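(* Let $n\ge 2$, $\alpha\in(0,1)$, and let $f\in C^\alpha(\mathbb{S}^n)$ be a positive function. Let $u$ be a solution of $$\Delta_{\mathbb{S}^n}u+nu=f\quad\text{on }\mathbb{S}^n .$$ Then $u$ is convex provided $$|f|_{C^\alpha(\mathbb{S}^n)}\le\gamma_{n,\alpha}\min_{\mathbb{S}^n}f ,$$ where $$\gamma_{n,\alpha}=\frac{\omega_n}{n(n+1)}\Big[\int_{\mathbb{R}^{n+1}}|y-\mathbf{e}_{n+1}|^{-n-1}\,|y|^{-1}\,\mathrm{dist}_{\mathbb{S}^n}^{\alpha}\big(y/|y|,\mathbf{e}_{n+1}\big)\,dy\Big]^{-1}.$$
   Context: $\omega_n=|\mathbb{S}^n|$ is the surface area of the unit sphere $\mathbb{S}^n\subset\mathbb{R}^{n+1}$; $\Delta_{\mathbb{S}^n}$ is the Laplace–Beltrami operator; $\mathbf{e}_{n+1}=(0,\dots,0,1)$; $\mathrm{dist}_{\mathbb{S}^n}(x,z)$ is the spherical (geodesic) distance between $x,z\in\mathbb{S}^n$, and $\mathrm{dist}_{\mathbb{S}^n}^\alpha$ is its $\alpha$-th power. $|f|_{C^\alpha(\mathbb{S}^n)}=\sup_{x\ne z\in\mathbb{S}^n}\frac{|f(x)-f(z)|}{\mathrm{dist}_{\mathbb{S}^n}^\alpha(x,z)}$ is the Hölder seminorm. A solution $u$ is called convex if $\nabla^2u+uI\ge0$ on $\mathbb{S}^n$, where $\nabla$ is the covariant derivative with respect to a local orthonormal frame on $\mathbb{S}^n$; equivalently, the degree-one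 homogeneous extension of $u$ to $\mathbb{R}^{n+1}$ is convex. *)

(* Defs.v *)
From HB Require Import structures.
From mathcomp Require Import all_boot all_order all_algebra.
From mathcomp Require Import all_classical all_reals all_analysis.

Set Implicit Arguments.
Unset Strict Implicit.
Unset Printing Implicit Defensive.

Import Order.TTheory GRing.Theory Num.Theory.
Import numFieldNormedType.Exports.

Local Open Scope classical_set_scope.
Local Open Scope ring_scope.

Lemma sigma_finite_product d1 d2 (T1 : measurableType d1) (T2 : measurableType d2)
    (R : realType) (m1 : {sigma_finite_measure set T1 -> \bar R})
    (m2 : {sigma_finite_measure set T2 -> \bar R}) :
  sigma_finite setT (m1 \x m2)%E.
Proof.
have /sigma_finiteP[F [TF ndF Foo]] := sigma_finiteT m1.
have /sigma_finiteP[G [TG ndG Goo]] := sigma_finiteT m2.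
exists (fun n => F n `*` G n).
  rewrite -setXTT TF TG predeqE => -[x y]; split=> [[/= [n _ Fnx] [k _ Gky]]|].
    exists (maxn n k) => //; split.
    - by move: x Fnx; exact/subsetPset/ndF/leq_maxl.
    - by move: y Gky; exact/subsetPset/ndG/leq_maxr.
  by move=> [n _ []/= ? ?]; split; exists n.
move=> k; have [? ?] := Foo k; have [? ?] := Goo k.
split; first exact: measurableX.
by rewrite product_measure1E// lte_mul_pinfty// ge0_fin_numE.
Qed.

Section lebesgue_tuple.
Context {R : realType}.
Local Notation mR := (measurableTypeR R).
Local Open Scope ereal_scope.

Definition cons_pair {n} (p : mR * n.-tuple mR) : n.+1.-tuple mR :=
  [tuple of p.1 :: p.2].

Lemma measurable_cons_pair n : measurable_fun [set: mR * n.-tuple mR] cons_pair.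
Proof. exact: measurable_cons. Qed.

Definition split_tuple {n} (t : n.+1.-tuple mR) : mR * n.-tuple mR :=
  (thead t, [tuple of behead t]).

Lemma measurable_split_tuple n : measurable_fun [set: n.+1.-tuple mR] split_tuple.
Proof.
apply/measurable_fun_pairP; split; last exact: measurable_behead.
exact: measurable_tnth.
Qed.

Lemma cons_pairK n : cancel (@cons_pair n) split_tuple.
Proof. by case=> x t; congr pair; apply: val_inj. Qed.

Section step.
Context {n : nat} (mu : {sigma_finite_measure set (n.-tuple mR) -> \bar R}).

Definition lebesgue_step : set (n.+1.-tuple mR) -> \bar R :=
  pushforward (@lebesgue_measure R \x mu) cons_pair.

Let pushed : {measure set (n.+1.-tuple mR) -> \bar R} :=
  measure_function_pushforward__canonical__measure_function_Measure
    (@lebesgue_measure R \x mu) (@measurable_cons_pair n).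

HB.instance Definition _ := isMeasure.Build _ _ _ lebesgue_step
  (measure0 pushed) (measure_ge0 pushed) (@measure_semi_sigma_additive _ _ _ pushed).

Let sigma_finite_step : sigma_finite setT lebesgue_step.
Proof.
have [F UF mF] : sigma_finite setT (@lebesgue_measure R \x mu) by exact: sigma_finite_product.
exists (fun k => split_tuple @^-1` F k).
  by rewrite -preimage_bigcup -UF preimage_setT.
move=> k; have [mFk Fk] := mF k; split.
  by rewrite -[X in measurable X]setTI; exact: measurable_split_tuple.
rewrite /lebesgue_step /pushforward -comp_preimage.
by rewrite (_ : _ \o _ = idfun) ?preimage_id//; apply/funext => p; exact: cons_pairK.
Qed.

HB.instance Definition _ := Measure_isSigmaFinite.Build _ _ _ lebesgue_step
  sigma_finite_step.
End step.

(* Lebesgue measure on R^n, as the n-fold product of the one-dimensional one *)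
Fixpoint lebesgue_tuple n : {sigma_finite_measure set (n.-tuple mR) -> \bar R} :=
  if n is m.+1 then lebesgue_step (lebesgue_tuple m) else \d_[tuple].

Lemma lebesgue_tuple_box n (A : 'I_n -> set mR) :
  (forall i, measurable (A i)) ->
  lebesgue_tuple n [set t | forall i, A i (tnth t i)] =
  \prod_(i < n) lebesgue_measure (A i).
Proof.
elim: n A => [|n IH] A mA /=.
  by rewrite big_ord0 diracE mem_set// => -[].
rewrite big_ord_recl -IH// -product_measure1E//; last first.
  rewrite (_ : [set _ | _] = \bigcap_(i in [set: 'I_n])
      ((@tnth n mR)^~ i @^-1` A (lift ord0 i))); last first.
    by apply/seteqP; split=> [t tA i _|t tA i]; exact: tA.
  apply: fin_bigcap_measurable => // i _.
  by rewrite -[X in measurable X]setTI; exact: measurable_tnth.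
congr (product_measure1 _ _ _); apply/seteqP; split=> [[x t] /= tA|[x t] /= [xA tA] i].
  by split=> [|i]; [exact: (tA ord0)|have := tA (lift ord0 i); rewrite tnthS].
by case: (unliftP ord0 i) => [j|] ->; rewrite ?tnthS.
Qed.

End lebesgue_tuple.

Section euclidean.
Context {R : realType}.
Local Notation mR := (measurableTypeR R).

Definition row_of_tuple {n} (t : n.-tuple mR) : 'rV[R]_n := \row_i tnth t i.

Definition volume {n} (A : set 'rV[R]_n) : \bar R :=
  lebesgue_tuple n (row_of_tuple @^-1` A).

Definition integral_Rn {n} (F : 'rV[R]_n -> R) : \bar R :=
  (\int[lebesgue_tuple n]_t (F (row_of_tuple t))%:E)%E.

Definition dot {n} (v w : 'rV[R]_n) : R := \sum_(i < n) v 0 i * w 0 i.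

(* The library norm `|v| on 'rV[R]_n is the sup norm. *)
Definition enorm {n} (v : 'rV[R]_n) : R := Num.sqrt (dot v v).

Definition normalize {n} (v : 'rV[R]_n) : 'rV[R]_n := (enorm v)^-1 *: v.

Definition basis_vec {n} (i : 'I_n) : 'rV[R]_n := delta_mx 0 i.

Definition C1_on {n} (A : set 'rV[R]_n.+1) (g : 'rV[R]_n.+1 -> R) : Prop :=
  forall (i : 'I_n.+1) x, A x ->
    derivable g x (basis_vec i) /\ {for x, continuous ('D_(basis_vec i) g)}.

Definition C2_on {n} (A : set 'rV[R]_n.+1) (g : 'rV[R]_n.+1 -> R) : Prop :=
  C1_on A g /\ forall i : 'I_n.+1, C1_on A ('D_(basis_vec i) g).

End euclidean.

(* A function on S^n is represented by a function on R^(n+1) of which only the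
   values on the sphere are ever used. *)
Section sphere.
Context {R : realType} {n : nat}.
Local Notation vec := 'rV[R]_n.+1.

Definition sphere : set vec := [set x | enorm x = 1].

Definition sphere_dist (x z : vec) : R := acos (dot x z).

(* Surface measure in polar coordinates: |A| = (n+1) vol {r x : x in A, 0 < r <= 1} *)
Definition sphere_measure (A : set vec) : \bar R :=
  (n.+1%:R%:E * volume [set y | (0 < enorm y <= 1)%R /\ A (normalize y)])%E.

Definition sphere_area : R := fine (sphere_measure sphere).

Definition holder_seminorm (alpha : R) (f : vec -> R) : \bar R :=
  ereal_sup [set s | exists x z, [/\ sphere x, sphere z, x <> z &
    s = (`|f x - f z| / sphere_dist x z `^ alpha)%:E]].

(* Equals the minimum whenever f is continuous on the sphere *)
Definition sphere_min (f : vec -> R) : R := inf (f @` sphere).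

Definition tangent (x v : vec) : Prop := dot x v = 0.

Definition tangent_proj (x v : vec) : vec := v - dot x v *: x.

(* Extension of a map on S^n to R^(n+1) \ {0}, homogeneous of degree 0 *)
Definition extend0 {T : Type} (u : vec -> T) : vec -> T := u \o normalize.

Definition C2_sphere (u : vec -> R) : Prop :=
  C2_on [set y : vec | y != 0] (extend0 u).

(* At x in S^n the Euclidean gradient of extend0 u is orthogonal to x, and so it
   is the gradient of u in the round metric. *)
Definition sphere_grad (u : vec -> R) (x : vec) : vec :=
  \row_i 'D_(basis_vec i) (extend0 u) x.

(* Levi-Civita connection of S^n: tangential part of the ambient derivative of
   the vector field X in the direction v in T_x S^n *)
Definition cov_deriv (X : vec -> vec) (x v : vec) : vec :=
  tangent_proj x ('D_v (extend0 X) x).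

Definition sphere_hess (u : vec -> R) (x v w : vec) : R :=
  dot (cov_deriv (sphere_grad u) x v) w.

(* Trace of the Hessian on T_x S^n: the projections of the standard basis
   vectors compute it as any orthonormal frame does, see sphere_laplacian_frame *)
Definition sphere_laplacian (u : vec -> R) (x : vec) : R :=
  \sum_i sphere_hess u x (tangent_proj x (basis_vec i))
                         (tangent_proj x (basis_vec i)).

(* nabla^2 u + u I >= 0 on S^n *)
Definition sphere_convex (u : vec -> R) : Prop :=
  forall x v : vec, sphere x -> tangent x v ->
    0 <= sphere_hess u x v v + u x * dot v v.

Definition north_pole : vec := basis_vec ord_max.

Definition gamma_integral (alpha : R) : \bar R :=
  integral_Rn (fun y : vec => enorm (y - north_pole) ^- n.+1 * (enorm y)^-1 *
                              sphere_dist (normalize y) north_pole `^ alpha).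

Definition gamma_const (alpha : R) : R :=
  sphere_area / (n * n.+1)%:R * (fine (gamma_integral alpha))^-1.

End sphere.

Arguments sphere {R} n.
Arguments sphere_area {R} n.
Arguments gamma_const {R} n alpha.

Section laplacian_frame.
Context {R : realType} {n : nat}.
Local Notation vec := 'rV[R]_n.+1.

Lemma dotE m (v w : 'rV[R]_m) : dot v w = (v *m w^T) 0 0.
Proof. by rewrite mxE; apply: eq_bigr => i _; rewrite mxE. Qed.

Lemma sphere_laplacian_frame (u : vec -> R) (x : vec) (E : 'I_n -> vec) :
  sphere n x -> differentiable (extend0 (sphere_grad u)) x ->
  (forall i, tangent x (E i)) -> (forall i j, dot (E i) (E j) = (i == j)%:R) ->
  sphere_laplacian u x = \sum_i sphere_hess u x (E i) (E i).
Proof.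
move=> xS dX Ex EE.
have xx : dot x x = 1.
  have dx : 0 <= dot x x by apply: sumr_ge0 => i _; rewrite -expr2 sqr_ge0.
  by rewrite -[LHS]sqr_sqrtr// (_ : Num.sqrt _ = 1) ?expr1n.
pose J : 'M[R]_n.+1 := 'J (extend0 (sphere_grad u)) x.
pose P : 'M[R]_n.+1 := 1%:M - x^T *m x.
pose B : 'M[R]_n.+1 := J *m P.
have projE v : tangent_proj x v = v *m P.
  rewrite /tangent_proj mulmxBr mulmx1 mulmxA; congr (_ - _).
  rewrite [v *m x^T]mx11_scalar mul_scalar_mx -dotE; congr (_ *: _).
  by apply: eq_bigr => i _; rewrite mulrC.
have hessE v w : sphere_hess u x v w = (v *m B *m w^T) 0 0.
  by rewrite /sphere_hess /cov_deriv dotE projE deriveEjacobian// !mulmxA.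
pose F : 'M[R]_(n, n.+1) := \matrix_i E i.
have FF : F *m F^T = 1%:M.
  by apply/matrixP => i j; rewrite mxE [RHS]mxE -EE; apply: eq_bigr => k _; rewrite !mxE.
have Fx : F *m x^T = 0.
  apply/matrixP => i j; rewrite mxE [RHS]mxE.
  transitivity (dot x (E i)); last exact: Ex.
  apply: eq_bigr => k _.
  by rewrite !mxE ord1 mulrC.
have QQ : (col_mx x F : 'M[R]_(1 + n, 1 + n)) *m (col_mx x F)^T = 1%:M.
  rewrite tr_col_mx mul_col_row Fx FF -[x *m F^T]trmxK trmx_mul trmxK Fx trmx0.
  rewrite [x *m x^T]mx11_scalar -dotE xx.
  by rewrite -scalar_mx_block.
have PE : P = F^T *m F.
  have := mulmx1C QQ; rewrite tr_col_mx mul_row_col /P => <-.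
  by rewrite addrC addKr.
have PT : P^T = P by rewrite PE trmx_mul trmxK.
have trE m (A : 'M[R]_(m, n.+1)) : \tr (A *m B *m A^T) =
    \sum_i sphere_hess u x (row i A) (row i A).
  rewrite /mxtrace; apply: eq_bigr => i _; rewrite hessE tr_row -!row_mul.
  rewrite [LHS]mxE 2![RHS]mxE; apply: eq_bigr => k _.
  by congr (_ * _); rewrite [RHS]mxE.
transitivity (\tr (P *m B *m P^T)).
  rewrite trE; apply: eq_bigr => i _; rewrite !projE /basis_vec -rowE.
  by [].
rewrite PT mxtrace_mulC mulmxA.
have -> : P *m P = P by rewrite PE !mulmxA -(mulmxA F^T F) FF mulmx1.
rewrite {1}PE -!mulmxA mxtrace_mulC trE.
by apply: eq_bigr => i _; rewrite rowK.
Qed.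

End laplacian_frame.

(* Main.v *)
(* Let x be a point of S^n, xi a unit tangent vector at x, c = f(x)/n, and extend
   u to be homogeneous of degree 0. The function W(y) = |y| (u(y/|y|) - c) has
   Laplacian (f(y/|y|) - f(x)) / |y|, and W_{xi xi}(x) = u_{xi xi}(x) + u(x) - c.
   With B the unit ball, a compactly supported W with Delta W (x) = 0 satisfies
     |B| |W_{xi xi}(x)| <= int |Delta W(y)| |y - x|^(-n-1) dy.
   Indeed, for G(z) = - (1 + |z|^2)^(-(n-1)/2) / (n-1), the integral of
   W_{xi xi}(x + eps z) Delta G(z) equals that of Delta W(x + eps z) G_{xi xi}(z),
   because symmetric second differences commute and are symmetric under the
   integral; as eps tends to 0 the left side tends to W_{xi xi}(x) int Delta G,
   where int Delta G = (n+1) |B|, while |G_{xi xi}(z)| <= (n+1) |z|^(-n-1).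
   Replacing the factor |y| of W by cutoffs k(|y|) costs an error that vanishes
   in the limit, so the Hoelder bound on f gives
     |B| |u_{xi xi} + u - c| <= |f|_{C^alpha} I_x,
   where I_x, the integral in gamma with x in place of the pole, does not depend
   on x, by a reflection exchanging x and the pole. Since omega_n = (n+1) |B|, the
   hypothesis bounds the right side by |B| c, whence u_{xi xi} + u >= 0. *)
Require Import Defs.
From HB Require Import structures.
From mathcomp Require Import all_boot all_order all_algebra.
From mathcomp Require Import all_classical all_reals all_analysis.
From mathcomp Require Import measurable_realfun.
From mathcomp Require Import ring lra.

Set Implicit Arguments.
Unset Strict Implicit.
Unset Printing Implicit Defensive.

Import Order.TTheory GRing.Theory Num.Theory.
Import numFieldNormedType.Exports.

Local Open Scope classical_set_scope.
Local Open Scope ring_scope.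

(** * Lebesgue measure on R^n *)

(** Why c = f(x)/n: a function |y| (u - c) of degree one has Laplacian (Delta_S + n)(u - c)/|y|, and
    n c = f(x), so it vanishes at x and grows there only like dist^alpha, which tames |y -
    x|^(-n-1). The obstacle is that the second derivatives of the Newtonian kernel have exactly this
    critical, non-integrable order. The smooth G has bounded continuous second derivatives, so
    difference quotients converge under the integral by domination, and integration by parts reduces
    to translation invariance of Lebesgue measure. The singular kernel reappears only as a pointwise
    bound, after rescaling. The factor n+1 of that bound cancels against Delta G = (n+1) (1 +
    |z|^2)^(-(n+3)/2), whose integral is a layer-cake computation. W is neither compactly supported
    nor smooth at 0, so it is cut off to 1/L < |y| < 2L. The inner ramp adds to Delta W a term of
    order L on a volume L^(-n-1): error L^(-n). The outer ramp adds order 1/L on a volume L^(n+1)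
    with weight L^(-n-1): error 1/L. *)

Section boxes.
Context {R : realType}.
Local Notation mR := (measurableTypeR R).

Definition box n (A : 'I_n -> set mR) : set (n.-tuple mR) :=
  [set t | forall i, A i (tnth t i)].

Lemma measurable_box n (A : 'I_n -> set mR) :
  (forall i, measurable (A i)) -> measurable (box A).
Proof.
move=> mA; rewrite (_ : box A = \bigcap_(i in [set: 'I_n])
    ((@tnth n mR)^~ i @^-1` (A i))); last first.
  by apply/seteqP; split=> [t tA i _|t tA i]; exact: tA.
apply: fin_bigcap_measurable => // i _.
by rewrite -[X in measurable X]setTI; exact: measurable_tnth.
Qed.

(** Uniqueness of measures is tested on a generating family stable under intersection. Boxes are
    stable, and each coordinate preimage defining the product sigma-algebra is a box whose other
    sides are the whole line. *)
Lemma measurable_tupleE n : @measurable _ (n.-tuple mR) =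
  <<s [set B | exists2 A, (forall i, measurable (A i)) & B = @box n A] >>.
Proof.
apply/seteqP; split; last first.
  apply: smallest_sub; first exact: sigma_algebra_measurable.
  by move=> _ [A mA ->]; exact: measurable_box.
apply: smallest_sub; first exact: smallest_sigma_algebra.
case: n => [|n]; first by rewrite big_ord0.
rewrite -bigcup_mkord_ord; apply: bigcup_sub => i /= ni B [C mC <-].
apply: sub_sigma_algebra.
exists (fun j => if j == inord i then C else setT).
  by move=> j; case: ifP => // _; exact: measurableT.
rewrite setTI; apply/seteqP; split=> t /=.
  by move=> tC j; case: ifPn => // /eqP ->.
by move=> /(_ (inord i)); rewrite eqxx.
Qed.

Lemma volume_box n (A : 'I_n -> set mR) : (forall i, measurable (A i)) ->
  (lebesgue_tuple n (box A) = \prod_(i < n) (@lebesgue_measure R (A i)))%E.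
Proof. exact: lebesgue_tuple_box. Qed.

Lemma lebesgue_tuple_unique n (m : {measure set (n.-tuple mR) -> \bar R}) :
  (forall A : 'I_n -> set mR, (forall i, measurable (A i)) ->
     m (box A) = \prod_(i < n) (@lebesgue_measure R (A i)))%E ->
  forall E, measurable E -> lebesgue_tuple n E = m E.
Proof.
move=> mbox E mE.
pose g k : set (n.-tuple mR) := box (fun=> [set` `[- (k%:R : R), k%:R]]).
apply: (measure_unique _ g (@measurable_tupleE n)) => //.
- move=> _ _ [A mA ->] [B mB ->]; exists (fun i => A i `&` B i).
    by move=> i; exact: measurableI.
  apply/seteqP; split=> [t [tA tB] i|t tAB]; first by split.
  by split=> i; have [] := tAB i.
- by move=> k; exists (fun=> [set` `[- (k%:R : R), k%:R]]).
- apply/seteqP; split=> // t _.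
  pose M := \sum_(i < n) `|tnth t i|.
  have M0 : 0 <= M by apply: sumr_ge0.
  exists (Num.truncn M).+1 => // i /=.
  rewrite in_itv /= -ler_norml.
  rewrite (le_trans _ (ltW (truncnS_gt _)))//.
  by rewrite /M (bigD1 i)//= lerDl sumr_ge0.
- move=> _ [A mA ->]; rewrite mbox//; exact: volume_box.
- move=> k; rewrite [X in (X < _)%E]volume_box//.
  have fin : (@lebesgue_measure R [set` `[- (k%:R : R), k%:R]]) = (k%:R *+ 2)%:E.
    rewrite lebesgue_measure_itv/= lte_fin; case: ifPn => [_|].
      by rewrite -EFinB opprK mulr2n.
    rewrite -leNgt => k0; have : k%:R = 0 :> R by have := ler0n R k; lra.
    by move=> ->; rewrite mul0rn.
  under eq_bigr do rewrite fin.
  by rewrite prodEFin ltry.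
Qed.

End boxes.

Section coordinates.
Context {R : realType}.
Local Notation mR := (measurableTypeR R).

Definition tuple_of_row n (v : 'rV[R]_n) : n.-tuple mR := [tuple v 0 i | i < n].

Lemma tuple_of_rowK n : cancel (@tuple_of_row n) row_of_tuple.
Proof. by move=> v; apply/rowP => i; rewrite mxE tnth_mktuple. Qed.

Lemma measurable_fun_tuple_of_row d (T : measurableType d) n (f : T -> 'rV[R]_n) :
  (forall i, measurable_fun setT (fun x => f x 0 i : mR)) ->
  measurable_fun setT (@tuple_of_row n \o f).
Proof.
move=> mf; apply/measurable_fun_tnthP => i.
by apply: eq_measurable_fun (mf i) => x _ /=; rewrite tnth_mktuple.
Qed.

Lemma measurable_coord n (i : 'I_n) :
  measurable_fun setT (fun t => row_of_tuple t 0 i : mR).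
Proof.
by apply: eq_measurable_fun (measurable_tnth i) => t _; rewrite mxE.
Qed.

(** Balls of the sup norm are boxes, and those with rational centre and radius 1/(m+1) form a
    countable base, so an open set is a countable union of boxes. *)
Lemma open_measurable_rV n (O : set 'rV[R]_n) :
  open O -> measurable (@row_of_tuple R n @^-1` O).
Proof.
move=> oO.
pose B (p : 'rV[rat]_n * nat) : set (n.-tuple mR) :=
  box (fun i => ball (ratr (p.1 0 i) : R) (p.2.+1%:R^-1)).
pose C (p : 'rV[rat]_n * nat) : set (n.-tuple mR) :=
  if `[< B p `<=` @row_of_tuple R n @^-1` O >] then B p else set0.
rewrite (_ : _ @^-1` O = \bigcup_(p in setT) C p); last first.
  apply/seteqP; split=> t /=; last first.
    by move=> [p _]; rewrite /C; case: asboolP => // + Bt; exact.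
  move=> Ot.
  have /nbhs_ballP[e /= e0 eO] : nbhs (row_of_tuple t) O by exact: open_nbhs_nbhs.
  have [m me] : exists m, m.+1%:R^-1 < e / 2.
    exists (Num.truncn (e / 2)^-1); rewrite invf_plt ?posrE ?divr_gt0//.
    exact: truncnS_gt.
  have m0 : 0 < m.+1%:R^-1 :> R by rewrite invr_gt0.
  have /choice[q qt] i : exists q : rat, ball (ratr q : R) m.+1%:R^-1 (tnth t i).
    move: m0; move: (m.+1%:R^-1 : R) => d d0 {me}; move: (tnth t i : R) => x.
    have tt : x - d < x + d by lra.
    have [q] := rat_in_itvoo tt; rewrite in_itv /= => /andP[q1 q2]; exists q.
    by rewrite /ball /= ltr_norml; apply/andP; split; lra.
  exists (\row_i q i, m) => //; rewrite /C; case: asboolP => [_ i|].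
    by rewrite /= mxE; exact: qt.
  case=> s Bs /=; apply: eO; split=> //= i j; rewrite !mxE.
  have := qt j; have := Bs j; rewrite /= mxE /ball /=.
  move: (tnth s j : R) (tnth t j : R) (ratr (q j) : R) (m.+1%:R^-1) me => a b r d me.
  rewrite !ltr_norml => /andP[a1 a2] /andP[b1 b2]; apply/andP; split; lra.
apply: countable_bigcupT_measurable; first exact: countableP.
move=> p; rewrite /C; case: ifP => // _; apply: measurable_box => i.
exact: measurable_ball.
Qed.

Lemma continuous_measurable_rV n (g : 'rV[R]_n -> R) :
  continuous g -> measurable_fun setT (g \o row_of_tuple).
Proof.
move=> /continuousP cg; apply: (measurability _ (RGenOpens.measurableE R)).
move=> _ [_ [a [b ->] <-]]; rewrite setTI comp_preimage.
by apply: open_measurable_rV; exact/cg/interval_open.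
Qed.

End coordinates.

(** * Affine and linear changes of variables *)

Section affine.
Context {R : realType}.
Local Notation mR := (measurableTypeR R).
Local Notation leb := (@lebesgue_measure R).

Lemma lebesgue_measure_affine (l a : R) (A : set mR) : 0 < l -> measurable A ->
  leb ((fun x => l * x + a) @^-1` A) = (l^-1%:E * leb A)%E.
Proof.
move=> l0 mA.
pose h : mR -> mR := fun x => l * x + a.
have mh : measurable_fun setT h.
  by apply: measurable_funD => //; exact: mulrl_measurable.
pose m1 : {measure set mR -> \bar R} :=
  measure_function_pushforward__canonical__measure_function_Measure leb mh.
pose m2 : {measure set mR -> \bar R} := mscale (NngNum (ltW l0)) m1.
have E : forall B, measurable B -> leb B = m2 B.
  apply: lebesgue_measure_unique => _ [[b c] /= _ <-].
  rewrite /m2 /mscale /= /m1 /pushforward /=.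
  rewrite (_ : h @^-1` _ = `](b - a) / l, (c - a) / l]%classic); last first.
    apply/seteqP; split=> x /=; rewrite !in_itv /= ltr_pdivrMr// ler_pdivlMr// /h;
      by rewrite (mulrC x) => /andP[H1 H2]; apply/andP; split; lra.
  rewrite !lebesgue_measure_itv /= !lte_fin ltr_pM2r ?invr_gt0// ltrD2r.
  case: ifPn => _; last by rewrite mule0.
  by rewrite -!EFinB -EFinM; congr EFin; field; rewrite gt_eqF.
by rewrite (E A mA) /m2 /mscale /= muleA -EFinM mulVf ?gt_eqF// mul1e.
Qed.

Definition affine_tuple n (l : R) (a : 'rV[R]_n) (t : n.-tuple mR) :=
  tuple_of_row (l *: row_of_tuple t + a).

Lemma measurable_affine_tuple n (l : R) (a : 'rV[R]_n) :
  measurable_fun setT (affine_tuple l a).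
Proof.
apply: (@measurable_fun_tuple_of_row _ _ _ _ (fun t => l *: row_of_tuple t + a)) => i.
apply: (@eq_measurable_fun _ _ _ _ _ (fun t => l * (row_of_tuple t 0 i) + a 0 i)).
  by move=> t _; rewrite !mxE.
apply: measurable_funD => //; apply: measurable_funM => //; exact: measurable_coord.
Qed.

(** The image measure times [l ^+ n] agrees with Lebesgue measure on boxes, one factor [l] per side,
    hence everywhere. *)
Lemma lebesgue_tuple_affine n (l : R) (a : 'rV[R]_n) A : 0 < l -> measurable A ->
  lebesgue_tuple n (affine_tuple l a @^-1` A) = ((l ^- n)%:E * lebesgue_tuple n A)%E.
Proof.
move=> l0 mA.
pose m1 : {measure set (n.-tuple mR) -> \bar R} :=
  measure_function_pushforward__canonical__measure_function_Measure
    (lebesgue_tuple n) (measurable_affine_tuple l a).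
have ln0 : 0 <= l ^+ n by rewrite exprn_ge0// ltW.
pose m2 : {measure set (n.-tuple mR) -> \bar R} := mscale (NngNum ln0) m1.
have E : forall B, measurable B -> lebesgue_tuple n B = m2 B.
  apply: lebesgue_tuple_unique => B mB.
  have -> : m2 (box B) = ((l ^+ n)%:E * lebesgue_tuple n (affine_tuple l a @^-1` box B))%E by [].
  rewrite [X in lebesgue_tuple n X](_ : _ = box (fun i => (fun x => l * x + a 0 i) @^-1` B i)); last first.
    by apply/seteqP; split=> t /= Bt i; have := Bt i; rewrite /affine_tuple tnth_mktuple !mxE.
  rewrite volume_box; last first.
    move=> i; rewrite -[X in measurable X]setTI.
    have : measurable_fun setT (fun x : mR => l * x + a 0 i : mR).
      by apply: measurable_funD => //; exact: mulrl_measurable.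
    exact.
  under eq_bigr do rewrite lebesgue_measure_affine//.
  rewrite big_split/= prodEFin prodr_const card_ord muleA -EFinM -exprMn mulfV ?gt_eqF//.
  by rewrite expr1n mul1e.
rewrite (E A mA) /m2 /mscale /= muleA -EFinM mulVf ?mul1e//.
by rewrite expf_neq0// gt_eqF.
Qed.

Lemma ge0_integral_affine n (l : R) (a : 'rV[R]_n) (F : 'rV[R]_n -> \bar R) :
  0 < l -> measurable_fun setT (F \o row_of_tuple) -> (forall y, 0 <= F y)%E ->
  (\int[lebesgue_tuple n]_t F (l *: row_of_tuple t + a)%R =
   (l ^- n)%:E * \int[lebesgue_tuple n]_t F (row_of_tuple t))%E.
Proof.
move=> l0 mF F0.
have ln0 : 0 <= l ^- n by rewrite invr_ge0 exprn_ge0// ltW.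
transitivity (\int[pushforward (lebesgue_tuple n) (affine_tuple l a)]_t
    F (row_of_tuple t))%E.
  rewrite ge0_integral_pushforward//; last exact: measurable_affine_tuple.
  by apply: eq_integral => t _ /=; rewrite /affine_tuple tuple_of_rowK.
pose m2 : {measure set (n.-tuple mR) -> \bar R} := mscale (NngNum ln0) (lebesgue_tuple n).
transitivity (\int[m2]_t F (row_of_tuple t))%E.
  apply: eq_measure_integral; first exact: measurable_affine_tuple.
  by move=> mh A mA _; exact: (lebesgue_tuple_affine a l0 mA).
by rewrite ge0_integral_mscale.
Qed.

Lemma integral_translate n (a : 'rV[R]_n) (F : 'rV[R]_n -> \bar R) :
  measurable_fun setT (F \o row_of_tuple) ->
  (\int[lebesgue_tuple n]_t F (row_of_tuple t + a)%R =
   \int[lebesgue_tuple n]_t F (row_of_tuple t))%E.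
Proof.
move=> mF.
have T G : measurable_fun setT (G \o row_of_tuple) -> (forall y, 0 <= G y)%E ->
    (\int[lebesgue_tuple n]_t G (row_of_tuple t + a)%R =
     \int[lebesgue_tuple n]_t G (row_of_tuple t))%E.
  move=> mG G0; have := @ge0_integral_affine n 1 a G ltr01 mG G0.
  rewrite expr1n invr1 mul1e => <-.
  by apply: eq_integral => t _; rewrite scale1r.
rewrite integralE [RHS]integralE; congr (_ - _)%E.
  under eq_integral do rewrite funeposE.
  rewrite (T (fun y => maxe (F y) 0%E)) => [||y]; last by rewrite le_max lexx orbT.
    by apply: eq_integral => t _; rewrite funeposE.
  exact: measurable_maxe.
under eq_integral do rewrite funenegE.
rewrite (T (fun y => maxe (- F y)%E 0%E)) => [||y]; last by rewrite le_max lexx orbT.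
  by apply: eq_integral => t _; rewrite funenegE.
by apply: measurable_maxe => //; exact: measurableT_comp.
Qed.

End affine.

Section linear.
Context {R : realType} {n : nat}.
Local Notation mR := (measurableTypeR R).
Local Notation mu := (lebesgue_tuple n : {measure set (n.-tuple mR) -> \bar R}).

Lemma measurable_fun_comp_row d (T : measurableType d) (h : T -> 'rV[R]_n)
    (F : 'rV[R]_n -> \bar R) :
  measurable_fun setT (F \o row_of_tuple) ->
  (forall i, measurable_fun setT (fun x => h x 0 i : mR)) ->
  measurable_fun setT (F \o h).
Proof.
move=> mF mh.
rewrite (_ : F \o h = (F \o row_of_tuple) \o (@tuple_of_row R n \o h)).
  exact: measurableT_comp (measurable_fun_tuple_of_row mh).
by apply/funext => x /=; rewrite tuple_of_rowK.
Qed.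

Lemma measurable_coordD d (T : measurableType d) (h k : T -> 'rV[R]_n) i :
  measurable_fun setT (fun x => h x 0 i : mR) ->
  measurable_fun setT (fun x => k x 0 i : mR) ->
  measurable_fun setT (fun x => (h x + k x) 0 i : mR).
Proof.
move=> mh mk; rewrite (_ : (fun x => _) = fun x => h x 0 i + k x 0 i).
  exact: measurable_funD.
by apply/funext => x; rewrite mxE.
Qed.

Lemma measurable_coordN d (T : measurableType d) (h : T -> 'rV[R]_n) i :
  measurable_fun setT (fun x => h x 0 i : mR) ->
  measurable_fun setT (fun x => (- h x) 0 i : mR).
Proof.
move=> mh; rewrite (_ : (fun x => _) = fun x => - h x 0 i).
  exact: measurable_funN.
by apply/funext => x; rewrite mxE.
Qed.

Lemma measurable_coord_mulmx d (T : measurableType d) (h : T -> 'rV[R]_n) (A : 'M[R]_n) i :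
  (forall i, measurable_fun setT (fun x => h x 0 i : mR)) ->
  measurable_fun setT (fun x => (h x *m A) 0 i : mR).
Proof.
move=> mh; rewrite (_ : (fun x => _) = fun x => \sum_j h x 0 j * A j i).
  by apply: measurable_sum => j; apply: measurable_funM => //; exact: mh.
by apply/funext => x; rewrite mxE.
Qed.

(* Uniqueness of the Haar measure: integrate [f y * F (z A + y)] over both
   variables, translating first in [z] and then in [y]. *)
Lemma ge0_integral_mulmx (A B : 'M[R]_n) (f F : 'rV[R]_n -> \bar R) :
  B *m A = 1%:M ->
  measurable_fun setT (f \o row_of_tuple) -> (forall y, 0 <= f y)%E ->
  (forall y, f (- y) = f y) ->
  measurable_fun setT (F \o row_of_tuple) -> (forall y, 0 <= F y)%E ->
  (\int[mu]_t f (row_of_tuple t) * \int[mu]_t F (row_of_tuple t *m A) =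
   \int[mu]_t F (row_of_tuple t) * \int[mu]_t f (row_of_tuple t *m A))%E.
Proof.
move=> BA mf f0 fN mF F0.
have mT (G : 'rV[R]_n -> \bar R) : measurable_fun setT (G \o row_of_tuple) ->
    measurable_fun setT ((fun y => G (y *m A)) \o row_of_tuple).
  move=> mG; apply: measurable_fun_comp_row mG _ => i.
  by apply: measurable_coord_mulmx => j; exact: measurable_coord.
pose H (p : n.-tuple mR * n.-tuple mR) :=
  (f (row_of_tuple p.1) * F (row_of_tuple p.2 *m A + row_of_tuple p.1)%R)%E.
pose K (p : n.-tuple mR * n.-tuple mR) :=
  (f (row_of_tuple p.1 - row_of_tuple p.2 *m A)%R * F (row_of_tuple p.1))%E.
have m1 i : measurable_fun setT
    (fun p : n.-tuple mR * n.-tuple mR => row_of_tuple p.1 0 i : mR).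
  exact: measurableT_comp (measurable_coord i) _.
have m2 i : measurable_fun setT
    (fun p : n.-tuple mR * n.-tuple mR => (row_of_tuple p.2 *m A) 0 i : mR).
  apply: (@measurable_coord_mulmx _ _ (fun p : n.-tuple mR * n.-tuple mR => row_of_tuple p.2)).
  by move=> j; exact: measurableT_comp (measurable_coord j) _.
have mH : measurable_fun setT H.
  apply: emeasurable_funM; apply: measurable_fun_comp_row => // i.
  exact: measurable_coordD.
have mK : measurable_fun setT K.
  apply: emeasurable_funM; apply: measurable_fun_comp_row => // i.
  by apply: measurable_coordD => //; exact: measurable_coordN.
transitivity (\int[mu]_y \int[mu]_z H (y, z))%E.
  rewrite -ge0_integralZr//; last exact: integral_ge0.
  apply: eq_integral => y _.
  rewrite /H/= ge0_integralZl//=.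
  - congr (_ * _)%E.
    (* Shifting [z] by [y B] turns [z A] into [z A + y], because [B A = 1]. *)
    rewrite -(integral_translate (row_of_tuple y *m B) (mT _ mF)).
    by apply: eq_integral => z _; rewrite mulmxDl -mulmxA BA mulmx1.
  - apply: measurable_fun_comp_row => // i.
    apply: measurable_coordD => //; apply: measurable_coord_mulmx => j.
    exact: measurable_coord.
rewrite fubini_tonelli//; last by move=> p; apply: mule_ge0.
transitivity (\int[mu]_z \int[mu]_y K (y, z))%E.
  apply: eq_integral => z _.
  rewrite -(@integral_translate _ n (row_of_tuple z *m A)
    (fun y => f (y - row_of_tuple z *m A)%R * F y)%E).
    by apply: eq_integral => y _; rewrite /H/= addrK [X in F X]addrC.
  apply: emeasurable_funM => //; apply: (measurable_fun_comp_row mf) => i.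
  by apply: measurable_coordD => //; exact: measurable_coord.
rewrite -fubini_tonelli//; last by move=> p; apply: mule_ge0.
rewrite -ge0_integralZr//; last exact: integral_ge0.
apply: eq_integral => y _.
rewrite /K/=; under eq_integral do rewrite muleC.
have mfy : measurable_fun setT
    (fun z : n.-tuple mR => f (row_of_tuple y - row_of_tuple z *m A)).
  apply: (measurable_fun_comp_row mf) => i; apply: measurable_coordD => //.
  by apply: measurable_coordN; apply: measurable_coord_mulmx => j; exact: measurable_coord.
rewrite ge0_integralZl//=; congr (_ * _)%E.
(* Since [f] is even, [f (y - z A)] is [f (z A - y)], which is [f (z A)] after a shift of [z] by
   [- y B]. *)
rewrite -(integral_translate (- (row_of_tuple y *m B)) (mT _ mf)).
apply: eq_integral => z _; rewrite mulmxDl mulNmx -mulmxA BA mulmx1 -fN.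
by rewrite opprB.
Qed.

End linear.

(** * Euclidean norm and balls *)

Section euclidean_norm.
Context {R : realType} {n : nat}.
Implicit Types v w y : 'rV[R]_n.

Lemma dotC v w : dot v w = dot w v.
Proof. by apply: eq_bigr => i _; rewrite mulrC. Qed.

Lemma dotDl v w y : dot (v + w) y = dot v y + dot w y.
Proof. by rewrite -big_split/=; apply: eq_bigr => i _; rewrite mxE mulrDl. Qed.

Lemma dotZl a v y : dot (a *: v) y = a * dot v y.
Proof. by rewrite mulr_sumr; apply: eq_bigr => i _; rewrite mxE mulrA. Qed.

Lemma dotNl v y : dot (- v) y = - dot v y.
Proof. by rewrite -scaleN1r dotZl mulN1r. Qed.

Lemma dotBl v w y : dot (v - w) y = dot v y - dot w y.
Proof. by rewrite dotDl dotNl. Qed.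

Lemma dotDr v w y : dot y (v + w) = dot y v + dot y w.
Proof. by rewrite dotC dotDl !(dotC y). Qed.

Lemma dotZr a v y : dot y (a *: v) = a * dot y v.
Proof. by rewrite dotC dotZl dotC. Qed.

Lemma dotNr v y : dot y (- v) = - dot y v.
Proof. by rewrite dotC dotNl dotC. Qed.

Lemma dotBr v w y : dot y (v - w) = dot y v - dot y w.
Proof. by rewrite dotDr dotNr. Qed.

Lemma dot0l y : dot 0 y = 0.
Proof. by apply: big1 => i _; rewrite mxE mul0r. Qed.

Lemma dot0r y : dot y 0 = 0.
Proof. by rewrite dotC dot0l. Qed.

Lemma dot_ge0 v : 0 <= dot v v.
Proof. by apply: sumr_ge0 => i _; rewrite -expr2 sqr_ge0. Qed.

Lemma dot_basis v i : dot v (basis_vec i) = v 0 i.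
Proof.
rewrite /dot (bigD1 i)//= !mxE !eqxx mulr1 big1 ?addr0// => j ji.
by rewrite mxE (negPf ji) mulr0.
Qed.

Lemma enorm_ge0 v : 0 <= enorm v.
Proof. exact: sqrtr_ge0. Qed.

Lemma sqr_enorm v : enorm v ^+ 2 = dot v v.
Proof. by rewrite sqr_sqrtr// dot_ge0. Qed.

Lemma enorm0 : enorm (0 : 'rV[R]_n) = 0.
Proof. by rewrite /enorm dot0l sqrtr0. Qed.

Lemma enorm_eq0 v : (enorm v == 0) = (v == 0).
Proof.
apply/idP/eqP => [|->]; last by rewrite enorm0.
rewrite sqrtr_eq0 => v0; apply/rowP => i; rewrite mxE.
have /psumr_eq0P : dot v v = 0 by apply/eqP; rewrite eq_le v0 dot_ge0.
move=> H; apply/eqP; rewrite -sqrf_eq0 expr2 H// => j _.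
by rewrite -expr2 sqr_ge0.
Qed.

Lemma enorm_gt0 v : (0 < enorm v) = (v != 0).
Proof. by rewrite lt_def enorm_ge0 andbT enorm_eq0. Qed.

Lemma enormZ a v : enorm (a *: v) = `|a| * enorm v.
Proof. by rewrite /enorm dotZl dotZr mulrA -expr2 sqrtrM ?sqr_ge0// sqrtr_sqr. Qed.

Lemma enormN v : enorm (- v) = enorm v.
Proof. by rewrite -scaleN1r enormZ normrN1 mul1r. Qed.

Lemma cauchy_schwarz v w : dot v w ^+ 2 <= dot v v * dot w w.
Proof.
have [->|v0] := eqVneq v 0; first by rewrite !dot0l expr0n mul0r.
have p : 0 < dot v v by rewrite -sqr_enorm exprn_gt0// enorm_gt0.
(* This square equals [dot v v] times the difference of the two sides of the claim. *)
have := dot_ge0 (dot v v *: w - dot v w *: v).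
rewrite dotBl !dotBr !dotZl !dotZr (dotC w v).
move: (dot v v) (dot v w) (dot w w) p => a b c p H.
rewrite -subr_ge0 -(pmulr_rge0 _ p).
by apply: le_trans H _; rewrite le_eqVlt; apply/orP; left; apply/eqP; ring.
Qed.

Lemma ler_dot_enorm v w : `|dot v w| <= enorm v * enorm w.
Proof.
rewrite -sqrtr_sqr -sqrtrM ?dot_ge0// ler_wsqrtr//; exact: cauchy_schwarz.
Qed.

Lemma ler_enormD v w : enorm (v + w) <= enorm v + enorm w.
Proof.
rewrite -(ler_pXn2r (ltn0Sn 1)) ?nnegrE ?addr_ge0 ?enorm_ge0//.
rewrite sqr_enorm sqrrD !sqr_enorm dotDl !dotDr (dotC w v).
have := le_trans (ler_norm _) (ler_dot_enorm v w); lra.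
Qed.

Lemma ler_enormB v w : enorm v - enorm w <= enorm (v - w).
Proof. by rewrite lerBlDr -{1}(subrK w v) ler_enormD. Qed.

Lemma ler_coord_enorm v i : `|v 0 i| <= enorm v.
Proof.
rewrite -sqrtr_sqr ler_wsqrtr// /dot (bigD1 i)//= -expr2 lerDl.
by apply: sumr_ge0 => j _; rewrite -expr2 sqr_ge0.
Qed.

Lemma ler_norm_enorm v : `|v| <= enorm v.
Proof.
rewrite [leLHS]mx_normrE; apply: bigmax_le => [|[i j] _ /=]; first exact: enorm_ge0.
by rewrite ord1 ler_coord_enorm.
Qed.

Lemma continuous_coord i : continuous (fun v : 'rV[R]_n => v 0 i).
Proof. exact: coord_continuous. Qed.

Lemma continuous_dot (V : topologicalType) (h k : V -> 'rV[R]_n) x :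
  {for x, continuous h} -> {for x, continuous k} ->
  {for x, continuous (fun t => dot (h t) (k t))}.
Proof.
move=> ch ck; rewrite /dot.
apply: cvg_big => [|i _]; first exact: add_continuous.
apply: cvgM; first exact: (continuous_comp ch (@continuous_coord i (h x))).
exact: (continuous_comp ck (@continuous_coord i (k x))).
Qed.

Lemma continuous_enorm : continuous (@enorm R n).
Proof.
move=> v; apply: (@continuous_comp _ _ _ (fun v => dot v v) Num.sqrt v).
  by apply: continuous_dot => //; exact: cvg_id.
exact: sqrt_continuous.
Qed.

End euclidean_norm.

Section normalize.
Context {R : realType} {n : nat}.
Implicit Types v w y : 'rV[R]_n.

Lemma enorm_normalize v : v != 0 -> enorm (normalize v) = 1.
Proof.
move=> v0; have p : 0 < enorm v by rewrite enorm_gt0.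
by rewrite enormZ ger0_norm ?invr_ge0 ?ltW// mulVf// gt_eqF.
Qed.

Lemma normalize_sphere v : enorm v = 1 -> normalize v = v.
Proof. by rewrite /normalize => ->; rewrite invr1 scale1r. Qed.

Lemma normalizeZ a v : 0 < a -> normalize (a *: v) = normalize v.
Proof.
move=> a0; rewrite /normalize enormZ gtr0_norm// scalerA invfM.
by rewrite mulrAC mulVf ?mul1r// gt_eqF.
Qed.

Lemma dot_normalizeK v : v != 0 -> enorm v *: normalize v = v.
Proof. by move=> v0; rewrite scalerA mulfV ?scale1r// enorm_eq0. Qed.

End normalize.

(** * Volumes of balls and the area of the sphere *)

Section balls.
Context {R : realType} {n : nat}.
Local Notation mR := (measurableTypeR R).
Local Notation mu := (lebesgue_tuple n : {measure set (n.-tuple mR) -> \bar R}).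

Definition eball r : set (n.-tuple mR) := [set t | enorm (row_of_tuple t) <= r].

Lemma measurable_enorm : measurable_fun setT (fun t : n.-tuple mR => enorm (row_of_tuple t)).
Proof. exact: continuous_measurable_rV continuous_enorm. Qed.

Lemma measurable_eball r : measurable (eball r).
Proof.
rewrite -[X in measurable X]setTI; apply: (measurable_enorm _ (measurable_itv `]-oo, r])) => //.
Qed.

Lemma volume_eball r : 0 < r -> mu (eball r) = ((r ^+ n)%:E * mu (eball 1%R))%E.
Proof.
move=> r0; have ri : 0 < r^-1 by rewrite invr_gt0.
have := lebesgue_tuple_affine 0 ri (measurable_eball 1).
rewrite exprVn invrK => <-; congr (lebesgue_tuple n _).
apply/seteqP; split=> t; rewrite /eball /= /affine_tuple tuple_of_rowK addr0 enormZ;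
  by rewrite gtr0_norm// ler_pdivrMl// mulr1.
Qed.

Lemma volume_eball1_lty : (mu (eball 1%R) < +oo)%E.
Proof.
apply: (@le_lt_trans _ _ (mu (box (fun=> [set` `[- (1:R), (1:R)]])))).
  apply: le_measure; rewrite ?inE; [exact: measurable_eball| |].
    by apply: measurable_box.
  move=> t; rewrite /eball /= => t1 i /=; rewrite in_itv/= -ler_norml.
  by apply: le_trans t1; have := ler_coord_enorm (row_of_tuple t) i; rewrite mxE.
rewrite [X in (X < _)%E]volume_box//; under eq_bigr do rewrite lebesgue_measure_itv/= lte_fin.
by rewrite gtrN// -EFinB prodEFin ltry.
Qed.

End balls.

Section punctured_ball.
Context {R : realType} {n : nat}.
Local Notation mR := (measurableTypeR R).
Local Notation mu := (lebesgue_tuple n.+1 : {measure set (n.+1.-tuple mR) -> \bar R}).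

(** The cone over the whole sphere that enters [sphere_measure]; the origin is missing because it
    has no direction. *)
Definition peball : set (n.+1.-tuple mR) := [set t | 0 < enorm (row_of_tuple t) <= 1].

Lemma measurable_peball : measurable peball.
Proof.
rewrite -[X in measurable X]setTI.
exact: (measurable_enorm measurableT (measurable_itv `]0, 1])).
Qed.

Lemma peball_sub : peball `<=` eball 1.
Proof. by move=> t /andP[]. Qed.

Lemma volume_peball_le : (mu peball <= mu (eball 1%R))%E.
Proof.
apply: le_measure; rewrite ?inE; [exact: measurable_peball|exact: measurable_eball|].
exact: peball_sub.
Qed.

Lemma volume_peball_lty : (mu peball < +oo)%E.
Proof. exact: le_lt_trans volume_peball_le volume_eball1_lty. Qed.

Lemma volume_peball_gt0 : (0 < mu peball)%E.
Proof.
(* The cube of side [d] fits inside: [d <= 1] bounds each squared coordinate by [d], and n+1 such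
   terms add up to 1. *)
pose d : R := n.+1%:R^-1.
have d0 : 0 < d by rewrite invr_gt0.
have d1 : d <= 1 by rewrite invf_le1 ?ltr0n// ler1n.
apply: (@lt_le_trans _ _ (mu (box (fun=> [set` `]0, d]])))); last first.
  apply: le_measure; rewrite ?inE; [by apply: measurable_box|exact: measurable_peball|].
  move=> t tb; rewrite /peball /= enorm_gt0; apply/andP; split.
    apply/eqP => /rowP/(_ ord0); rewrite !mxE => t0.
    by have := tb ord0; rewrite /= t0 in_itv/= ltxx.
  rewrite -(ler_pXn2r (ltn0Sn 1)) ?nnegrE ?enorm_ge0// sqr_enorm expr1n /dot.
  apply: (@le_trans _ _ (\sum_(i < n.+1) d)).
    apply: ler_sum => i _; rewrite mxE; have := tb i; rewrite /= in_itv/=.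
    move: (tnth t i : R) => x /andP[x0 xd].
    have x1 : x <= 1 := le_trans xd d1.
    by rewrite -[leRHS]mul1r; exact: ler_pM (ltW x0) (ltW x0) x1 xd.
  by rewrite sumr_const card_ord -mulr_natl mulfV.
rewrite [X in (_ < X)%E]volume_box//; under eq_bigr do rewrite lebesgue_measure_itv/= lte_fin.
by rewrite d0 -EFinB prodEFin lte_fin prodr_const exprn_gt0// subr0.
Qed.

Lemma volume_eball1_gt0 : (0 < mu (eball 1%R))%E.
Proof. exact: lt_le_trans volume_peball_gt0 volume_peball_le. Qed.

Lemma sphere_areaE : sphere_area n = n.+1%:R * fine (mu peball).
Proof.
rewrite /sphere_area /sphere_measure /volume (_ : _ @^-1` _ = peball).
  by rewrite fineM// ge0_fin_numE// volume_peball_lty.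
apply/seteqP; split=> t /=; first by case.
by move=> t1; split=> //; rewrite /sphere/= enorm_normalize// -enorm_gt0; case/andP: t1.
Qed.

Lemma sphere_area_gt0 : 0 < sphere_area n :> R.
Proof.
rewrite sphere_areaE mulr_gt0// fine_gt0// volume_peball_gt0.
by rewrite volume_peball_lty.
Qed.

(** Take the indicator of the unit ball as weight in [ge0_integral_mulmx]. An isometry preserves it,
    so both sides carry the same factor, the volume of the ball, which is positive and finite and
    can be cancelled. *)
Lemma ge0_integral_isometry (A : 'M[R]_n.+1) (F : 'rV[R]_n.+1 -> \bar R) :
  A *m A^T = 1%:M ->
  measurable_fun setT (F \o row_of_tuple) -> (forall y, 0 <= F y)%E ->
  (\int[mu]_t F (row_of_tuple t *m A) = \int[mu]_t F (row_of_tuple t))%E.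
Proof.
move=> AA mF F0; have AA' := mulmx1C AA.
pose f (y : 'rV[R]_n.+1) : \bar R := (nat_of_bool (enorm y <= 1))%:R%:E.
have fE t : f (row_of_tuple t) = (\1_(@eball R n.+1 1) t)%:E.
  rewrite /f !indicE; congr ((nat_of_bool _)%:R%:E).
  by apply/idP/idP; rewrite inE.
have fA y : f (y *m A) = f y.
  by rewrite /f /enorm !dotE trmx_mul mulmxA -(mulmxA y) AA mulmx1.
have mf : measurable_fun setT (f \o row_of_tuple).
  apply: (@eq_measurable_fun _ _ _ _ _ (EFin \o \1_(@eball R n.+1 1))).
    by move=> t _; rewrite /= -fE.
  by apply/measurable_EFinP; apply: measurable_indic; exact: measurable_eball.
have f0 y : (0 <= f y)%E by rewrite lee_fin.
have fN y : f (- y) = f y.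
  by rewrite /f enormN.
have := ge0_integral_mulmx AA' mf f0 fN mF F0.
have If : (\int[mu]_t f (row_of_tuple t) = mu (eball 1%R))%E.
  under eq_integral do rewrite fE.
  by rewrite integral_indic ?setIT//; exact: measurable_eball.
under [X in (_ = _ * X)%E]eq_integral do rewrite fA.
rewrite If muleC.
have vf : mu (eball 1%R) \is a fin_num by rewrite ge0_fin_numE// volume_eball1_lty.
rewrite -(fineK vf).
have v0 : fine (mu (eball 1%R)) != 0 by rewrite gt_eqF// fine_gt0// volume_eball1_gt0 volume_eball1_lty.
move=> /(congr1 (fun x => x * (fine (mu (eball 1%R)))^-1%:E)%E).
by rewrite -!muleA -!EFinM mulfV// !mule1.
Qed.

End punctured_ball.

(** * Directional derivatives *)

Section directional.
Context {R : realType} {V : normedModType R}.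

Lemma is_derive_lineP (f : V -> R) x v d :
  is_derive x v f d <-> is_derive (0 : R) 1 (fun h : R => f (h *: v + x)) d.
Proof.
have E : 'D_v f x = 'D_1 (fun h : R => f (h *: v + x)) 0.
  rewrite /derive; set g1 := fun h => h^-1 *: _; set g2 := fun h => h^-1 *: _.
  suff -> : g1 = g2 by [].
  by rewrite funeqE /g1 /g2 => h /=; rewrite addr0 scale0r add0r [_%:A]mulr1.
split=> [[df <-]|[df <-]].
  by constructor; [exact: (derivable1P f x v).1 df|rewrite E].
by constructor; [exact: (derivable1P f x v).2 df|rewrite -E].
Qed.

Lemma is_derive_comp1 (g : R -> R) (f : V -> R) x v a b :
  is_derive (f x) 1 g a -> is_derive x v f b -> is_derive x v (g \o f) (a * b).
Proof.
move=> dg /is_derive_lineP df; apply/is_derive_lineP.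
apply: (@is_derive1_comp _ g (fun h => f (h *: v + x))).
by rewrite scale0r add0r.
Qed.

End directional.

Section derive_formulas.
Context {R : realType}.

Lemma is_derive_rsqrt (s : R) : 0 < s ->
  is_derive s 1 (fun s => (Num.sqrt s)^-1) (- 2^-1 * (Num.sqrt s)^-1 ^+ 3).
Proof.
move=> s0; have q0 : Num.sqrt s != 0 by rewrite gt_eqF// sqrtr_gt0.
apply: (is_derive_eq (@is_deriveV _ Num.sqrt s _ 1 q0 (is_derive1_sqrt s0)));
  rewrite /GRing.scale/=; field.
by rewrite q0.
Qed.

Context {n : nat}.
Implicit Types y v w : 'rV[R]_n.+1.

Lemma is_derive_dotl y v w : is_derive y v (fun z => dot z w) (dot v w).
Proof.
apply/is_derive_lineP.
rewrite (_ : (fun h : R => _) = (fun h => h * dot v w + dot y w)).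
  apply: is_derive_eq; rewrite /GRing.scale/=; ring.
by apply/funext => h; rewrite dotDl dotZl.
Qed.

Lemma is_derive_dot y v : is_derive y v (fun z => dot z z) (2 * dot y v).
Proof.
apply/is_derive_lineP.
rewrite (_ : (fun h : R => _) = (fun h => h ^+ 2 * dot v v + h * (2 * dot y v) + dot y y)).
  apply: is_derive_eq; rewrite /GRing.scale/=; ring.
by apply/funext => h; rewrite dotDl !dotDr !dotZl !dotZr (dotC v y); ring.
Qed.

Lemma is_derive_enorm y v : y != 0 -> is_derive y v (@enorm R _) (dot y v / enorm y).
Proof.
move=> y0; have p : 0 < dot y y by rewrite -sqr_enorm exprn_gt0// enorm_gt0.
have D := @is_derive_comp1 _ _ Num.sqrt (fun z => dot z z) y v _ _
  (is_derive1_sqrt p) (is_derive_dot y v).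
apply: (is_derive_eq D);
  rewrite -/(enorm y); field.
by rewrite enorm_eq0.
Qed.

End derive_formulas.

(* [japanese y] is the inverse of the bracket (1 + |y|^2)^(1/2). *)
Section japanese.
Context {R : realType} {n : nat}.
Implicit Types y v w : 'rV[R]_n.+1.

Definition japanese (r : R) : R := (Num.sqrt (r ^+ 2 + 1))^-1.

Lemma japanese_gt0 r : 0 < japanese r.
Proof. by rewrite invr_gt0 sqrtr_gt0 ltr_wpDl// sqr_ge0. Qed.

Lemma japanese_neq0 r : japanese r != 0.
Proof. by rewrite gt_eqF// japanese_gt0. Qed.

Lemma sqr_japanese r : japanese r ^- 2 = r ^+ 2 + 1.
Proof. by rewrite exprVn invrK sqr_sqrtr// addr_ge0// sqr_ge0. Qed.

Lemma is_derive_japanese (r : R) : is_derive r 1 japanese (- r * japanese r ^+ 3).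
Proof.
have p : 0 < r ^+ 2 + 1 by rewrite ltr_wpDl// sqr_ge0.
have d : is_derive r 1 (fun r => r ^+ 2 + 1) (2 * r).
  by apply: is_derive_eq; rewrite /GRing.scale/=; ring.
have D := @is_derive_comp1 _ _ (fun s => (Num.sqrt s)^-1) (fun r : R => r ^+ 2 + 1) r 1 _ _
  (is_derive_rsqrt p) d.
apply: (is_derive_eq D);
  rewrite /japanese; field.
by rewrite gt_eqF// sqrtr_gt0.
Qed.

Lemma is_derive_japaneseX (r : R) m :
  is_derive r 1 (fun r => japanese r ^+ m) (- m%:R * r * japanese r ^+ m.+2).
Proof.
have d := is_derive_japanese r.
rewrite (_ : (fun r => _) = japanese ^+ m); last by apply/funext => s; rewrite exprfctE.
apply: (is_derive_eq (is_deriveX m d)); rewrite /GRing.scale/=.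
case: m => [|m]; first by rewrite oppr0 !mul0r.
rewrite !exprS/=; ring.
Qed.

End japanese.

Lemma cvgXn {R : realType} {T : Type} (F : set_system T) {FF : Filter F}
    (f : T -> R) (a : R) m : f x @[x --> F] --> a -> f x ^+ m @[x --> F] --> a ^+ m.
Proof.
move=> fa; elim: m => [|m IH]; first by rewrite expr0; under eq_fun do rewrite expr0; exact: cvg_cst.
by rewrite exprS; under eq_fun do rewrite exprS; exact: cvgM.
Qed.

Lemma is_derive1_continuous {R : realType} (f : R -> R) (x d : R) :
  is_derive x 1 f d -> {for x, continuous f}.
Proof. by move=> [df _]; apply/differentiable_continuous/derivable1_diffP. Qed.

(** * The integral of a power of the inverse bracket *)

Section layer_cake.
Context {R : realType} {n : nat}.
Local Notation mR := (measurableTypeR R).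
Local Notation leb := (@lebesgue_measure R).

Lemma japanese_cvg0 : japanese (r : R) @[r --> +oo] --> (0 : R).
Proof.
apply/cvgrPdist_le => e e0; near=> r.
have r0 : 0 < r by near: r; exact: nbhs_pinfty_gt.
rewrite sub0r normrN gtr0_norm ?japanese_gt0//.
have s0 : 0 < Num.sqrt (r ^+ 2 + 1) by rewrite sqrtr_gt0 ltr_wpDl ?sqr_ge0.
rewrite /japanese invf_ple ?posrE//.
apply: (@le_trans _ _ r); first by near: r; apply: nbhs_pinfty_ge; rewrite num_real.
by rewrite (le_trans (ler_norm r))// -sqrtr_sqr ler_wsqrtr// lerDl.
Unshelve. all: by end_near. Qed.

Lemma continuous_japanese : continuous (@japanese R).
Proof.
move=> r; exact: is_derive1_continuous (is_derive_japanese r).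
Qed.

Lemma continuous_japanese_mono (c : R) k m :
  continuous (fun r : R => c * r ^+ k * japanese r ^+ m).
Proof.
move=> r; apply: (@cvgM _ _ _ _ (fun r : R => c * r ^+ k) (fun r => japanese r ^+ m)).
  by apply: cvgM; [exact: cvg_cst|exact: cvgXn cvg_id].
exact: cvgXn (@continuous_japanese r).
Qed.

(** The layer-cake formula for a power of [japanese]: its value at [a] becomes a superposition of
    the indicators of [a <= r], to be used with [a] the norm of a point. *)
Lemma integral_japanese_tail m (a : R) : 0 <= a ->
  (\int[leb]_(r in `[a, +oo[) (m.+1%:R * r * japanese r ^+ m.+3)%:E =
   (japanese a ^+ m.+1)%:E)%E.
Proof.
move=> a0.
have dF (x : R) : is_derive x 1 (fun r => - japanese r ^+ m.+1)
    (m.+1%:R * x * japanese x ^+ m.+3).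
  apply: (is_derive_eq (is_deriveN (is_derive_japaneseX x m.+1))).
  by rewrite !mulNr opprK.
rewrite (@ge0_continuous_FTC2y _ _ (fun r => - japanese r ^+ m.+1) a 0).
- by rewrite -EFinB sub0r opprK.
- move=> x ax; rewrite mulr_ge0 ?exprn_ge0 ?(ltW (japanese_gt0 _))//.
  by rewrite mulr_ge0// (le_trans a0).
- by apply: continuous_subspaceT => x; exact: (@continuous_japanese_mono _ 1).
- rewrite -oppr0; apply: cvgN.
  have := @cvgXn _ _ _ _ _ _ m.+1 japanese_cvg0; rewrite expr0n/=. exact.
- by move=> x _; have [] := dF x.
- apply: cvg_at_right_filter; exact: is_derive1_continuous (dF a).
- by move=> x _; rewrite derive1E; have [_ ->] := dF x.
Qed.

(** The derivative of [r * japanese r] is [japanese r ^+ 3], so [(r * japanese r) ^+ m.+1] is an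
    antiderivative; it rises from 0 to 1. *)
Lemma integral_japanese_radial m :
  (\int[leb]_(r in `[0%R, +oo[) (m.+1%:R * r ^+ m * japanese r ^+ m.+3)%:E = 1)%E.
Proof.
have dF (x : R) : is_derive x 1 (fun r => (r * japanese r) ^+ m.+1)
    (m.+1%:R * x ^+ m * japanese x ^+ m.+3).
  have d : is_derive x 1 (fun r => r * japanese r) (japanese x ^+ 3).
    apply: (is_derive_eq (@is_deriveM _ _ id japanese x 1 _ _ (is_derive_id _ _) (is_derive_japanese x))).
    rewrite /GRing.scale /=.
    have -> : japanese x * 1 = japanese x ^+ 3 * japanese x ^- 2.
      by rewrite mulr1 (exprS _ 2) -mulrA mulfV ?mulr1// expf_neq0// japanese_neq0.
    rewrite sqr_japanese; ring.
  rewrite (_ : (fun r => _) = (fun r => r * japanese r) ^+ m.+1); last first.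
    by apply/funext => s; rewrite exprfctE.
  apply: (is_derive_eq (is_deriveX m.+1 d)).
  rewrite /GRing.scale/= exprMn !exprS; ring.
rewrite (@ge0_continuous_FTC2y _ _ (fun r => (r * japanese r) ^+ m.+1) 0 1).
- by rewrite mul0r expr0n/= sube0.
- move=> x ax; rewrite mulr_ge0 ?exprn_ge0 ?(ltW (japanese_gt0 _))//.
  by rewrite mulr_ge0// exprn_ge0.
- by apply: continuous_subspaceT => x; exact: continuous_japanese_mono.
- have H : r * japanese r @[r --> +oo] --> (1 : R).
    apply/cvgrPdist_le => e e0; near=> r.
    have r0 : 0 < r by near: r; exact: nbhs_pinfty_gt.
    apply: (@le_trans _ _ (japanese r)); last first.
      near: r; have /cvgrPdist_le/(_ _ e0) := japanese_cvg0; apply: filterS => r.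
      by rewrite sub0r normrN => /(le_trans (ler_norm _)).
    have j0 := japanese_gt0 r.
    (* The bracket exceeds [r] by at most 1, so the distance to the limit is at most
       [japanese r]. *)
    have -> : 1 - r * japanese r = japanese r * (Num.sqrt (r ^+ 2 + 1) - r).
      rewrite mulrBr mulVf ?(mulrC r)// gt_eqF// sqrtr_gt0 ltr_wpDl ?sqr_ge0//.
    rewrite normrM (gtr0_norm j0) -[leRHS]mulr1 ler_pM2l//.
    have H1 : r <= Num.sqrt (r ^+ 2 + 1).
      by rewrite (le_trans (ler_norm r))// -sqrtr_sqr ler_wsqrtr// lerDl.
    have H2 : Num.sqrt (r ^+ 2 + 1) <= r + 1.
      have r1 : 0 <= r + 1 by rewrite addr_ge0// ltW.
      rewrite -(ger0_norm r1) -sqrtr_sqr ler_wsqrtr//.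
      by rewrite sqrrD expr1n mulr1 lerD2r lerDl mulrn_wge0// ltW.
    rewrite ler_norml; apply/andP; split; lra.
  have := @cvgXn _ _ _ _ _ _ m.+1 H; rewrite expr1n. exact.
- by move=> x _; have [] := dF x.
- apply: cvg_at_right_filter; exact: is_derive1_continuous (dF 0).
- by move=> x _; rewrite derive1E; have [_ ->] := dF x.
Unshelve. all: by end_near. Qed.

Local Notation mu := (lebesgue_tuple n.+1 : {measure set (n.+1.-tuple mR) -> \bar R}).

(** Expand the integrand in layers and exchange the integrals: the layer at [r] is a ball of volume
    [r ^+ n.+1] times that of the unit ball, and the remaining radial density has mass 1. With
    [sum_newton2] this gives the mass of the Laplacian of the potential. *)
Lemma integral_japanese :
  (\int[@lebesgue_tuple R n.+1]_t (japanese (enorm (row_of_tuple t)) ^+ n.+3)%:E =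
   mu (eball 1%R))%E.
Proof.
pose k (r : R) := n.+3%:R * r * japanese r ^+ n.+3.+2.
pose S := [set p : n.+1.-tuple mR * mR | enorm (row_of_tuple p.1) <= p.2].
have SE t r : \1_S (t, r) = (nat_of_bool (enorm (row_of_tuple t) <= r))%:R :> R.
  by rewrite indicE; congr (nat_of_bool _)%:R; apply/idP/idP; rewrite inE.
pose H (p : n.+1.-tuple mR * mR) : \bar R := (k p.2 * \1_S p)%:E.
have k0 (r : R) : 0 <= r -> 0 <= k r.
  by move=> r0; apply: mulr_ge0; [exact: mulr_ge0|rewrite exprn_ge0// ltW// japanese_gt0].
have mk : measurable_fun setT (k : mR -> mR).
  by apply: continuous_measurable_fun => x; exact: (@continuous_japanese_mono _ 1).
have H0 p : (0 <= H p)%E.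
  case: p => t r; rewrite lee_fin SE; have [h|_] := boolP (_ <= r); last by rewrite mulr0.
  by rewrite mulr1 k0// (le_trans _ h)// enorm_ge0.
have mH : measurable_fun setT H.
  apply/measurable_EFinP; apply: measurable_funM; first exact: measurableT_comp mk _.
  apply: measurable_indic; rewrite -[S]setTI.
  have mb : measurable_fun setT (fun p : n.+1.-tuple mR * mR => enorm (row_of_tuple p.1) <= p.2).
    apply: measurable_fun_ler => //.
    exact: measurableT_comp measurable_enorm _.
  exact: (mb measurableT [set true] Logic.I).
transitivity (\int[mu]_t \int[leb]_r H (t, r))%E.
  apply: eq_integral => t _.
  rewrite -integral_japanese_tail; last exact: enorm_ge0.
  rewrite integral_mkcond; apply: eq_integral => r _; rewrite /H SE /patch /=.
  rewrite mem_setE in_itv/= andbT.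
  by case: (_ <= r); rewrite ?mulr1 ?mulr0.
rewrite fubini_tonelli//.
transitivity (\int[leb]_(r in `[0%R, +oo[)
    (mu (eball 1%R) * (n.+3%:R * r ^+ n.+2 * japanese r ^+ n.+3.+2)%:E))%E.
  rewrite [RHS]integral_mkcond; apply: eq_integral => r _.
  rewrite /patch mem_setE in_itv/= andbT; case: ifPn => r0; last first.
    apply: integral0_eq => t _; rewrite /H/= SE.
    have /negPf-> : ~~ (enorm (row_of_tuple t) <= r).
      by apply: contra r0; apply: le_trans; exact: enorm_ge0.
    by rewrite mulr0.
  transitivity (\int[mu]_t ((k r)%:E * (\1_(eball r) t)%:E))%E.
    apply: eq_integral => t _; rewrite /H/= SE EFinM indicE.
    congr (_ * (nat_of_bool _)%:R%:E)%E.
    by apply/idP/idP; rewrite inE.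
  rewrite ge0_integralZl//; last 2 first.
  - by apply/measurable_EFinP; apply: measurable_indic; exact: measurable_eball.
  - by rewrite lee_fin k0.
  rewrite integral_indic ?setIT//; last exact: measurable_eball.
  (* The scaling of volumes asks for a positive radius; at [r = 0] both sides vanish through [k]. *)
  move: r0; rewrite le_eqVlt => /predU1P[<-|r0].
    by rewrite /k mulr0 mul0r expr0n/= mulr0 mul0r mule0 mul0e.
  rewrite volume_eball// muleA muleC; congr (_ * _)%E.
  by rewrite -EFinM /k; congr EFin; rewrite !exprS; ring.
rewrite ge0_integralZl//.
- by rewrite integral_japanese_radial mule1.
- apply/measurable_EFinP; apply: measurable_funS measurableT _ _ => //.
  by apply: continuous_measurable_fun => x; exact: continuous_japanese_mono.
- move=> r; rewrite /= in_itv/= andbT => r0; rewrite lee_fin; apply: mulr_ge0.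
    by apply: mulr_ge0 => //; exact: exprn_ge0.
  by rewrite exprn_ge0// ltW// japanese_gt0.
Qed.

End layer_cake.

(** * Derivatives along lines *)

Section lines.
Context {R : realType} {V : normedModType R}.
Implicit Types (f g W : V -> R) (v y : V).

Lemma is_derive_line f v y (t d : R) :
  is_derive (t *: v + y) v f d -> is_derive t 1 (fun s : R => f (s *: v + y)) d.
Proof.
move=> /is_derive_lineP df; apply/is_derive_lineP.
rewrite (_ : (fun h : R => _) = fun h : R => f (h *: v + (t *: v + y)))//.
by apply/funext => h; rewrite [h *: 1]mulr1 scalerDl addrA.
Qed.

Lemma is_derive_scale f v y (a d : R) :
  is_derive y v f d -> is_derive y (a *: v) f (a * d).
Proof.
move=> /is_derive_lineP df; apply/is_derive_lineP.
pose u (h : R) := f (h *: v + y).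
have du : is_derive (a * 0) 1 u d by rewrite mulr0.
have da : is_derive (0:R) 1 (fun h : R => a * h) a.
  by apply: is_derive_eq; rewrite /GRing.scale/= mulr1.
have -> : (fun h : R => f (h *: (a *: v) + y)) = u \o (fun h : R => a * h).
  by apply/funext => h; rewrite /u/= scalerA mulrC.
by rewrite mulrC; exact: is_derive1_comp.
Qed.

Lemma MVT_line f (df : V -> R) v y :
  (forall t : R, 0 <= t <= 1 -> is_derive (t *: v + y) v f (df (t *: v + y))) ->
  exists2 c : R, 0 <= c <= 1 & f (v + y) - f y = df (c *: v + y).
Proof.
move=> dfE.
have d (t : R) : 0 <= t <= 1 ->
    is_derive t 1 (fun s : R => f (s *: v + y)) (df (t *: v + y)).
  by move=> t01; apply: is_derive_line; exact: dfE.
have [||c c01] := @MVT_segment R (fun s : R => f (s *: v + y))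
    (fun t => df (t *: v + y)) 0 1 ler01.
- by move=> t; rewrite in_itv/= => /andP[/ltW t0 /ltW t1]; apply: d; rewrite t0.
- apply: continuous_in_subspaceT => t; rewrite inE/= in_itv/= => t01.
  exact: is_derive1_continuous (d t t01).
- rewrite scale1r scale0r add0r subr0 mulr1 => E; exists c => //.
Qed.

(** A mean value theorem of second order. Being exact, it gives both facts used about difference
    quotients: a bound by the supremum of [W2], uniform in the step, and convergence where [W2] is
    continuous. *)
Lemma second_difference W (W1 W2 : V -> R) v y :
  (forall z, is_derive z v W (W1 z)) -> (forall z, is_derive z v W1 (W2 z)) ->
  exists2 c : R, -1 <= c <= 1 &
    W (y + v) + W (y - v) - 2 * W y = W2 (c *: v + y).
Proof.
move=> dW dW1.
pose D := W (y + v) + W (y - v) - 2 * W y.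
(* The multiple of [t ^+ 2] is chosen so that [p 1 = p 0]; the derivative of [p] then has a zero [c]
   inside the interval. *)
pose p (t : R) := W (t *: v + y) + W ((- t) *: v + y) - t ^+ 2 * D.
pose dp (t : R) := W1 (t *: v + y) - W1 ((- t) *: v + y) - 2 * t * D.
have dpE (t : R) : is_derive t 1 p (dp t).
  have d1 : is_derive t 1 (fun s : R => W (s *: v + y)) (W1 (t *: v + y)).
    exact: is_derive_line.
  have d2 : is_derive t 1 (fun s : R => W ((- s) *: v + y)) (- W1 ((- t) *: v + y)).
    have e1 : is_derive (- t) 1 (fun s : R => W (s *: v + y)) (W1 ((- t) *: v + y)).
      exact: is_derive_line.
    apply: (is_derive_eq (@is_derive1_comp _ _ (fun s : R => - s) t _ _ e1 _)).
    by rewrite mulrN1.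
  have d3 : is_derive t 1 (fun s : R => s ^+ 2 * D) (2 * t * D).
    apply: is_derive_eq; rewrite /GRing.scale/=; ring.
  exact: is_deriveB (is_deriveD d1 d2) d3.
have cp : {within `[0, 1], continuous p}.
  by apply: continuous_subspaceT => t; exact: is_derive1_continuous (dpE t).
have [c] := @MVT R p dp 0 1 ltr01 (fun t _ => dpE t) cp.
rewrite in_itv/= => /andP[c0 c1].
have -> : p 1 - p 0 = 0.
  rewrite /p !scale1r oppr0 !scale0r !add0r expr0n expr1n/= scaleN1r /D.
  rewrite (addrC v) (addrC (- v)); ring.
rewrite subr0 mulr1 /dp => E.
(* A second mean value theorem, for [W1] on the segment from [y - c v] to [y + c v]; the factor
   [2 * c] is positive and cancels against the one from [p]. *)
have [b /andP[b0 b1]] := @MVT_line W1 (fun z => 2 * c * W2 z) ((2 * c) *: v) (- c *: v + y)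
  (fun t _ => is_derive_scale _ (dW1 _)).
rewrite addrA -scalerDl (_ : 2 * c - c = c); last by ring.
move=> E2; exists (b * (2 * c) - c).
  by apply/andP; split; nra.
move: E; rewrite E2 scalerA addrA -scalerDl => /eqP; rewrite eq_sym subr_eq0 => /eqP E.
apply: (@mulfI _ (2 * c)); first by rewrite mulf_neq0 ?gt_eqF.
by rewrite E.
Qed.

End lines.

Section C1.
Context {R : realType} {n : nat}.
Local Notation vec := 'rV[R]_n.+1.
Variables (g : vec -> R) (dg : 'I_n.+1 -> vec -> R) (x : vec).
Hypothesis ddg : forall i, \forall y \near x, is_derive y (basis_vec i) g (dg i y).
Hypothesis cdg : forall i, {for x, continuous (dg i)}.

(** Go from [y] to [z] one coordinate at a time and apply the mean value theorem on each edge. This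
    is how continuous partials along the basis, all that [C1_on] provides, yield continuity and
    derivatives in every direction. *)
Lemma C1_strict (e : R) : 0 < e ->
  exists2 d : R, 0 < d & forall y z, ball x d y -> ball x d z ->
    `|g z - g y - \sum_i (z 0 i - y 0 i) * dg i x| <= e * \sum_i `|z 0 i - y 0 i|.
Proof.
move=> e0.
have : \forall y \near x, forall i, is_derive y (basis_vec i) g (dg i y) /\
    `|dg i x - dg i y| <= e.
  have FF : Filter (nbhs x) by typeclasses eauto.
  apply: (@filter_forall vec 'I_n.+1 (fun i y => is_derive y (basis_vec i) g (dg i y) /\
    `|dg i x - dg i y| <= e) (nbhs x) FF) => i.
  by apply: filterI; [exact: ddg|move/cvgrPdist_le: (@cdg i); exact].
move=> /nbhs_ballP[d /= d0 H]; exists d => // y z [_ By] [_ Bz].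
(* The vertices of the path: the first [k] coordinates are already those of [z]. *)
pose m k : vec := \row_i (if (i < k)%N then z 0 i else y 0 i).
have step (k : 'I_n.+1) :
    `|g (m k.+1) - g (m k) - (z 0 k - y 0 k) * dg k x| <= e * `|z 0 k - y 0 k|.
  pose a := z 0 k - y 0 k.
  have Bt (t : R) : 0 <= t <= 1 -> ball x d (t *: (a *: basis_vec k) + m k).
    move=> /andP[t0 t1]; split=> //= i j; rewrite ord1 !mxE eqxx /=.
    have := By 0 j; have := Bz 0 j; rewrite /ball/=.
    have [->|jk] := eqVneq j k.
      rewrite ltnn mulr1 /a; move: (z 0 k) (y 0 k) (x 0 k) => b c f.
      rewrite !ltr_norml => /andP[b1 b2] /andP[c1 c2].
      have p0 : 0 <= 1 - t by rewrite subr_ge0.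
      have -> : f - (t * (b - c) + c) = t * (f - b) + (1 - t) * (f - c) by ring.
      have [->|tn0] := eqVneq t 0; first by rewrite mul0r subr0 mul1r add0r c1 c2.
      have tp : 0 < t by rewrite lt_def tn0.
      have b1' := ltr_pM2l tp (- d) (f - b); have b2' := ltr_pM2l tp (f - b) d.
      have c1' := ler_wpM2l p0 (ltW c1); have c2' := ler_wpM2l p0 (ltW c2).
      rewrite -b1' in b1; rewrite -b2' in b2.
      by apply/andP; split; lra.
    by rewrite mulr0 mulr0 add0r => H1 H2; case: ifP.
  have [t t01|c c01] := @MVT_line R _ g (fun w => a * dg k w) (a *: basis_vec k) (m k).
    by apply: is_derive_scale; have [] := H _ (Bt t t01) k.
  have -> : a *: basis_vec k + m k = m k.+1.
    apply/rowP => i; rewrite !mxE eqxx /= [in RHS]ltnS (leq_eqVlt i k).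
    have [->|ik] := eqVneq i k; first by rewrite ltnn eqxx mulr1 /a subrK.
    by rewrite mulr0 add0r (inj_eq val_inj) (negPf ik).
  move=> ->; rewrite -mulrBr normrM mulrC ler_wpM2r// distrC.
  by have [] := H _ (Bt c c01) k.
have -> : g z - g y = \sum_(k < n.+1) (g (m k.+1) - g (m k)).
  rewrite -(big_mkord xpredT (fun k => g (m k.+1) - g (m k))) telescope_sumr//.
  congr (g _ - g _); apply/rowP => i; rewrite mxE ?ltn_ord//.
rewrite -sumrB mulr_sumr; apply: le_trans (ler_norm_sum _ _ _) _.
exact: ler_sum.
Qed.

Lemma C1_is_derive v : is_derive x v g (\sum_i v 0 i * dg i x).
Proof.
pose l := \sum_i v 0 i * dg i x.
suff H : h^-1 *: (g (h *: v + x) - g x) @[h --> (0:R)^'] --> l.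
  by apply: DeriveDef; [apply/cvg_ex; exists l|apply/cvg_lim].
apply/cvgrPdist_le => e e0.
pose M := \sum_i `|v 0 i| + 1.
have M0 : 0 < M by rewrite ltr_wpDl// sumr_ge0.
have [d d0 H] := C1_strict (divr_gt0 e0 M0).
have cx : h *: v + x @[h --> (0:R)] --> x.
  rewrite -[X in _ --> X]add0r -(scale0r v).
  by apply: cvgD; [apply: cvgZ; [exact: cvg_id|exact: cvg_cst]|exact: cvg_cst].
have Bh : \forall h \near (0:R)^', ball x d (h *: v + x).
  by apply: nbhs_dnbhs; move/cvg_ball: cx; exact.
near=> h.
have h0 : h != 0 by near: h; exact: nbhs_dnbhs_neq.
have Bhx : ball x d (h *: v + x) by near: h.
have := H x (h *: v + x) (ballxx x d0) Bhx.
have E1 : \sum_i ((h *: v + x) 0 i - x 0 i) * dg i x = h * l.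
  by rewrite mulr_sumr; apply: eq_bigr => i _; rewrite !mxE addrK mulrA.
have E2 : \sum_i `|(h *: v + x) 0 i - x 0 i| = `|h| * (M - 1).
  by rewrite /M addrK mulr_sumr; apply: eq_bigr => i _; rewrite !mxE addrK normrM.
rewrite E1 E2 => K.
have hp : 0 < `|h| by rewrite normr_gt0.
rewrite -(ler_pM2l hp) -normrM mulrBr.
rewrite /GRing.scale/= (mulrA h) mulfV// mul1r distrC.
apply: le_trans K _.
rewrite mulrCA ler_pM2l// -ler_pdivlMl ?divr_gt0// invf_div mulrVK ?unitfE ?gt_eqF//.
by rewrite gerBl.
Unshelve. all: by end_near. Qed.

Lemma C1_continuous : {for x, continuous g}.
Proof.
have FF : Filter (nbhs x) by typeclasses eauto.
apply: (@cvgrPdist_le _ _ _ (nbhs x) FF g (g x)).2 => e e0.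
have [d d0 H] := C1_strict ltr01.
have C : \forall z \near x, forall i : 'I_n.+1, `|(z : vec) 0 i - x 0 i| * (1 + `|dg i x|) <= e / n.+1%:R.
  apply: (@filter_forall vec 'I_n.+1 (fun i z =>
    `|z 0 i - x 0 i| * (1 + `|dg i x|) <= e / n.+1%:R) (nbhs x) FF) => i.
  have p : 0 < 1 + `|dg i x| by rewrite ltr_pwDl.
  have q : 0 < e / n.+1%:R / (1 + `|dg i x|) by rewrite !divr_gt0.
  have /cvgrPdist_le/(_ _ q) := @coord_continuous _ _ _ 0 i x.
  by apply: filterS => z; rewrite distrC ler_pdivlMr.
near=> z.
have Bz : ball x d z by near: z; exact: nbhsx_ballx.
have Cz : forall i : 'I_n.+1, `|(z : vec) 0 i - x 0 i| * (1 + `|dg i x|) <= e / n.+1%:R by near: z.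
have K := H x z (ballxx x d0) Bz.
rewrite distrC -[X in `|X|](subrK (\sum_i (z 0 i - x 0 i) * dg i x)).
apply: le_trans (ler_normD _ _) _.
apply: le_trans (lerD K (ler_norm_sum _ _ _)) _.
rewrite mul1r -big_split/=.
apply: (@le_trans _ _ (\sum_(i < n.+1) e / n.+1%:R)).
  apply: ler_sum => i _; apply: le_trans (Cz i).
  by rewrite normrM mulrDr mulr1.
by rewrite sumr_const card_ord -(mulr_natr (_ / _)) divfK.
Unshelve. all: by end_near. Qed.
End C1.

(** * Integrals of compactly supported continuous functions *)

Section compact_support.
Context {R : realType} {n : nat}.
Local Notation mR := (measurableTypeR R).
Local Notation vec := 'rV[R]_n.+1.
Local Notation mu := (lebesgue_tuple n.+1 : {measure set (n.+1.-tuple mR) -> \bar R}).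
Implicit Types F G : vec -> R.

Definition Cc F := continuous F /\ exists r, forall y, r < enorm y -> F y = 0.

Lemma compact_eball (r : R) : compact [set y : vec | enorm y <= r].
Proof.
apply: bounded_closed_compact.
  exists r; split; first exact: num_real.
  by move=> M rM y /= yr; rewrite (le_trans (ler_norm_enorm y))// (le_trans yr)// ltW.
rewrite (_ : mkset _ = @enorm R n.+1 @^-1` [set x | x <= r])//.
by apply: closed_comp; [move=> y _; exact: continuous_enorm|exact: closed_le].
Qed.

Lemma bounded_on_compact (A : set vec) F : compact A -> {in A, continuous F} ->
  exists2 C, 0 <= C & forall y, A y -> `|F y| <= C.
Proof.
move=> cA cF; have [->|A0] := eqVneq A set0; first by exists 0.
have cF' : {within A, continuous (fun y => `|F y|)}.
  apply: continuous_in_subspaceT => y yA.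
  by apply: continuous_comp; [exact: cF|exact: norm_continuous].
have [c cA' H] := EVT_max_rV ((set0P _).1 A0) cA cF'.
by exists `|F c| => // y /mem_set; exact: H.
Qed.

Lemma Cc_bounded F : Cc F -> exists2 C, 0 <= C & forall y, `|F y| <= C.
Proof.
move=> [cF [r Fr]]; have [|C C0 HC] := @bounded_on_compact _ F (@compact_eball r).
  by move=> y _; exact: cF.
exists C => // y; have [yr|yr] := leP (enorm y) r; first exact: HC.
by rewrite Fr// normr0.
Qed.

Lemma integrable_bounded_support F (C r : R) :
  measurable_fun setT (F \o row_of_tuple) ->
  (forall y, `|F y| <= C) -> (forall y, r < enorm y -> F y = 0) ->
  mu.-integrable setT (EFin \o (F \o row_of_tuple)).
Proof.
(* The given [r] may be nonpositive, while [volume_eball] asks for a positive radius. *)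
move=> mF FC Fr; pose s := Num.max r 1.
have s0 : 0 < s by rewrite lt_max ltr01 orbT.
have C0 : 0 <= C by apply: le_trans (FC 0).
have ms := @measurable_eball R n.+1 s.
have mi : measurable_fun setT (EFin \o (\1_(@eball R n.+1 s) : _ -> R)).
  by apply/measurable_EFinP; exact: measurable_indic.
have mE : measurable_fun setT (EFin \o (F \o row_of_tuple)) by exact/measurable_EFinP.
apply/integrableP; split => //.
apply: (@le_lt_trans _ _ (\int[mu]_t (C%:E * (\1_(eball s) t)%:E))%E).
  apply: ge0_le_integral => //.
  - exact: measurableT_comp.
  - exact: measurable_funeM.
  move=> t _ /=; rewrite lee_fin indicE.
  have [ts|ts] := leP (enorm (row_of_tuple t)) s.
    by rewrite mem_set//= mulr1.
  by rewrite Fr ?normr0 ?mulr_ge0// (le_lt_trans _ ts)// le_max lexx.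
rewrite ge0_integralZl// integral_indic// setIT volume_eball//.
rewrite !lte_mul_pinfty ?lee_fin ?exprn_ge0 ?(ltW s0)//; exact: volume_eball1_lty.
Qed.

Lemma Cc_integrable F : Cc F -> mu.-integrable setT (EFin \o (F \o row_of_tuple)).
Proof.
move=> csF; have [C C0 FC] := Cc_bounded csF; have [cF [r Fr]] := csF.
exact: (integrable_bounded_support (continuous_measurable_rV cF) FC Fr).
Qed.

Lemma continuous_translate F (a : vec) : continuous F -> continuous (fun y : vec => F (y + a)).
Proof.
move=> cF y; apply: (@continuous_comp _ _ _ (fun z : vec => z + a) F y); last exact: cF.
exact: cvgD cvg_id (cvg_cst _).
Qed.

Lemma Cc_translate F (a : vec) : Cc F -> Cc (fun y => F (y + a)).
Proof.
move=> [cF [r Fr]]; split; first exact: continuous_translate.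
exists (r + enorm a) => y; rewrite -ltrBrDr => yr; apply: Fr.
by rewrite (lt_le_trans yr)// -(opprK a) enormN ler_enormB.
Qed.

Lemma CcD F G : Cc F -> Cc G -> Cc (fun y => F y + G y).
Proof.
move=> [cF [r Fr]] [cG [s Gs]]; split; first by move=> y; exact: cvgD (cF y) (cG y).
by exists (Num.max r s) => y; rewrite gt_max => /andP[/Fr-> /Gs->]; rewrite addr0.
Qed.

Lemma CcM F G : Cc F -> continuous G -> Cc (fun y => F y * G y).
Proof.
move=> [cF [r Fr]] cG; split; first by move=> y; exact: cvgM (cF y) (cG y).
by exists r => y /Fr->; rewrite mul0r.
Qed.

Definition intRn F := (\int[mu]_t F (row_of_tuple t))%R.

Lemma intRnD F G : Cc F -> Cc G -> intRn (fun y => F y + G y) = intRn F + intRn G.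
Proof. by move=> cF cG; apply: RintegralD => //; exact: Cc_integrable. Qed.

Lemma intRnB F G : Cc F -> Cc G -> intRn (fun y => F y - G y) = intRn F - intRn G.
Proof. by move=> cF cG; apply: RintegralB => //; exact: Cc_integrable. Qed.

Lemma intRn_translate F (a : vec) : Cc F -> intRn (fun y => F (y + a)) = intRn F.
Proof.
move=> [cF _]; congr fine.
have mF : measurable_fun setT ((EFin \o F) \o row_of_tuple).
  by apply/measurable_EFinP; exact: continuous_measurable_rV.
by rewrite -[RHS](integral_translate a mF).
Qed.

Definition delta2 (a : vec) F (y : vec) := F (y + a) + F (y - a) - 2 * F y.

Lemma continuous_delta2 a F : continuous F -> continuous (delta2 a F).
Proof.
move=> cF y; have t b := @continuous_translate F b cF y.
exact: cvgB (cvgD (t a) (t (- a))) (cvgM (cvg_cst _) (cF y)).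
Qed.

(** Discrete integration by parts: a translation moves the shift by [a] from [F] to a shift by [- a]
    of [G], and [delta2] contains both. The support of [F] alone makes all products integrable, so
    [G] may be the potential, whose support is not compact. *)
Lemma intRn_delta2 a F G : Cc F -> continuous G ->
  intRn (fun y => delta2 a F y * G y) = intRn (fun y => F y * delta2 a G y).
Proof.
move=> cF cG.
have cGt (b : vec) : continuous (fun y : vec => G (y + b)) by exact: continuous_translate.
have tr (b : vec) : intRn (fun y => F (y + b) * G y) = intRn (fun y => F y * G (y - b)).
  rewrite -(@intRn_translate (fun y => F y * G (y - b)) b).
    by apply: eq_Rintegral => t _; rewrite addrK.
  exact: CcM.
have C1 (b : vec) : Cc (fun y => F (y + b) * G y) by apply: CcM => //; exact: Cc_translate.
have C2 (b : vec) : Cc (fun y => F y * G (y + b)) by apply: CcM.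
have C3 : Cc (fun y => F y * (2 * G y)).
  by apply: CcM => // y; exact: cvgM (cvg_cst _) (cG y).
transitivity (intRn (fun y => F (y + a) * G y + F (y - a) * G y - F y * (2 * G y))).
  by apply: eq_Rintegral => t _; rewrite /delta2; ring.
rewrite intRnB//; last exact: CcD.
rewrite intRnD// !tr opprK -intRnD// -intRnB//; last exact: CcD.
by apply: eq_Rintegral => t _; rewrite /delta2; ring.
Qed.

End compact_support.

(** * Exchanging second derivatives under the integral *)

Section green.
Context {R : realType} {n : nat}.
Local Notation mR := (measurableTypeR R).
Local Notation vec := 'rV[R]_n.+1.
Local Notation mu := (lebesgue_tuple n.+1 : {measure set (n.+1.-tuple mR) -> \bar R}).
Implicit Types (F G W : vec -> R) (v w y : vec).

Lemma intRn_dominated (F_ : nat -> vec -> R) F (g : n.+1.-tuple mR -> R) :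
  (forall k, measurable_fun setT (F_ k \o row_of_tuple)) ->
  measurable_fun setT (F \o row_of_tuple) ->
  (forall y, F_ k y @[k --> \oo] --> F y) ->
  mu.-integrable setT (EFin \o g) ->
  (forall k t, `|F_ k (row_of_tuple t)| <= g t) ->
  intRn (F_ k) @[k --> \oo] --> intRn F.
Proof.
move=> mF_ mF FF ig Fg.
have FE t : setT t -> (F_ k (row_of_tuple t))%:E @[k --> \oo] --> (F (row_of_tuple t))%:E.
  by move=> _; apply: cvg_EFin; [exact: nearW|exact: FF].
have [iF _ H] := @dominated_convergence _ _ _ mu setT measurableT
  (fun k => EFin \o (F_ k \o row_of_tuple)) (EFin \o (F \o row_of_tuple)) (EFin \o g)
  (fun k => (measurable_EFinP _ _).2 (mF_ k)) ((measurable_EFinP _ _).2 mF)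
  (aeW _ FE) ig
  (aeW _ (fun t k _ => Fg k t)).
apply: fine_cvg; move: H.
rewrite /intRn /Rintegral fineK//.
exact: integrable_fin_num.
Qed.

Lemma continuous_scaler F (c : R) : continuous F -> continuous (fun y => c * F y).
Proof. by move=> cF y; exact: cvgM (cvg_cst _) (cF y). Qed.

Lemma continuous_mulr F G : continuous F -> continuous G -> continuous (fun y => F y * G y).
Proof. by move=> cF cG y; exact: cvgM (cF y) (cG y). Qed.

(** The first derivative stays existential because every estimate below is in terms of [W2]
    alone. *)
Definition line_C2 v W W2 := exists W1 : vec -> R,
  (forall z, is_derive z v W (W1 z)) /\ (forall z, is_derive z v W1 (W2 z)).

Lemma line_C2_delta2 v W W2 (h : R) y : line_C2 v W W2 -> h != 0 ->
  exists2 c : R, `|c| <= `|h| & h ^- 2 * delta2 (h *: v) W y = W2 (c *: v + y).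
Proof.
move=> [W1 [dW dW1]] h0.
have d1 z : is_derive z (h *: v) W (h * W1 z) by exact: is_derive_scale.
have d2 z : is_derive z (h *: v) (fun z => h * W1 z) (h ^+ 2 * W2 z).
  have := is_derive_scale h (@is_deriveM _ _ (cst h) W1 z v 0 (W2 z) (is_derive_cst _ _ _) (dW1 z)).
  move=> d; apply: (is_derive_eq d); rewrite /GRing.scale/= /cst; ring.
have [c /andP[c0 c1] E] := second_difference y d1 d2.
exists (c * h); first by rewrite normrM ler_piMl// ler_norml c0.
by rewrite /delta2 E scalerA mulrA mulVf ?mul1r// expf_neq0.
Qed.

Lemma cvg_delta2 v W W2 y : line_C2 v W W2 -> continuous W2 ->
  k.+1%:R ^+ 2 * delta2 (k.+1%:R^-1 *: v) W y @[k --> \oo] --> W2 y.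
Proof.
move=> lW cW2.
have /choice[c cP] k : exists c : R, `|c| <= k.+1%:R^-1 /\
    k.+1%:R ^+ 2 * delta2 (k.+1%:R^-1 *: v) W y = W2 (c *: v + y).
  have k0 : k.+1%:R^-1 != 0 :> R by rewrite invr_neq0.
  have [c ck E] := line_C2_delta2 y lW k0; exists c; split.
    by rewrite (le_trans ck)// ger0_norm.
  by rewrite -E exprVn invrK.
rewrite (_ : (fun k => _) = fun k => W2 (c k *: v + y)); last first.
  by apply/funext => k; have [_ ->] := cP k.
have c0 : c k @[k --> \oo] --> (0 : R).
  apply/norm_cvg0P; apply: (@squeeze_cvgr _ _ _ _ (fun=> 0) (@harmonic R)).
  - by near=> k; have [ck _] := cP k; rewrite normr_ge0/=.
  - exact: cvg_cst.
  - exact: cvg_harmonic.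
have H : c k *: v + y @[k --> \oo] --> y.
  rewrite -[X in _ --> X]add0r -(scale0r v).
  exact: cvgD (cvgZ c0 (cvg_cst v)) (cvg_cst y).
exact: (cvg_comp (fun k => c k *: v + y) W2 H (cW2 y)).
Unshelve. all: by end_near. Qed.

Lemma intRn_delta2_comm v w W G : Cc W -> continuous G ->
  intRn (fun y => delta2 v W y * delta2 w G y) =
  intRn (fun y => delta2 w W y * delta2 v G y).
Proof.
move=> cW cG.
rewrite intRn_delta2//; last exact: continuous_delta2.
rewrite intRn_delta2//; last exact: continuous_delta2.
apply: eq_Rintegral => t _; congr (_ * _); rewrite /delta2.
move: (row_of_tuple t) => y.
rewrite (addrAC y v w) (addrAC y v (- w)) (addrAC y (- v) w) (addrAC y (- v) (- w)).
ring.
Qed.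

(** Limit of [intRn_delta2_comm] for steps 1/(k+1). By [second_difference] the quotients are bounded
    by [C] uniformly in [k], so [C * C] on a fixed ball dominates the products. *)
Lemma intRn_symm v w W Wv Ww G Gv Gw (C : R) :
  Cc W -> continuous G ->
  line_C2 v W Wv -> line_C2 w W Ww -> line_C2 v G Gv -> line_C2 w G Gw ->
  continuous Wv -> continuous Ww -> continuous Gv -> continuous Gw ->
  (forall y, `|Wv y| <= C /\ `|Ww y| <= C /\ `|Gv y| <= C /\ `|Gw y| <= C) ->
  intRn (fun y => Wv y * Gw y) = intRn (fun y => Ww y * Gv y).
Proof.
move=> cW cG lWv lWw lGv lGw cWv cWw cGv cGw bC.
pose A a F k y := k.+1%:R ^+ 2 * delta2 (k.+1%:R^-1 *: a) F y.
have A_cont a F k : continuous F -> continuous (A a F k).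
  by move=> cF; exact: continuous_scaler (continuous_delta2 cF).
have k0 k : k.+1%:R^-1 != 0 :> R by rewrite invr_neq0.
have A_bd a F F2 k y : line_C2 a F F2 -> (forall y, `|F2 y| <= C) -> `|A a F k y| <= C.
  move=> lF FC; have [c _] := line_C2_delta2 y lF (k0 k).
  by rewrite exprVn invrK /A => ->.
have [cW' [r Wr]] := cW.
(* The steps are at most [enorm a], so one enlarged ball contains the supports of all quotients. *)
have A_supp a k y : r + enorm a < enorm y -> A a W k y = 0.
  rewrite -ltrBrDr => yr.
  have ea : enorm (k.+1%:R^-1 *: a) <= enorm a.
    rewrite enormZ ger0_norm// ler_piMl ?enorm_ge0// invf_le1// ler1n//.
  have y0 : r < enorm y by rewrite (lt_le_trans yr)// lerBlDr lerDl enorm_ge0.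
  have y1 : r < enorm (y - k.+1%:R^-1 *: a).
    by rewrite (lt_le_trans yr)// (le_trans _ (ler_enormB _ _))// lerB.
  have y2 : r < enorm (y + k.+1%:R^-1 *: a).
    rewrite (lt_le_trans yr)// -[X in y + X]opprK (le_trans _ (ler_enormB _ _))//.
    by rewrite enormN lerB.
  by rewrite /A /delta2 !Wr// mulr0 addr0 subr0 mulr0.
have main a b Wa Gb : line_C2 a W Wa -> line_C2 b G Gb -> continuous Wa -> continuous Gb ->
    (forall y, `|Wa y| <= C) -> (forall y, `|Gb y| <= C) ->
    intRn (fun y => A a W k y * A b G k y) @[k --> \oo] --> intRn (fun y => Wa y * Gb y).
  move=> lWa lGb cWa cGb bWa bGb.
  have C0 : 0 <= C by apply: le_trans (bWa 0).
  pose s := r + enorm a.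
  have ig : mu.-integrable setT (EFin \o (fun t => C * C * \1_(eball s) t)).
    rewrite (_ : (fun t => _) = (fun y => C * C * \1_[set y : vec | enorm y <= s] y) \o
        row_of_tuple); last first.
      by apply/funext => t; rewrite /= !indicE.
    apply: (@integrable_bounded_support _ _ _ (C * C) s).
    - apply: (@eq_measurable_fun _ _ _ _ _ (fun t => C * C * \1_(@eball R n.+1 s) t)).
        by move=> t _; rewrite /= !indicE.
      apply: measurable_funM => //; apply: measurable_indic; exact: measurable_eball.
    - move=> y; rewrite indicE normrM (ger0_norm (mulr_ge0 C0 C0)).
      by case: (_ \in _); rewrite ?normr1 ?normr0 ?mulr1 ?mulr0 ?mulr_ge0.
    - move=> y sy; rewrite indicE memNset ?mulr0//=.
      by apply/negP; rewrite -ltNge.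
  apply: (intRn_dominated _ _ _ ig).
  - move=> k; apply: continuous_measurable_rV.
    by apply: continuous_mulr; exact: A_cont.
  - by apply: continuous_measurable_rV; exact: continuous_mulr.
  - by move=> y; apply: cvgM; exact: cvg_delta2.
  - move=> k t; rewrite indicE normrM.
    have [ts|ts] := leP (enorm (row_of_tuple t)) s.
      by rewrite mem_set//= mulr1; apply: ler_pM => //; [exact: A_bd lWa bWa|exact: A_bd lGb bGb].
    by rewrite A_supp// normr0 mul0r !mulr_ge0.
have E k : intRn (fun y => A v W k y * A w G k y) = intRn (fun y => A w W k y * A v G k y).
  (* Both normalizing factors are moved into [W], which reduces the claim to plain second
     differences. *)
  pose W' y := k.+1%:R ^+ 2 * k.+1%:R ^+ 2 * W y.
  have cW'' : Cc W'.
    split; first exact: continuous_scaler.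
    by exists r => y /Wr; rewrite /W' => ->; rewrite mulr0.
  have EA a b : intRn (fun y => A a W k y * A b G k y) =
      intRn (fun y => delta2 (k.+1%:R^-1 *: a) W' y * delta2 (k.+1%:R^-1 *: b) G y).
    apply: eq_Rintegral => t _; rewrite /A /delta2 /W'; ring.
  by rewrite !EA intRn_delta2_comm.
have H1 := main v w _ _ lWv lGw cWv cGw (fun y => (bC y).1) (fun y => (bC y).2.2.2).
have H2 := main w v _ _ lWw lGv cWw cGv (fun y => (bC y).2.1) (fun y => (bC y).2.2.1).
apply: (cvg_unique _ H1); first exact: norm_hausdorff.
rewrite (_ : (fun k => _) = fun k => intRn (fun y => A w W k y * A v G k y)).
  exact: H2.
by apply/funext => k; exact: E.
Qed.

End green.

(** * The regularized Newtonian potential *)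

Section kernel.
Context {R : realType} {n : nat}.
Local Notation vec := 'rV[R]_n.+1.
Implicit Types (v y : vec).

Local Notation J y := (japanese (enorm y)).

Lemma is_derive_J y v : is_derive y v (fun z => J z) (- dot y v * J y ^+ 3).
Proof.
have E (z : vec) : J z = (Num.sqrt (dot z z + 1))^-1 by rewrite /japanese sqr_enorm.
have p : 0 < dot y y + 1 by rewrite ltr_wpDl// dot_ge0.
have d : is_derive y v (fun z : vec => dot z z + 1) (2 * dot y v).
  have := is_deriveD (is_derive_dot y v) (is_derive_cst (1 : R) y v).
  by move=> d; apply: (is_derive_eq d); rewrite addr0.
have D := @is_derive_comp1 _ _ (fun s => (Num.sqrt s)^-1) (fun z : vec => dot z z + 1) y v _ _
  (is_derive_rsqrt p) d.
rewrite (_ : (fun z => _) = (fun s : R => (Num.sqrt s)^-1) \o (fun z : vec => dot z z + 1)).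
  by apply: (is_derive_eq D); rewrite E; field; rewrite gt_eqF// sqrtr_gt0.
by apply/funext => z; rewrite E.
Qed.

Lemma is_derive_JX y v m :
  is_derive y v (fun z => J z ^+ m) (- m%:R * dot y v * J y ^+ m.+2).
Proof.
have d := is_derive_J y v.
rewrite (_ : (fun z => _) = (fun z => J z) ^+ m); last by apply/funext => s; rewrite exprfctE.
apply: (is_derive_eq (is_deriveX m d)); rewrite /GRing.scale/=.
case: m => [|m]; first by rewrite oppr0 !mul0r.
rewrite !exprS/=; ring.
Qed.

(* Up to the factor 1/|S^n|, a regularized fundamental solution of the Laplacian. *)
Definition newton y : R := - n.-1%:R^-1 * J y ^+ n.-1.

Definition newton2 v y : R := dot v v * J y ^+ n.+1 - n.+1%:R * dot y v ^+ 2 * J y ^+ n.+3.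

Lemma newton_line_C2 v : (2 <= n)%N -> line_C2 v newton (newton2 v).
Proof.
move=> n2; have n0 : n.-1%:R != 0 :> R by rewrite pnatr_eq0 -lt0n -ltnS prednK// ltnW.
have nE : n.-1.+2 = n.+1 by rewrite prednK// ltnW.
exists (fun y => dot y v * J y ^+ n.+1); split=> z.
  have d := @is_deriveM _ _ (cst (- n.-1%:R^-1)) (fun z => J z ^+ n.-1) z v _ _
    (is_derive_cst _ _ _) (is_derive_JX z v n.-1).
  apply: (is_derive_eq d); rewrite /GRing.scale/= /cst nE mulr0 addr0.
  by rewrite !mulrA mulrNN mulVf// mul1r.
have d := @is_deriveM _ _ (fun y => dot y v) (fun z => J z ^+ n.+1) z v _ _
  (is_derive_dotl z v v) (is_derive_JX z v n.+1).
apply: (is_derive_eq d); rewrite /GRing.scale/= /newton2; ring.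
Qed.

Lemma continuous_J m : continuous (fun y : vec => J y ^+ m).
Proof.
have c : continuous (fun y : vec => J y).
  move=> y; apply: (@continuous_comp _ _ _ (@enorm R n.+1) (@japanese R)).
    exact: continuous_enorm.
  exact: continuous_japanese.
by move=> y; exact: cvgXn (c y).
Qed.

Lemma continuous_newton : continuous newton.
Proof. by apply: continuous_scaler; exact: continuous_J. Qed.

Lemma continuous_newton2 v : continuous (newton2 v).
Proof.
have c1 : continuous (fun y : vec => dot v v * J y ^+ n.+1).
  by apply: continuous_scaler; exact: continuous_J.
have c2 : continuous (fun y : vec => n.+1%:R * dot y v ^+ 2 * J y ^+ n.+3).
  apply: continuous_mulr; last exact: continuous_J.
  have c : continuous (fun y : vec => dot y v).
    move=> y; apply: (@continuous_dot _ _ _ id (fun=> v) y); first exact: cvg_id.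
    exact: cst_continuous.
  by apply: continuous_scaler => y; exact: cvgXn (c y).
by move=> y; exact: cvgB (c1 y) (c2 y).
Qed.

(** Both terms of [newton2] lie between 0 and the right-hand side, hence so does the absolute value
    of their difference. For the second one, use Cauchy-Schwarz and |y|^2 J^2 <= 1. The constant n+1
    is the one of [sum_newton2], against which it will cancel. *)
Lemma ler_newton2 v y : `|newton2 v y| <= n.+1%:R * dot v v * J y ^+ n.+1.
Proof.
have j0 := ltW (japanese_gt0 (enorm y)).
have jn m : 0 <= J y ^+ m by rewrite exprn_ge0.
have v0 := dot_ge0 v.
have n1 : 1 <= n.+1%:R :> R by rewrite ler1n.
have a0 : 0 <= dot v v * J y ^+ n.+1 by rewrite mulr_ge0.
have b0 : 0 <= n.+1%:R * dot y v ^+ 2 * J y ^+ n.+3.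
  by apply: mulr_ge0 => //; apply: mulr_ge0 => //; exact: sqr_ge0.
have yJ : dot y y * J y ^+ 2 <= 1.
  rewrite -sqr_enorm -(mulVf (expf_neq0 2 (japanese_neq0 (enorm y)))) sqr_japanese.
  by rewrite ler_wpM2r// lerDl.
have b1 : n.+1%:R * dot y v ^+ 2 * J y ^+ n.+3 <= n.+1%:R * (dot v v * J y ^+ n.+1).
  rewrite -mulrA ler_pM2l ?ltr0n//.
  apply: (@le_trans _ _ (dot y y * dot v v * J y ^+ n.+3)).
    by rewrite ler_wpM2r// cauchy_schwarz.
  rewrite (_ : _ * _ = dot v v * J y ^+ n.+1 * (dot y y * J y ^+ 2)); last by rewrite !exprS; ring.
  by rewrite ler_piMr.
rewrite -mulrA.
have a1 : dot v v * J y ^+ n.+1 <= n.+1%:R * (dot v v * J y ^+ n.+1) by rewrite ler_peMl.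
rewrite /newton2; move: a0 b0 b1 a1.
move: (dot v v * _) (n.+1%:R * dot y v ^+ 2 * _) => a b; move: (n.+1%:R * a) => c.
by move=> a0 b0 b1 a1; rewrite ler_norml; apply/andP; split; lra.
Qed.

Lemma J_le1 y m : J y ^+ m <= 1.
Proof.
have j0 := japanese_gt0 (enorm y).
rewrite exprn_ile1// ?(ltW j0)// /japanese invf_le1 ?sqrtr_gt0 ?ltr_wpDl ?sqr_ge0//.
by rewrite -[leLHS]sqrtr1 ler_wsqrtr// lerDr sqr_ge0.
Qed.

Lemma J_le_inv y m : y != 0 -> J y ^+ m <= enorm y ^- m.
Proof.
move=> y0; have p : 0 < enorm y by rewrite enorm_gt0.
have s0 : 0 < Num.sqrt (enorm y ^+ 2 + 1) by rewrite sqrtr_gt0 ltr_wpDl ?sqr_ge0.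
rewrite -exprVn; apply: lerXn2r; rewrite ?nnegrE.
- exact: ltW (japanese_gt0 _).
- by rewrite invr_ge0 ltW.
rewrite /japanese lef_pV2 ?posrE//.
by rewrite (le_trans (ler_norm _))// -sqrtr_sqr ler_wsqrtr// lerDl.
Qed.

(** The Laplacian of the potential. Writing J^(n+1) as J^(n+3) (|y|^2 + 1) cancels the terms in
    |y|^2 and leaves a positive function of known integral, an approximate identity after
    rescaling. *)
Lemma sum_newton2 y : \sum_i newton2 (basis_vec i) y = n.+1%:R * J y ^+ n.+3.
Proof.
have E : \sum_i newton2 (basis_vec i) y =
    \sum_(i < n.+1) (J y ^+ n.+1 - n.+1%:R * J y ^+ n.+3 * (y 0 i * y 0 i)).
  apply: eq_bigr => i _; rewrite /newton2 !dot_basis !mxE !eqxx/= mul1r expr2; ring.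
rewrite E sumrB sumr_const card_ord -mulr_sumr -/(dot y y) -sqr_enorm -mulr_natl.
have -> : J y ^+ n.+1 = J y ^+ n.+3 * (enorm y ^+ 2 + 1).
  rewrite -sqr_japanese -(addn2 n.+1) exprD -mulrA mulfV ?mulr1//.
  by rewrite expf_neq0// japanese_neq0.
ring.
Qed.

End kernel.

(** * A second derivative bounded by the Laplacian *)

Section second_derivative_bound.
Context {R : realType} {n : nat}.
Local Notation mR := (measurableTypeR R).
Local Notation vec := 'rV[R]_n.+1.
Local Notation mu := (lebesgue_tuple n.+1 : {measure set (n.+1.-tuple mR) -> \bar R}).
Local Notation J y := (japanese (enorm y)).
Implicit Types (F G W : vec -> R) (v w x y z : vec).

Lemma is_derive_affine W (d a : R) x v z : is_derive (a *: z + x) v W d ->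
  is_derive z v (fun z => W (a *: z + x)) (a * d).
Proof.
move=> /(is_derive_scale a)/is_derive_lineP dW; apply/is_derive_lineP.
rewrite (_ : (fun h : R => _) = fun h : R => W (h *: (a *: v) + (a *: z + x)))//.
by apply/funext => h; rewrite scalerDr !scalerA mulrC addrA.
Qed.

Lemma line_C2_affine v W W2 (a : R) x : line_C2 v W W2 ->
  line_C2 v (fun z => W (a *: z + x)) (fun z => a ^+ 2 * W2 (a *: z + x)).
Proof.
move=> [W1 [dW dW1]]; exists (fun z => a * W1 (a *: z + x)); split=> z.
  exact: is_derive_affine.
have d := @is_deriveM _ _ (cst a) (fun z => W1 (a *: z + x)) z v _ _
  (is_derive_cst _ _ _) (is_derive_affine (dW1 _)).
by apply: (is_derive_eq d); rewrite /GRing.scale/= /cst; ring.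
Qed.

Lemma continuous_affine F (a : R) x : continuous F -> continuous (fun z => F (a *: z + x)).
Proof.
move=> cF z; apply: (@continuous_comp _ _ _ (fun z : vec => a *: z + x) F z); last exact: cF.
exact: cvgD (cvgZ (cvg_cst _) cvg_id) (cvg_cst _).
Qed.

Lemma Cc_affine F (a : R) x : 0 < a -> Cc F -> Cc (fun z => F (a *: z + x)).
Proof.
move=> a0 [cF [r Fr]]; split; first exact: continuous_affine.
exists ((r + enorm x) / a) => z; rewrite ltr_pdivrMr// -ltrBrDr => zr.
apply: Fr; rewrite (lt_le_trans zr)// -(opprK x) (le_trans _ (ler_enormB _ _))//.
by rewrite enormN enormZ gtr0_norm// mulrC.
Qed.

Lemma line_C2_scale (c : R) v W W2 : line_C2 v W W2 ->
  line_C2 v (fun z => c * W z) (fun z => c * W2 z).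
Proof.
move=> [W1 [dW dW1]]; exists (fun z => c * W1 z).
by split=> z; [have d := dW z|have d := dW1 z];
  apply: (is_derive_eq (is_deriveM (is_derive_cst c z v) d));
  rewrite /GRing.scale/= /cst mulr0 addr0.
Qed.

Lemma measurable_inv_enorm m x :
  measurable_fun setT (fun t : n.+1.-tuple mR => enorm (row_of_tuple t - x) ^- m).
Proof.
(* [powR] is measurable on the whole line and agrees with the inverse on nonnegative numbers,
   including the default value 0 at 0. *)
rewrite (_ : (fun t => _) = fun t => (enorm (row_of_tuple t - x) `^ (- 1)) ^+ m).
  apply: measurable_funX; apply: (measurableT_comp (measurable_powR (- 1))).
  apply: (@continuous_measurable_rV R n.+1 (fun y => enorm (y - x))).
  exact: (continuous_translate (@continuous_enorm R n.+1)).
by apply/funext => t; rewrite powR_inv1 ?enorm_ge0// exprVn.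
Qed.

Lemma intRn_sum I (r : seq I) (F : I -> vec -> R) : (forall i, Cc (F i)) ->
  Cc (fun y => \sum_(i <- r) F i y) /\
  intRn (fun y => \sum_(i <- r) F i y) = \sum_(i <- r) intRn (F i).
Proof.
move=> cF; elim: r => [|i r [IH1 IH2]].
  rewrite (_ : (fun y => _) = fun=> 0); last by apply/funext => y; rewrite big_nil.
  split; first by split; [exact: cst_continuous|exists 0].
  rewrite big_nil /intRn /Rintegral integral0_eq//.
rewrite (_ : (fun y => _) = fun y => F i y + \sum_(j <- r) F j y); last first.
  by apply/funext => y; rewrite big_cons.
by split; [exact: CcD|rewrite intRnD// big_cons IH2].
Qed.

Lemma integrable_J : mu.-integrable setT (EFin \o (fun t : n.+1.-tuple mR => J (row_of_tuple t) ^+ n.+3)).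
Proof.
have mJ : measurable_fun setT (fun t : n.+1.-tuple mR => J (row_of_tuple t) ^+ n.+3).
  have c := @continuous_J R n n.+3.
  exact: continuous_measurable_rV c.
apply/integrableP; split; first exact/measurable_EFinP.
rewrite (_ : (\int[mu]_t _ = mu (eball 1%R))%E) ?volume_eball1_lty//.
rewrite -integral_japanese; apply: eq_integral => t _ /=.
by rewrite ger0_norm// exprn_ge0// ltW// japanese_gt0.
Qed.

Lemma intRn_J : intRn (fun y => J y ^+ n.+3) = fine (mu (eball 1%R)).
Proof. by rewrite -integral_japanese. Qed.

Lemma second_derivative_bound W (Wb : 'I_n.+1 -> vec -> R) x v Wv :
  (2 <= n)%N -> Cc W -> enorm v = 1 ->
  line_C2 v W Wv -> Cc Wv ->
  (forall i, line_C2 (basis_vec i) W (Wb i)) -> (forall i, Cc (Wb i)) ->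
  \sum_i Wb i x = 0 ->
  ((fine (mu (eball 1%R)) * `|Wv x|)%:E <=
  \int[mu]_t (`|\sum_i Wb i (row_of_tuple t)| * enorm (row_of_tuple t - x) ^- n.+1)%:E)%E.
Proof.
move=> n2 cW v1 lWv cWv lWb cWb Lx.
pose L y := \sum_i Wb i y.
have vv : dot v v = 1 by rewrite -sqr_enorm v1 expr1n.
pose H y : \bar R := (`|L y| * enorm (y - x) ^- n.+1)%:E.
have H0 y : (0 <= H y)%E by rewrite lee_fin mulr_ge0// invr_ge0 exprn_ge0// enorm_ge0.
have cL : Cc L by have [] := intRn_sum (index_enum _) cWb.
have mH : measurable_fun setT (H \o row_of_tuple).
  apply/measurable_EFinP; apply: measurable_funM; last exact: measurable_inv_enorm.
  by apply: measurableT_comp => //; apply: continuous_measurable_rV; case: cL.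
pose eps k : R := k.+1%:R^-1.
have eps0 k : 0 < eps k by rewrite invr_gt0.
have bnd w : exists2 C, 0 <= C & forall z, `|newton2 w z| <= C.
  exists (n.+1%:R * dot w w) => [|z]; first by rewrite mulr_ge0// dot_ge0.
  apply: le_trans (ler_newton2 w z) _.
  by rewrite ler_piMr ?J_le1// mulr_ge0// dot_ge0.
have key k : intRn (fun z => Wv (eps k *: z + x) * (n.+1%:R * J z ^+ n.+3)) =
    intRn (fun z => L (eps k *: z + x) * newton2 v z).
  (* The factor compensates the chain rule: the second derivatives of [W'] are those of [W] at
     [eps k *: z + x], with no power of [eps k]. *)
  pose W' z := eps k ^- 2 * W (eps k *: z + x).
  have cW' : Cc W'.
    have [c [r Wr]] := Cc_affine x (eps0 k) cW.
    split; first exact: continuous_scaler.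
    by exists r => z /Wr; rewrite /W' => ->; rewrite mulr0.
  have lW' w Ww : line_C2 w W Ww -> line_C2 w W' (fun z => Ww (eps k *: z + x)).
    move=> /(line_C2_affine (eps k) x)/(line_C2_scale (eps k ^- 2)).
    rewrite (_ : (fun z => _ * (_ * _)) = fun z => Ww (eps k *: z + x))//.
    by apply/funext => z; rewrite mulrA mulVf ?mul1r// expf_neq0// gt_eqF.
  have cWv' := Cc_affine x (eps0 k) cWv.
  have cWb' i := Cc_affine x (eps0 k) (cWb i).
  have [_ S1] := intRn_sum (index_enum 'I_n.+1)
    (fun i => CcM cWv' (@continuous_newton2 R n (basis_vec i))).
  have [_ S2] := intRn_sum (index_enum 'I_n.+1)
    (fun i => CcM (cWb' i) (@continuous_newton2 R n v)).
  (* Expand the Laplacian of the potential over the basis, exchange the directions [v] and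
     [basis_vec i] in each term, and resum: the Laplacian now falls on [W]. *)
  transitivity (intRn (fun z => \sum_i Wv (eps k *: z + x) * newton2 (basis_vec i) z)).
    by apply: eq_Rintegral => t _; rewrite -mulr_sumr sum_newton2.
  rewrite S1; transitivity (\sum_i intRn (fun z => Wb i (eps k *: z + x) * newton2 v z)).
    apply: eq_bigr => i _.
    have [C1 C10 H1] := Cc_bounded cWv'; have [C2 C20 H2] := Cc_bounded (cWb' i).
    have [C3 C30 H3] := bnd v; have [C4 C40 H4] := bnd (basis_vec i).
    apply: (@intRn_symm _ _ v (basis_vec i) W' _ _ newton _ _ (C1 + C2 + (C3 + C4))) => //.
    - exact: continuous_newton.
    - exact: lW'.
    - exact: lW'.
    - exact: newton_line_C2.
    - exact: newton_line_C2.
    - by case: cWv'.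
    - by case: (cWb' i).
    - exact: continuous_newton2.
    - exact: continuous_newton2.
    move=> z; have C12 : 0 <= C1 + C2 by rewrite addr_ge0.
    have C34 : 0 <= C3 + C4 by rewrite addr_ge0.
    split; [|split; [|split]].
    - by apply: le_trans (H1 z) _; rewrite -addrA lerDl addr_ge0.
    - by apply: le_trans (H2 z) _; rewrite (addrC C1) -addrA lerDl addr_ge0.
    - by apply: le_trans (H3 z) _; rewrite addrC -addrA lerDl addr_ge0.
    - by apply: le_trans (H4 z) _; rewrite addrC (addrC C3) -addrA lerDl addr_ge0.
  by rewrite -S2; apply: eq_Rintegral => t _; rewrite -mulr_suml.
have bound k : ((`|intRn (fun z => Wv (eps k *: z + x) * (n.+1%:R * J z ^+ n.+3))|)%:E <=
    n.+1%:R%:E * \int[mu]_t H (row_of_tuple t))%E.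
  rewrite key.
  have cG : Cc (fun z => L (eps k *: z + x) * newton2 v z).
    by apply: CcM; [exact: Cc_affine|exact: continuous_newton2].
  have iG := Cc_integrable cG.
  have -> : ((`|intRn (fun z => L (eps k *: z + x) * newton2 v z)|)%:E =
      `|\int[mu]_t (L (eps k *: row_of_tuple t + x)%R * newton2 v (row_of_tuple t))%:E|)%E.
    by rewrite -abse_EFin /intRn /Rintegral fineK//; exact: integrable_fin_num iG.
  apply: le_trans (le_abse_integral _ measurableT _) _.
    by have /integrableP[] := iG.
  have mH' : measurable_fun setT (fun t => H (eps k *: row_of_tuple t + x)%R).
    have := measurableT_comp mH (measurable_affine_tuple (eps k) x).
    by apply: eq_measurable_fun => t _; rewrite /= /affine_tuple tuple_of_rowK.
  (* The kernel in [H] is homogeneous of degree -(n+1), so the power of [eps k] cancels against the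
     Jacobian and the bound does not depend on [k]. *)
  apply: (@le_trans _ _ (\int[mu]_t ((n.+1%:R * eps k ^+ n.+1)%:E * H (eps k *: row_of_tuple t + x)%R))%E).
    apply: ge0_le_integral => //.
    - by apply: measurableT_comp => //; have /integrableP[] := iG.
    - exact: measurable_funeM.
    move=> t _; move: (row_of_tuple t) => z.
    rewrite /H -EFinM /= lee_fin addrK enormZ (gtr0_norm (eps0 k)) normrM exprMn invfM.
    (* At the origin the inverse power takes the default value 0 while [newton2 v 0] is 1; the
       inequality holds there because the Laplacian vanishes at [x]. *)
    have [->|z0] := eqVneq z 0.
      by rewrite scaler0 add0r /L Lx normr0 !(mul0r, mulr0).
    have e0 : eps k ^+ n.+1 != 0 by rewrite expf_neq0// gt_eqF.
    rewrite (_ : _ * _ * _ = `|L (eps k *: z + x)| * (n.+1%:R * enorm z ^- n.+1)); last first.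
      by field; rewrite e0 expf_neq0// enorm_eq0.
    rewrite ler_wpM2l// (le_trans (ler_newton2 v z))// vv mulr1 ler_pM2l ?ltr0n//.
    exact: J_le_inv.
  have c0 : (0 <= (n.+1%:R * eps k ^+ n.+1)%:E)%E by rewrite lee_fin mulr_ge0// exprn_ge0// ltW.
  rewrite (@ge0_integralZl _ _ _ mu setT measurableT _ mH' _ (fun t _ => H0 _) c0).
  rewrite ge0_integral_affine// muleA -EFinM -mulrA mulfV ?mulr1//.
  by rewrite expf_neq0// gt_eqF.
(* [Wv] is bounded and J^(n+3) integrable, so the limit passes under the integral and freezes [Wv]
   at [x]. *)
have lim : intRn (fun z => Wv (eps k *: z + x) * (n.+1%:R * J z ^+ n.+3)) @[k --> \oo] -->
    intRn (fun z => Wv x * (n.+1%:R * J z ^+ n.+3)).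
  have [C C0 HC] := Cc_bounded cWv.
  have cJ : continuous (fun z : vec => n.+1%:R * J z ^+ n.+3).
    by apply: continuous_scaler; exact: continuous_J.
  apply: (@intRn_dominated _ _ _ _ (fun t => (C * n.+1%:R) * J (row_of_tuple t) ^+ n.+3)).
  - move=> k; apply: continuous_measurable_rV; apply: continuous_mulr => //.
    by apply: continuous_affine; case: cWv.
  - by apply: continuous_measurable_rV; exact: continuous_scaler.
  - move=> z; apply: cvgM; last exact: cvg_cst.
    have ez : eps k *: z + x @[k --> \oo] --> x.
      rewrite -[X in _ --> X]add0r -(scale0r z).
      exact: cvgD (cvgZ (@cvg_harmonic R) (cvg_cst z)) (cvg_cst x).
    exact: (cvg_comp (fun k => eps k *: z + x) Wv ez (cWv.1 x)).
  - have := integrableZl measurableT (C * n.+1%:R) integrable_J.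
    by apply: eq_integrable => // t _; rewrite /= EFinM.
  - move=> k t; rewrite normrM -mulrA ler_pM//.
    by rewrite ger0_norm// mulr_ge0// exprn_ge0// ltW// japanese_gt0.
have E : intRn (fun z => Wv x * (n.+1%:R * J z ^+ n.+3)) =
    n.+1%:R * (Wv x * fine (mu (eball 1%R))).
  rewrite -intRn_J; transitivity (intRn (fun z => n.+1%:R * Wv x * J z ^+ n.+3)).
    by apply: eq_Rintegral => t _; ring.
  by rewrite mulrA; apply: RintegralZl; [exact: measurableT|exact: integrable_J].
rewrite E in lim.
move: bound; rewrite -/(H _); have : (0 <= \int[mu]_t H (row_of_tuple t))%E by exact: integral_ge0.
rewrite (_ : (\int[mu]_t (`|\sum_i _| * _)%:E = \int[mu]_t H (row_of_tuple t))%E)//.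
case: (\int[mu]_t H (row_of_tuple t))%E => [r| |]; [|by move=> *; rewrite leey|by []].
move=> _ bound; rewrite lee_fin.
have V0 : 0 <= fine (mu (eball 1%R)) by rewrite ltW// fine_gt0// volume_eball1_gt0 volume_eball1_lty.
rewrite -(ler_pM2l (ltr0Sn R n)).
rewrite (_ : _ * (_ * _) = `|n.+1%:R * (Wv x * fine (mu (eball 1%R)))|); last first.
  by rewrite !normrM (ger0_norm V0) (ger0_norm (ler0n _ _)) (mulrC `|Wv x|).
apply: (cvgr_to_le (cvg_norm lim)); apply: nearW => k.
by rewrite -lee_fin EFinM; exact: bound.
Qed.

End second_derivative_bound.

(** * Calculus on the sphere *)

Lemma is_derive_unique {R : realType} {V : normedModType R} (g : V -> R) x v a b :
  is_derive x v g a -> is_derive x v g b -> a = b.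
Proof. by move=> [_ <-] [_ <-]. Qed.

Section homogeneous.
Context {R : realType} {n : nat}.
Local Notation vec := 'rV[R]_n.+1.
Implicit Types (g : vec -> R) (v x y : vec).

Lemma near_neq0 y : y != 0 -> \forall z \near y, z != 0.
Proof.
move=> y0; have o : open [set z : vec | z != 0].
  rewrite (_ : mkset _ = @enorm R n.+1 @^-1` [set x | 0 < x]).
    by apply: open_comp; [move=> z _; exact: continuous_enorm|exact: open_gt].
  by apply/seteqP; split=> z /=; rewrite enorm_gt0.
by apply: open_nbhs_nbhs; split.
Qed.

Lemma C1_on_is_derive g v y : C1_on [set y : vec | y != 0] g -> y != 0 ->
  is_derive y v g (\sum_i v 0 i * 'D_(basis_vec i) g y).
Proof.
move=> C1g y0; apply: (@C1_is_derive _ _ g (fun i => 'D_(basis_vec i) g)) => i.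
  by have := near_neq0 y0; apply: filterS => z z0; have [d _] := C1g i z z0; exact: DeriveDef.
by have [] := C1g i y y0.
Qed.

Lemma C1_on_continuous g y : C1_on [set y : vec | y != 0] g -> y != 0 ->
  {for y, continuous g}.
Proof.
move=> C1g y0; apply: (@C1_continuous _ _ g (fun i => 'D_(basis_vec i) g)) => i.
  by have := near_neq0 y0; apply: filterS => z z0; have [d _] := C1g i z z0; exact: DeriveDef.
by have [] := C1g i y y0.
Qed.

Lemma derive_homogeneous0 g i y (a : R) : C1_on [set y : vec | y != 0] g ->
  (forall z b, 0 < b -> g (b *: z) = g z) -> y != 0 -> 0 < a ->
  'D_(basis_vec i) g (a *: y) = a^-1 * 'D_(basis_vec i) g y.
Proof.
move=> C1g hg y0 a0; have ay0 : a *: y != 0 by rewrite scaler_eq0 negb_or gt_eqF.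
have d1 : is_derive y (basis_vec i) g ('D_(basis_vec i) g y).
  by have [d _] := C1g i y y0; exact: DeriveDef.
have d2 : is_derive (a *: y + 0) (basis_vec i) g ('D_(basis_vec i) g (a *: y)).
  by rewrite addr0; have [d _] := C1g i _ ay0; exact: DeriveDef.
have := is_derive_affine d2.
rewrite (_ : (fun z => g (a *: z + 0)) = g); last by apply/funext => z; rewrite addr0 hg.
by move=> /(is_derive_unique d1) ->; rewrite mulKf ?gt_eqF.
Qed.

Lemma derive_homogeneousV g i y (a : R) : C1_on [set y : vec | y != 0] g ->
  (forall z b, z != 0 -> 0 < b -> g (b *: z) = b^-1 * g z) -> y != 0 -> 0 < a ->
  'D_(basis_vec i) g (a *: y) = a ^- 2 * 'D_(basis_vec i) g y.
Proof.
move=> C1g hg y0 a0; have ay0 : a *: y != 0 by rewrite scaler_eq0 negb_or gt_eqF.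
have an0 : a != 0 by rewrite gt_eqF.
have d1 : is_derive y (basis_vec i) g ('D_(basis_vec i) g y).
  by have [d _] := C1g i y y0; exact: DeriveDef.
have d2 : is_derive (a *: y + 0) (basis_vec i) g ('D_(basis_vec i) g (a *: y)).
  by rewrite addr0; have [d _] := C1g i _ ay0; exact: DeriveDef.
have d3 : is_derive y (basis_vec i) g (a * (a * 'D_(basis_vec i) g (a *: y))).
  have d4 := is_derive_affine d2.
  have d5 := is_deriveM (is_derive_cst a y (basis_vec i)) d4.
  apply: (@near_eq_is_derive _ _ _ (cst a * (fun z => g (a *: z + 0)))).
    have := near_neq0 y0; apply: filterS => z z0.
    by rewrite -[LHS]/(a * g (a *: z + 0)) addr0 hg// mulVKf.
  by apply: (is_derive_eq d5); rewrite /GRing.scale/= mulr0 addr0.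
by rewrite (is_derive_unique d1 d3) mulrA -expr2 mulKf// expf_neq0.
Qed.

Lemma near_line_pos : \forall h \near (0 : R), 0 < h + 1.
Proof.
exists 1 => //= h; rewrite /= sub0r normrN ltr_norml => /andP[h1 _]; lra.
Qed.

Lemma euler0 g y : C1_on [set y : vec | y != 0] g ->
  (forall z b, 0 < b -> g (b *: z) = g z) -> y != 0 ->
  \sum_i y 0 i * 'D_(basis_vec i) g y = 0.
Proof.
move=> C1g hg y0; have /is_derive_lineP d1 := C1_on_is_derive y C1g y0.
apply: (is_derive_unique d1).
apply: (@near_eq_is_derive _ _ _ (cst (g y))).
have := near_line_pos; apply: filterS => h h1.
by rewrite -[X in g (_ + X)]scale1r -scalerDl hg.
Qed.

Lemma eulerV g y : C1_on [set y : vec | y != 0] g ->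
  (forall z b, z != 0 -> 0 < b -> g (b *: z) = b^-1 * g z) -> y != 0 ->
  \sum_i y 0 i * 'D_(basis_vec i) g y = - g y.
Proof.
move=> C1g hg y0; have /is_derive_lineP d1 := C1_on_is_derive y C1g y0.
apply: (is_derive_unique d1).
apply: (@near_eq_is_derive _ _ _ (fun h : R => (h + 1)^-1 * g y)).
  have := near_line_pos; apply: filterS => h h1.
  by rewrite -[X in g (_ + X)]scale1r -scalerDl hg.
have n0 : (0 : R) + 1 != 0 by rewrite add0r oner_neq0.
have d2 : is_derive (0:R) 1 (fun h : R => h + 1) 1.
  by apply: is_derive_eq; rewrite addr0.
have d3 := is_deriveM (@is_deriveV _ (fun h : R => h + 1) 0 1 1 n0 d2) (is_derive_cst (g y) (0:R) 1).
by apply: (is_derive_eq d3); rewrite /GRing.scale/= add0r expr1n invr1; ring.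
Qed.

End homogeneous.

Section sphere_calculus.
Context {R : realType} {n : nat}.
Local Notation vec := 'rV[R]_n.+1.
Variable u : vec -> R.
Hypothesis C2u : C2_sphere u.
Implicit Types (v w x y z : vec).

Local Notation u0 := (extend0 u).
Local Notation du i := ('D_(basis_vec i) (extend0 u)).
Local Notation ddu i j := ('D_(basis_vec j) ('D_(basis_vec i) (extend0 u))).

(** The Euclidean Hessian of the degree-zero extension: [v] is the direction of the outer derivative
    and [w] selects the component of the gradient, in the order of [sphere_hess]. *)
Definition ambient_hess y v w := \sum_i w 0 i * \sum_j v 0 j * ddu i j y.

Lemma extend0Z z (b : R) : 0 < b -> u0 (b *: z) = u0 z.
Proof. by move=> b0; rewrite /extend0 /= normalizeZ. Qed.

Lemma duZ i z (b : R) : z != 0 -> 0 < b -> du i (b *: z) = b^-1 * du i z.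
Proof. by move=> z0 b0; apply: derive_homogeneous0 => //; [case: C2u|exact: extend0Z]. Qed.

Lemma dduZ i j z (b : R) : z != 0 -> 0 < b -> ddu i j (b *: z) = b ^- 2 * ddu i j z.
Proof.
move=> z0 b0; apply: derive_homogeneousV => //; first by case: C2u.
by move=> w c; exact: duZ.
Qed.

Lemma sphere_neq0 x : sphere n x -> x != 0.
Proof. by move=> xS; rewrite -enorm_gt0 xS. Qed.

Lemma sphere_dot x : sphere n x -> dot x x = 1.
Proof. by move=> xS; rewrite -sqr_enorm xS expr1n. Qed.

Lemma is_derive_extend0 y v : y != 0 -> is_derive y v u0 (\sum_i v 0 i * du i y).
Proof. by apply: C1_on_is_derive; case: C2u. Qed.

Lemma is_derive_du i y v : y != 0 -> is_derive y v (du i) (\sum_j v 0 j * ddu i j y).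
Proof. by apply: C1_on_is_derive; case: C2u. Qed.

Lemma euler_extend0 y : y != 0 -> \sum_i y 0 i * du i y = 0.
Proof. by apply: euler0; [case: C2u|move=> z b; exact: extend0Z]. Qed.

Lemma euler_du i y : y != 0 -> \sum_j y 0 j * ddu i j y = - du i y.
Proof. by apply: eulerV; [case: C2u|move=> z b; exact: duZ]. Qed.

(** Partials of a function of degree zero have degree -1, so the degree-zero extension of the
    gradient is |y| times the ambient gradient. The factor |y| has zero derivative in a tangent
    direction. *)
Lemma derive_extend0_grad x v : sphere n x -> tangent x v ->
  'D_v (extend0 (sphere_grad u)) x = \row_i \sum_j v 0 j * ddu i j x.
Proof.
move=> xS xv; have x0 := sphere_neq0 xS.
have d i : is_derive x v (fun y => extend0 (sphere_grad u) y 0 i) (\sum_j v 0 j * ddu i j x).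
  apply: (@near_eq_is_derive _ _ _ (fun y => enorm y * du i y)).
    have := near_neq0 x0; apply: filterS => y y0.
    by rewrite /extend0 /= mxE duZ// ?invrK// invr_gt0 enorm_gt0.
  apply: (is_derive_eq (is_deriveM (is_derive_enorm v x0) (is_derive_du i v x0))).
  by rewrite /GRing.scale/= xv mul0r mulr0 addr0 (_ : enorm x = 1)// mul1r.
have D : derivable (extend0 (sphere_grad u)) x v.
  by apply/derivable_mxP => i j; rewrite ord1; have [] := d j.
by rewrite derive_mx//; apply/matrixP => i j; rewrite !mxE ord1; have [_ ->] := d j.
Qed.

(** The projection in [cov_deriv] only removes a multiple of [x], which a tangent [w] does not
    see. *)
Lemma sphere_hessE x v w : sphere n x -> tangent x v -> tangent x w ->
  sphere_hess u x v w = ambient_hess x v w.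
Proof.
move=> xS xv xw; rewrite /sphere_hess /cov_deriv derive_extend0_grad// /tangent_proj.
rewrite dotBl dotZl (_ : dot x w = 0)// mulr0 subr0.
by apply: eq_bigr => i _; rewrite mxE mulrC.
Qed.

Lemma tangent_tangent_proj x v : sphere n x -> tangent x (tangent_proj x v).
Proof. by move=> xS; rewrite /tangent /tangent_proj dotBr dotZr sphere_dot// mulr1 subrr. Qed.

(** With P the projection along x and M the ambient Hessian, the left side is the trace of P M P,
    that is tr M - x M x^T. Euler's relation for the gradient turns x M x^T into minus the radial
    derivative of the extension, which is 0 by Euler's relation in degree zero. *)
Lemma sphere_laplacianE x : sphere n x -> sphere_laplacian u x = \sum_i ddu i i x.
Proof.
move=> xS; have x0 := sphere_neq0 xS.
have pE k i : tangent_proj x (basis_vec k) 0 i = (i == k)%:R - x 0 k * x 0 i.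
  by rewrite /tangent_proj !mxE dot_basis eqxx.
have xx : \sum_k x 0 k * x 0 k = 1 by exact: sphere_dot.
have E : sphere_laplacian u x = \sum_i \sum_j ((i == j)%:R - x 0 i * x 0 j) * ddu i j x.
  rewrite /sphere_laplacian.
  under eq_bigr => k _.
    rewrite sphere_hessE//; last 2 first.
    - exact: tangent_tangent_proj.
    - exact: tangent_tangent_proj.
    rewrite /ambient_hess; under eq_bigr do rewrite mulr_sumr.
    over.
  rewrite exchange_big/=; apply: eq_bigr => i _.
  rewrite exchange_big/=; apply: eq_bigr => j _.
  under eq_bigr do rewrite mulrA.
  rewrite -mulr_suml; congr (_ * _).
  under eq_bigr do rewrite !pE.
  transitivity (\sum_k ((i == k)%:R * (j == k)%:R - (i == k)%:R * x 0 k * x 0 j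
      - (j == k)%:R * x 0 k * x 0 i + x 0 i * x 0 j * (x 0 k * x 0 k))).
    by apply: eq_bigr => k _; ring.
  rewrite big_split/= !sumrB -mulr_sumr xx mulr1.
  have S1 (F : 'I_n.+1 -> R) l : \sum_k (l == k)%:R * F k = F l.
    rewrite (bigD1 l)//= eqxx mul1r big1 ?addr0// => k kl.
    by rewrite eq_sym (negPf kl) mul0r.
  rewrite -!mulr_suml !S1 (eq_sym j i); ring.
rewrite E; under eq_bigr => i _.
  under eq_bigr do rewrite mulrBl.
  rewrite sumrB; under [X in _ - X]eq_bigr do rewrite -mulrA.
  rewrite -mulr_sumr euler_du//.
  over.
rewrite sumrB; under [X in _ - X]eq_bigr do rewrite mulrN.
rewrite sumrN euler_extend0// oppr0 subr0.
apply: eq_bigr => i _; rewrite (bigD1 i)//= eqxx mul1r big1 ?addr0// => j ji.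
by rewrite eq_sym (negPf ji) mul0r.
Qed.

Lemma laplacian_extend0 y : y != 0 ->
  \sum_i ddu i i y = enorm y ^- 2 * sphere_laplacian u (normalize y).
Proof.
move=> y0; have yn0 : normalize y != 0 by rewrite -enorm_gt0 enorm_normalize.
rewrite sphere_laplacianE; last exact: enorm_normalize.
rewrite mulr_sumr; apply: eq_bigr => i _.
by rewrite -{1}(dot_normalizeK y0) dduZ// enorm_gt0.
Qed.

End sphere_calculus.

(** * Cutting off a homogeneous function *)

Section smooth_step.
Context {R : realType}.
Implicit Types (r s : R).

Definition pospart r : R := Num.max 0 r.

Lemma pospart_ge0 r : 0 <= pospart r. Proof. by rewrite le_max lexx. Qed.

Lemma pospart_le0 r : r <= 0 -> pospart r = 0.
Proof. by move=> r0; apply/max_idPl. Qed.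

Lemma pospart_gt0 r : 0 <= r -> pospart r = r.
Proof. by move=> r0; apply/max_idPr. Qed.

Lemma pospart_le1 r : r <= 1 -> pospart r <= 1.
Proof. by move=> r1; rewrite ge_max ler01. Qed.

Lemma is_derive_pospartX m r :
  is_derive r 1 (fun s => pospart s ^+ m.+2) (m.+2%:R * pospart r ^+ m.+1).
Proof.
have [r0|r0|<-] := ltgtP 0 r.
- apply: (@near_eq_is_derive _ _ _ (fun s : R => s ^+ m.+2)).
    near=> s; rewrite pospart_gt0// ltW//; near: s.
    exact: lt_nbhsr.
  rewrite (_ : (fun s : R => s ^+ m.+2) = (id : R -> R) ^+ m.+2); last first.
    by apply/funext => s; rewrite exprfctE.
  apply: (is_derive_eq (is_deriveX m.+2 (is_derive_id r 1))).
  by rewrite /GRing.scale/= mulr1 pospart_gt0// ltW.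
- apply: (@near_eq_is_derive _ _ _ (cst (0 : R))).
    near=> s; rewrite pospart_le0 ?expr0n// ltW//; near: s.
    exact: lt_nbhsl.
  apply: (is_derive_eq (is_derive_cst 0 r 1)).
  by rewrite pospart_le0 ?ltW// expr0n/= mulr0.
(* At the corner both one-sided formulas give 0; the difference quotient is at most |h| once |h| <=
   1, because the exponent is at least 2. *)
- rewrite (pospart_le0 (lexx _)) expr0n/= mulr0.
  suff H : h^-1 *: (pospart (h *: 1 + 0) ^+ m.+2 - pospart 0 ^+ m.+2) @[h --> (0:R)^'] --> (0:R).
    by apply: DeriveDef; [apply/cvg_ex; exists 0|apply/cvg_lim].
  apply/cvgr0Pnorm_le => e e0; near=> h.
  have h0 : h != 0 by near: h; exact: nbhs_dnbhs_neq.
  have he : `|h| <= e by near: h; exact: dnbhs0_le.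
  have h1 : `|h| <= 1 by near: h; exact: dnbhs0_le.
  rewrite addr0 (pospart_le0 (lexx _)) expr0n/= subr0 [h *: 1]mulr1 /GRing.scale/=.
  rewrite normrM normfV ler_pdivrMl ?normr_gt0// normrX (ger0_norm (pospart_ge0 h)).
  have ph : pospart h <= `|h| by rewrite ge_max normr_ge0 ler_norm.
  rewrite exprS ler_pM ?pospart_ge0 ?exprn_ge0 ?pospart_ge0//.
  apply: le_trans he; rewrite exprS (le_trans _ ph)// ler_piMr ?pospart_ge0//.
  by rewrite exprn_ile1 ?pospart_ge0// (le_trans ph).
Unshelve. all: by end_near. Qed.

Lemma continuous_pospart : continuous pospart.
Proof.
move=> r; apply: (@continuous_comp _ _ _ (fun s => (0 : R, s)) (fun p => Num.max p.1 p.2)).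
  exact: cvg_pair (cvg_cst _) cvg_id.
exact: max_continuous.
Qed.

(* A C^2 step, 0 for [s <= 0] and 1 for [1 <= s]. *)
Definition step s : R := 1 - pospart (1 - pospart s ^+ 3) ^+ 3.

Definition step1 s : R := 9 * pospart (1 - pospart s ^+ 3) ^+ 2 * pospart s ^+ 2.

Definition step2 s : R :=
  18 * pospart (1 - pospart s ^+ 3) ^+ 2 * pospart s -
  54 * pospart (1 - pospart s ^+ 3) * pospart s ^+ 4.

Lemma is_derive_step s : is_derive s 1 step (step1 s).
Proof.
have d1 : is_derive s 1 (fun s => 1 - pospart s ^+ 3) (- (3 * pospart s ^+ 2)).
  have := is_deriveB (is_derive_cst (1 : R) s 1) (is_derive_pospartX 1 s).
  by move=> d; apply: (is_derive_eq d); rewrite add0r.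
have d2 := @is_derive1_comp _ (fun s => pospart s ^+ 3) (fun s => 1 - pospart s ^+ 3) s _ _
  (is_derive_pospartX 1 (1 - pospart s ^+ 3)) d1.
have d3 := is_deriveB (is_derive_cst (1 : R) s 1) d2.
by apply: (is_derive_eq d3); rewrite /step1; ring.
Qed.

Lemma is_derive_step1 s : is_derive s 1 step1 (step2 s).
Proof.
have d1 : is_derive s 1 (fun s => 1 - pospart s ^+ 3) (- (3 * pospart s ^+ 2)).
  have := is_deriveB (is_derive_cst (1 : R) s 1) (is_derive_pospartX 1 s).
  by move=> d; apply: (is_derive_eq d); rewrite add0r.
have d2 := @is_derive1_comp _ (fun s => pospart s ^+ 2) (fun s => 1 - pospart s ^+ 3) s _ _
  (is_derive_pospartX 0 (1 - pospart s ^+ 3)) d1.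
have d3 := is_deriveM (is_deriveM (is_derive_cst (9 : R) s 1) d2) (is_derive_pospartX 0 s).
by apply: (is_derive_eq d3); rewrite /GRing.scale/= /step2 !expr1 mulrfctE /=; ring.
Qed.

Lemma continuous_step2 : continuous step2.
Proof.
move=> s; have c0 := @continuous_pospart s.
have c1 : {for s, continuous (fun s => pospart (1 - pospart s ^+ 3))}.
  apply: (@continuous_comp _ _ _ (fun s => 1 - pospart s ^+ 3) pospart).
    exact: cvgB (cvg_cst _) (cvgXn c0).
  exact: continuous_pospart.
exact: cvgB (cvgM (cvgM (cvg_cst _) (cvgXn c1)) c0) (cvgM (cvgM (cvg_cst _) c1) (cvgXn c0)).
Qed.

Lemma step_le0 s : s <= 0 -> [/\ step s = 0, step1 s = 0 & step2 s = 0].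
Proof.
move=> s0; rewrite /step /step1 /step2 (pospart_le0 s0) !expr0n/= subr0.
by rewrite (pospart_gt0 ler01) !expr1n subrr !mulr0 subrr.
Qed.

Lemma step_ge1 s : 1 <= s -> [/\ step s = 1, step1 s = 0 & step2 s = 0].
Proof.
move=> s1; have s0 : 0 <= s by apply: le_trans s1.
have s3 : 1 - s ^+ 3 <= 0 by rewrite subr_le0 exprn_ege1.
rewrite /step /step1 /step2 (pospart_gt0 s0) (pospart_le0 s3) !expr0n/=.
by rewrite subr0 !(mulr0, mul0r) subrr.
Qed.

(** For [s < 1] both positive parts lie in [0, 1], so the constants can be read off the
    coefficients: 9, and 72 = 18 + 54. For [1 <= s], where [pospart s] may be large, the outer
    positive part vanishes. *)
Lemma step_bounds s : [/\ 0 <= step s <= 1, `|step1 s| <= 9 & `|step2 s| <= 72].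
Proof.
have [s1|s1] := ltP s 1; last first.
  by have [-> -> ->] := step_ge1 s1; rewrite ler01 lexx normr0 !ler0n.
have p0 := pospart_ge0 s; have p1 := pospart_le1 (ltW s1).
have p30 : 0 <= pospart s ^+ 3 by rewrite exprn_ge0.
have q0 := pospart_ge0 (1 - pospart s ^+ 3).
have q1 : pospart (1 - pospart s ^+ 3) <= 1 by rewrite pospart_le1// gerBl.
rewrite /step /step1 /step2; move: (pospart (1 - _)) q0 q1 => q q0 q1.
move: (pospart s) p0 p1 {p30} => p p0 p1.
have X (a : R) m : 0 <= a -> a <= 1 -> 0 <= a ^+ m <= 1.
  by move=> a0 a1; rewrite exprn_ge0// exprn_ile1.
have /andP[q30 q31] := X q 3 q0 q1; have /andP[q20 q21] := X q 2 q0 q1.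
have /andP[p20 p21] := X p 2 p0 p1; have /andP[p40 p41] := X p 4 p0 p1.
split.
- by apply/andP; split; lra.
- rewrite ger0_norm ?mulr_ge0// -mulrA ger_pMr// mulr_ile1//.
- have a0 : 0 <= q ^+ 2 * p <= 1 by rewrite mulr_ge0// mulr_ile1.
  have b0 : 0 <= q * p ^+ 4 <= 1 by rewrite mulr_ge0// mulr_ile1.
  rewrite -(mulrA 18) -(mulrA 54).
  move: a0 b0; move: (q ^+ 2 * p) (q * p ^+ 4) => a b.
  by move=> /andP[? ?] /andP[? ?]; rewrite ler_norml; apply/andP; split; lra.
Qed.

End smooth_step.

Section cutoff.
Context {R : realType}.
Variable L : R.
Hypothesis L2 : 2 <= L.
Implicit Types (r s : R).

Let L0 : 0 < L. Proof. by apply: lt_le_trans L2. Qed.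
Definition chi r : R := step (L * r - 1) - step (L^-1 * r - 1).
Definition chi1 r : R := L * step1 (L * r - 1) - L^-1 * step1 (L^-1 * r - 1).
Definition chi2 r : R := L ^+ 2 * step2 (L * r - 1) - L ^- 2 * step2 (L^-1 * r - 1).

(* Equal to [r] on [2/L, L] and supported in [1/L, 2L]. *)
Definition cutid r : R := r * chi r.
Definition cutid1 r : R := chi r + r * chi1 r.
Definition cutid2 r : R := 2 * chi1 r + r * chi2 r.

Lemma is_derive_comp_affine (g g1 : R -> R) (a r : R) :
  (forall s, is_derive s 1 g (g1 s)) ->
  is_derive r 1 (fun r => g (a * r - 1)) (a * g1 (a * r - 1)).
Proof.
move=> dg; have d : is_derive r 1 (fun r => a * r - 1) a.
  by apply: is_derive_eq; rewrite /GRing.scale/=; ring.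
have := @is_derive1_comp _ g (fun r => a * r - 1) r _ _ (dg _) d.
by move=> D; apply: (is_derive_eq D); rewrite mulrC.
Qed.

Lemma is_derive_chi r : is_derive r 1 chi (chi1 r).
Proof.
exact: is_deriveB (is_derive_comp_affine _ _ (@is_derive_step R))
  (is_derive_comp_affine _ _ (@is_derive_step R)).
Qed.

Lemma is_derive_chi1 r : is_derive r 1 chi1 (chi2 r).
Proof.
have d a : is_derive r 1 (fun r => a * step1 (a * r - 1)) (a ^+ 2 * step2 (a * r - 1)).
  have D := is_deriveM (is_derive_cst a r 1) (is_derive_comp_affine a r (@is_derive_step1 R)).
  by apply: (is_derive_eq D); rewrite /GRing.scale/=; ring.
have := is_deriveB (d L) (d L^-1); rewrite exprVn; exact.
Qed.

Lemma is_derive_cutid r : is_derive r 1 cutid (cutid1 r).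
Proof.
have D := is_deriveM (is_derive_id r (1 : R)) (is_derive_chi r).
by apply: (is_derive_eq D); rewrite /GRing.scale/= /cutid1; ring.
Qed.

Lemma is_derive_cutid1 r : is_derive r 1 cutid1 (cutid2 r).
Proof.
have D := is_deriveD (is_derive_chi r) (is_deriveM (is_derive_id r (1 : R)) (is_derive_chi1 r)).
by apply: (is_derive_eq D); rewrite /GRing.scale/= /cutid2; ring.
Qed.

Lemma continuous_cutid2 : continuous cutid2.
Proof.
have c a : continuous (fun r => step2 (a * r - 1)).
  move=> r; apply: (@continuous_comp _ _ _ (fun r => a * r - 1) (@step2 R)).
    exact: cvgB (cvgM (cvg_cst _) cvg_id) (cvg_cst _).
  exact: continuous_step2.
have c1 : continuous chi1 by move=> r; exact: is_derive1_continuous (is_derive_chi1 r).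
move=> r; apply: cvgD (cvgM (cvg_cst _) (c1 r)) (cvgM cvg_id _).
exact: cvgB (cvgM (cvg_cst _) (c _ r)) (cvgM (cvg_cst _) (c _ r)).
Qed.

Lemma chi_small r : r <= L^-1 -> [/\ chi r = 0, chi1 r = 0 & chi2 r = 0].
Proof.
move=> rL; have a : L * r - 1 <= 0 by rewrite subr_le0 -ler_pdivlMl// mulr1.
have b : L^-1 * r - 1 <= 0.
  rewrite subr_le0 (@le_trans _ _ (L^-1 * L^-1))//.
    by rewrite ler_wpM2l// invr_ge0 ltW.
  by rewrite mulr_ile1 ?invr_ge0 ?(ltW L0)// invf_le1// (le_trans _ L2)// ler1n.
rewrite /chi /chi1 /chi2; have [-> -> ->] := step_le0 a; have [-> -> ->] := step_le0 b.
by rewrite !mulr0 !subr0.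
Qed.

Lemma chi_large r : 2 * L <= r -> [/\ chi r = 0, chi1 r = 0 & chi2 r = 0].
Proof.
move=> rL; have b : 1 <= L^-1 * r - 1.
  by rewrite lerBrDr -(@ler_pM2l _ L)// mulVKf ?gt_eqF// mulrC.
have a : 1 <= L * r - 1.
  have r1 : 1 <= r by have := L2; lra.
  have : 2 * 1 <= L * r by apply: ler_pM.
  by rewrite mulr1; lra.
rewrite /chi /chi1 /chi2; have [-> -> ->] := step_ge1 a; have [-> -> ->] := step_ge1 b.
by rewrite !mulr0 !subr0 subrr.
Qed.

Lemma chi_mid r : 2 * L^-1 <= r -> r <= L -> [/\ chi r = 1, chi1 r = 0 & chi2 r = 0].
Proof.
move=> r1 r2; have a : 1 <= L * r - 1.
  by rewrite lerBrDr -ler_pdivrMl// mulrC.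
have b : L^-1 * r - 1 <= 0 by rewrite subr_le0 ler_pdivrMl// mulr1.
rewrite /chi /chi1 /chi2; have [-> -> ->] := step_ge1 a; have [-> -> ->] := step_le0 b.
by rewrite !mulr0 !subr0.
Qed.

Lemma ler_chi r : `|chi r| <= 1.
Proof.
have [/andP[a0 a1] _ _] := step_bounds (L * r - 1).
have [/andP[b0 b1] _ _] := step_bounds (L^-1 * r - 1).
by rewrite /chi ler_norml; apply/andP; split; lra.
Qed.

(** On the inner ramp the derivatives of [chi] are of order L and L^2, and [r * L <= 2] turns the
    second into order L; on the outer ramp they are of order 1/L and 1/L^2, and [r / L <= 2]. The
    constants are the bounds 9 and 72 of the step, the latter doubled by these factors 2. *)
Lemma chi_error (m : nat) r : 0 < r ->
  `|m%:R * chi1 r + r * chi2 r| <=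
  (9 * m%:R + 144) *
    (L * (nat_of_bool (r <= 2 * L^-1))%:R + L^-1 * (nat_of_bool (L <= r <= 2 * L))%:R).
Proof.
move=> r0.
have [_ a1 a2] := step_bounds (L * r - 1).
have [_ b1 b2] := step_bounds (L^-1 * r - 1).
have Li0 : 0 < L^-1 by rewrite invr_gt0.
have A : `|m%:R * (L * step1 (L * r - 1)) + r * (L ^+ 2 * step2 (L * r - 1))| <=
    (9 * m%:R + 144) * (L * (nat_of_bool (r <= 2 * L^-1))%:R).
  have [rL|rL] := leP r (2 * L^-1); last first.
    have a : 1 <= L * r - 1 by rewrite lerBrDr -ler_pdivrMl// mulrC ltW.
    by have [_ -> ->] := step_ge1 a; rewrite !mulr0 addr0 normr0.
  have rL' : r * L <= 2 by rewrite -ler_pdivlMr.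
  rewrite mulr1; apply: le_trans (ler_normD _ _) _.
  rewrite mulrDl; apply: lerD.
    rewrite normrM (normrM L) (ger0_norm (ler0n _ _)) (gtr0_norm L0).
    rewrite (_ : 9 * _ * _ = m%:R * (L * 9)); last by ring.
    by apply: ler_wpM2l => //; apply: ler_wpM2l => //; exact: (ltW L0).
  rewrite (_ : r * _ = r * L * (L * step2 (L * r - 1))); last by ring.
  rewrite (normrM (r * L)) (_ : 144 * L = 2 * (L * 72)); last by ring.
  rewrite ger0_norm ?mulr_ge0 ?(ltW r0) ?(ltW L0)// (normrM L) (gtr0_norm L0).
  apply: ler_pM => //; first by rewrite mulr_ge0 ?(ltW r0) ?(ltW L0).
    by rewrite mulr_ge0 ?(ltW L0).
  by apply: ler_wpM2l => //; exact: (ltW L0).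
have B : `|m%:R * (L^-1 * step1 (L^-1 * r - 1)) + r * (L ^- 2 * step2 (L^-1 * r - 1))| <=
    (9 * m%:R + 144) * (L^-1 * (nat_of_bool (L <= r <= 2 * L))%:R).
  have [rL1|rL1] := leP L r; last first.
    have b : L^-1 * r - 1 <= 0 by rewrite subr_le0 ler_pdivrMl// mulr1 ltW.
    by have [_ -> ->] := step_le0 b; rewrite !mulr0 addr0 normr0.
  have [rL|rL] := leP r (2 * L); last first.
    have a : 1 <= L^-1 * r - 1.
      by rewrite lerBrDr -(@ler_pM2l _ L)// mulVKf ?gt_eqF// mulrC ltW.
    by have [_ -> ->] := step_ge1 a; rewrite !mulr0 addr0 normr0.
  have rL' : r * L^-1 <= 2 by rewrite ler_pdivrMr.
  rewrite mulr1; apply: le_trans (ler_normD _ _) _.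
  rewrite mulrDl; apply: lerD.
    rewrite normrM (normrM L^-1) (ger0_norm (ler0n _ _)) (gtr0_norm Li0).
    rewrite (_ : 9 * _ * _ = m%:R * (L^-1 * 9)); last by ring.
    by apply: ler_wpM2l => //; apply: ler_wpM2l => //; exact: (ltW Li0).
  rewrite -exprVn (_ : r * _ = r * L^-1 * (L^-1 * step2 (L^-1 * r - 1))); last by ring.
  rewrite (normrM (r * L^-1)) (_ : 144 * L^-1 = 2 * (L^-1 * 72)); last by ring.
  rewrite ger0_norm ?mulr_ge0 ?(ltW r0) ?(ltW Li0)// (normrM L^-1) (gtr0_norm Li0).
  apply: ler_pM => //; first by rewrite mulr_ge0 ?(ltW r0) ?(ltW Li0).
    by rewrite mulr_ge0 ?(ltW Li0).
  by apply: ler_wpM2l => //; exact: (ltW Li0).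
have H := lerD A B; rewrite -mulrDr in H; apply: le_trans H.
apply: le_trans (ler_normB _ _).
by rewrite le_eqVlt; apply/orP; left; apply/eqP; congr (`|_|); rewrite /chi1 /chi2; ring.
Qed.

End cutoff.

Lemma continuous_sum_at {R : realType} {T : topologicalType} n (F : 'I_n -> T -> R) (y : T) :
  (forall i, {for y, continuous (F i)}) -> {for y, continuous (fun z => \sum_i F i z)}.
Proof.
move=> cF; apply: (@cvg_big _ _ _ _ _ add_continuous _ (nbhs y)) => // i _.
exact: cF.
Qed.

(** * A radial factor times a function of degree zero *)

Section radial_product.
Context {R : realType} {n : nat}.
Local Notation vec := 'rV[R]_n.+1.
Variables (u : vec -> R) (c : R) (k k1 k2 : R -> R) (a b : R).
Hypothesis C2u : C2_sphere u.
Hypothesis dk : forall r : R, is_derive r 1 k (k1 r).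
Hypothesis dk1 : forall r : R, is_derive r 1 k1 (k2 r).
Hypothesis ck2 : continuous k2.
Hypothesis a0 : 0 < a.
Hypothesis k_small : forall r, r <= a -> [/\ k r = 0, k1 r = 0 & k2 r = 0].
Hypothesis k_large : forall r, b <= r -> [/\ k r = 0, k1 r = 0 & k2 r = 0].
Implicit Types (v w x y z : vec).

Local Notation du i := ('D_(basis_vec i) (extend0 u)).
Local Notation ddu i j := ('D_(basis_vec j) ('D_(basis_vec i) (extend0 u))).

Definition radial_mul y : R := k (enorm y) * (extend0 u y - c).

Let D v y := \sum_i v 0 i * du i y.
Let p y := (enorm y)^-1.

Definition radial_mul1 v y : R :=
  k1 (enorm y) * (dot y v * p y) * (extend0 u y - c) + k (enorm y) * D v y.

Definition radial_mul2 v y : R :=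
  (k2 (enorm y) * (dot y v * p y) ^+ 2 +
   k1 (enorm y) * (dot v v * p y - dot y v ^+ 2 * p y ^+ 3)) * (extend0 u y - c) +
  2 * k1 (enorm y) * (dot y v * p y) * D v y + k (enorm y) * ambient_hess u y v v.

Let is_derive_p y v : y != 0 -> is_derive y v p (- (dot y v * p y ^+ 3)).
Proof.
move=> y0; have e0 : enorm y != 0 by rewrite enorm_eq0.
have d := @is_deriveV _ id (enorm y) 1 1 e0 (is_derive_id _ _).
have DE := @is_derive_comp1 _ _ (fun r => r^-1) (@enorm R n.+1) y v _ _ d (is_derive_enorm v y0).
apply: (is_derive_eq DE); rewrite /GRing.scale/= /p; field.
by rewrite e0.
Qed.

Let is_derive_k (g g1 : R -> R) y v : (forall r : R, is_derive r 1 g (g1 r)) -> y != 0 ->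
  is_derive y v (fun z => g (enorm z)) (g1 (enorm y) * (dot y v * p y)).
Proof.
move=> dg y0.
exact: (@is_derive_comp1 _ _ g (@enorm R n.+1) y v _ _ (dg _) (is_derive_enorm v y0)).
Qed.

Let is_derive_v0 y v : y != 0 -> is_derive y v (fun z => extend0 u z - c) (D v y).
Proof.
move=> y0; have d := is_deriveB (is_derive_extend0 C2u v y0) (is_derive_cst c y v).
by apply: (is_derive_eq d); rewrite subr0.
Qed.

Let is_derive_D y v : y != 0 -> is_derive y v (D v) (ambient_hess u y v v).
Proof.
move=> y0.
have d i : is_derive y v (fun z => v 0 i * du i z) (v 0 i * \sum_j v 0 j * ddu i j y).
  have d := is_deriveM (is_derive_cst (v 0 i) y v) (is_derive_du C2u i v y0).
  by apply: (is_derive_eq d); rewrite /GRing.scale/= mulr0 addr0.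
have := @is_derive_sum _ _ _ n.+1 (fun i z => v 0 i * du i z) y v _ d.
rewrite (_ : \sum_(i < n.+1) _ = D v)//.
by apply/funext => z; rewrite fct_sumE.
Qed.

Let near_small y : enorm y < a -> \forall z \near y, enorm z <= a.
Proof.
move=> ya; have FF : Filter (nbhs y) by typeclasses eauto.
have H : \forall z \near y, enorm z < a := @continuous_enorm R n.+1 y _ (lt_nbhsl ya).
apply: (@filterS _ _ FF _ _ _ H) => z; exact: ltW.
Qed.

(** Where the norm is below [a] the function vanishes nearby, which removes the singularity of the
    extension at the origin; elsewhere [y != 0] and the product rule applies. *)
Lemma radial_mul_line_C2 v : line_C2 v radial_mul (radial_mul2 v).
Proof.
exists (radial_mul1 v); split=> y.
  have [ya|ya] := ltP (enorm y) a.
    apply: (@near_eq_is_derive _ _ _ (cst (0 : R))).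
      have := near_small ya; apply: filterS => z za.
      by rewrite /radial_mul; have [-> _ _] := k_small za; rewrite mul0r.
    apply: (is_derive_eq (is_derive_cst (0 : R) y v)).
    by rewrite /radial_mul1; have [-> -> _] := k_small (ltW ya); rewrite !mul0r addr0.
  have y0 : y != 0 by rewrite -enorm_gt0 (lt_le_trans a0).
  apply: (is_derive_eq (is_deriveM (is_derive_k v dk y0) (is_derive_v0 v y0))).
  by rewrite /GRing.scale/= /radial_mul1; ring.
have [ya|ya] := ltP (enorm y) a.
  apply: (@near_eq_is_derive _ _ _ (cst (0 : R))).
    have := near_small ya; apply: filterS => z za.
    by rewrite /radial_mul1; have [-> -> _] := k_small za; rewrite !mul0r addr0.
  apply: (is_derive_eq (is_derive_cst (0 : R) y v)).
  by rewrite /radial_mul2; have [-> -> ->] := k_small (ltW ya); rewrite !(mul0r, mulr0, addr0).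
have y0 : y != 0 by rewrite -enorm_gt0 (lt_le_trans a0).
have dp := is_deriveM (is_derive_dotl y v v) (is_derive_p v y0).
have d1 := is_deriveM (is_deriveM (is_derive_k v dk1 y0) dp) (is_derive_v0 v y0).
have d2 := is_deriveM (is_derive_k v dk y0) (is_derive_D v y0).
apply: (is_derive_eq (is_deriveD d1 d2)).
rewrite /GRing.scale/= !mulrfctE /= /radial_mul2; ring.
Qed.

Let near_zero_cont (F : vec -> R) y : enorm y < a ->
  (forall z, enorm z <= a -> F z = 0) -> {for y, continuous F}.
Proof.
move=> ya F0; apply: (@near_cst_continuous _ _ 0 F y).
by have := near_small ya; apply: filterS => z /F0.
Qed.

Lemma continuous_radial_mul : continuous radial_mul.
Proof.
move=> y; have [ya|ya] := ltP (enorm y) a.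
  apply: near_zero_cont => // z za.
  by rewrite /radial_mul; have [-> _ _] := k_small za; rewrite mul0r.
have y0 : y != 0 by rewrite -enorm_gt0 (lt_le_trans a0).
have ce := @continuous_enorm R n.+1 y.
have ck : {for y, continuous (fun y => k (enorm y))}.
  apply: (@continuous_comp _ _ _ (@enorm R n.+1) k) => //.
  exact: is_derive1_continuous (dk _).
have cu : {for y, continuous (extend0 u)}.
  by apply: C1_on_continuous => //; case: C2u.
exact: cvgM ck (cvgB cu (cvg_cst _)).
Qed.

Lemma continuous_radial_mul2 v : continuous (radial_mul2 v).
Proof.
move=> y; have [ya|ya] := ltP (enorm y) a.
  apply: near_zero_cont => // z za.
  by rewrite /radial_mul2; have [-> -> ->] := k_small za; rewrite !(mul0r, mulr0, addr0).
have y0 : y != 0 by rewrite -enorm_gt0 (lt_le_trans a0).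
have e0 : enorm y != 0 by rewrite enorm_eq0.
have ce := @continuous_enorm R n.+1 y.
have ck : {for y, continuous (fun y => k (enorm y))}.
  apply: (@continuous_comp _ _ _ (@enorm R n.+1) k) => //.
  exact: is_derive1_continuous (dk _).
have ck1 : {for y, continuous (fun y => k1 (enorm y))}.
  apply: (@continuous_comp _ _ _ (@enorm R n.+1) k1) => //.
  exact: is_derive1_continuous (dk1 _).
have ckk2 : {for y, continuous (fun y => k2 (enorm y))}.
  by apply: (@continuous_comp _ _ _ (@enorm R n.+1) k2) => //; exact: ck2.
have cu : {for y, continuous (extend0 u)}.
  by apply: C1_on_continuous => //; case: C2u.
have cdu i : {for y, continuous (du i)}.
  by apply: C1_on_continuous => //; case: C2u.
have cddu i j : {for y, continuous (ddu i j)}.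
  by have [_ /(_ i)/(_ j y y0)[]] := C2u.
have cp : {for y, continuous p} by exact: cvgV e0 ce.
have cd : {for y, continuous (fun y => dot y v)}.
  apply: (@continuous_dot _ _ _ id (fun=> v) y); first exact: cvg_id.
  exact: cst_continuous.
have cD : {for y, continuous (D v)}.
  apply: continuous_sum_at => i; exact: cvgM (cvg_cst _) (cdu i).
have cDD : {for y, continuous (fun y => ambient_hess u y v v)}.
  apply: continuous_sum_at => i.
  have cs : {for y, continuous (fun y => \sum_j v 0 j * ddu i j y)}.
    by apply: continuous_sum_at => j; exact: cvgM (cvg_cst _) (cddu i j).
  exact: cvgM (cvg_cst _) cs.
have cv0 : {for y, continuous (fun y => extend0 u y - c)} by exact: cvgB cu (cvg_cst _).
have cdp : {for y, continuous (fun y => dot y v * p y)} by exact: cvgM cd cp.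
have t1 : {for y, continuous (fun y => k2 (enorm y) * (dot y v * p y) ^+ 2)}.
  exact: cvgM ckk2 (cvgXn cdp).
have t2 : {for y, continuous (fun y => k1 (enorm y) * (dot v v * p y - dot y v ^+ 2 * p y ^+ 3))}.
  exact: cvgM ck1 (cvgB (cvgM (cvg_cst _) cp) (cvgM (cvgXn cd) (cvgXn cp))).
have t3 : {for y, continuous (fun y => 2 * k1 (enorm y) * (dot y v * p y) * D v y)}.
  exact: cvgM (cvgM (cvgM (cvg_cst _) ck1) cdp) cD.
exact: cvgD (cvgD (cvgM (cvgD t1 t2) cv0) t3) (cvgM ck cDD).
Qed.

Lemma Cc_radial_mul : Cc radial_mul.
Proof.
split; first exact: continuous_radial_mul.
by exists b => y /ltW yb; rewrite /radial_mul; have [-> _ _] := k_large yb; rewrite mul0r.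
Qed.

Lemma Cc_radial_mul2 v : Cc (radial_mul2 v).
Proof.
split; first exact: continuous_radial_mul2.
exists b => y /ltW yb; rewrite /radial_mul2; have [-> -> ->] := k_large yb.
by rewrite !(mul0r, mulr0, addr0).
Qed.

(** The Laplacian in polar coordinates of R^(n+1). The mixed term pairs the radial direction with
    the gradient of a function of degree zero, so Euler's relation removes it. *)
Lemma sum_radial_mul2 y : y != 0 ->
  \sum_i radial_mul2 (basis_vec i) y =
  (k2 (enorm y) + n%:R * (k1 (enorm y) * p y)) * (extend0 u y - c) +
  k (enorm y) * p y ^+ 2 * sphere_laplacian u (normalize y).
Proof.
move=> y0; have e0 : enorm y != 0 by rewrite enorm_eq0.
have E i : radial_mul2 (basis_vec i) y =
    (k2 (enorm y) * p y ^+ 2 - k1 (enorm y) * p y ^+ 3) * (extend0 u y - c) * (y 0 i * y 0 i) +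
    k1 (enorm y) * p y * (extend0 u y - c) +
    2 * k1 (enorm y) * p y * (y 0 i * du i y) + k (enorm y) * ddu i i y.
  have S1 (F : 'I_n.+1 -> R) l : \sum_k basis_vec l 0 k * F k = F l.
    rewrite (bigD1 l)//= !mxE !eqxx mul1r big1 ?addr0// => m ml.
    by rewrite mxE (negPf ml) andbF mul0r.
  rewrite /radial_mul2 /D /ambient_hess !S1 !dot_basis !mxE !eqxx/=; ring.
rewrite (eq_bigr _ (fun i _ => E i)) !big_split/= -!mulr_sumr.
rewrite (euler_extend0 C2u)// (laplacian_extend0 C2u)// mulr0 addr0.
rewrite -/(dot y y) -sqr_enorm sumr_const card_ord -[_ *+ n.+1]mulr_natl -natr1.
rewrite /p; field.
by rewrite e0.
Qed.

End radial_product.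

(** * The Hessian bound *)

Section kernel_integral.
Context {R : realType} {n : nat}.
Local Notation mR := (measurableTypeR R).
Local Notation vec := 'rV[R]_n.+1.
Local Notation mu := (lebesgue_tuple n.+1 : {measure set (n.+1.-tuple mR) -> \bar R}).
Implicit Types (v w x y z : vec).

Lemma acos_nonincreasing (s t : R) : -1 <= s -> t <= 1 -> s <= t -> acos t <= acos s.
Proof.
move=> s1 t1 st; have sB : -1 <= s <= 1 by rewrite s1 (le_trans st).
have tB : -1 <= t <= 1 by rewrite t1 (le_trans s1).
rewrite leNgt; apply/negP => H.
have /andP[a0 a1] : 0 <= acos s <= pi by rewrite acos_ge0// acos_lepi.
have /andP[b0 b1] : 0 <= acos t <= pi by rewrite acos_ge0// acos_lepi.
have : cos (acos t) < cos (acos s) by rewrite ltr_cos// in_itv/= ?a0 ?b0.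
by rewrite !acosK ?in_itv//= ltNge st.
Qed.

(** Measurability of [acos] is drawn from monotonicity, which holds on [-1, 1]; the clamp extends it
    to the line and leaves unchanged the dot products that occur. *)
Let clamp (t : R) : R := Num.max (-1) (Num.min t 1).

Lemma measurable_acos_clamp : measurable_fun setT (acos \o clamp : mR -> mR).
Proof.
apply: nonincreasing_measurable => // s t st; apply: acos_nonincreasing.
- by rewrite le_max lexx.
- by rewrite ge_max ge_min lexx orbT andbT; lra.
- by rewrite ge_max le_max lexx/= le_max le_min !ge_min st lexx !orbT.
Qed.

Lemma dot_normalize_itv y x : enorm x = 1 -> -1 <= dot (normalize y) x <= 1.
Proof.
move=> x1; rewrite -ler_norml; have [->|y0] := eqVneq y 0.
  by rewrite /normalize scaler0 dot0l normr0.
by apply: le_trans (ler_dot_enorm _ _) _; rewrite x1 enorm_normalize// mulr1.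
Qed.

Definition hkernel (alpha : R) x y : R :=
  enorm (y - x) ^- n.+1 * (enorm y)^-1 * sphere_dist (normalize y) x `^ alpha.

Lemma hkernel_ge0 alpha x y : 0 <= hkernel alpha x y.
Proof. by rewrite !mulr_ge0 ?powR_ge0 ?invr_ge0 ?exprn_ge0 ?enorm_ge0. Qed.

Lemma measurable_hkernel alpha x : enorm x = 1 ->
  measurable_fun setT (hkernel alpha x \o row_of_tuple).
Proof.
move=> x1; apply: measurable_funM; first apply: measurable_funM.
- exact: measurable_inv_enorm.
- apply: (@eq_measurable_fun _ _ _ _ _ (fun t => enorm (row_of_tuple t - (0 : vec)) ^- 1)).
    by move=> t _; rewrite subr0 expr1.
  exact: measurable_inv_enorm.
apply: (@measurableT_comp _ _ _ _ _ _ (fun s => s `^ alpha)); first exact: measurable_powR.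
apply: (@eq_measurable_fun _ _ _ _ _ ((acos \o clamp) \o
    (fun t => enorm (row_of_tuple t - (0 : vec)) ^- 1 * dot (row_of_tuple t) x))).
  move=> t _ /=; rewrite /sphere_dist subr0 expr1 -dotZl -/(normalize _).
  have /andP[h1 h2] := dot_normalize_itv (row_of_tuple t) x1.
  by congr acos; rewrite /clamp (min_idPl h2); apply/max_idPr.
apply: measurableT_comp; first exact: measurable_acos_clamp.
apply: measurable_funM; first exact: measurable_inv_enorm.
apply: (@continuous_measurable_rV R n.+1 (fun y => dot y x)) => y.
apply: (@continuous_dot _ _ _ id (fun=> x) y); first exact: cvg_id.
exact: cst_continuous.
Qed.

(** The Householder reflection in the hyperplane orthogonal to [x - z]. *)
Lemma reflection x z : enorm x = 1 -> enorm z = 1 ->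
  exists2 A : 'M[R]_n.+1, A *m A^T = 1%:M & x *m A = z.
Proof.
move=> x1 z1; have [->|xz] := eqVneq x z.
  by exists 1%:M; rewrite ?trmx1 mulmx1.
have xx : dot x x = 1 by rewrite -sqr_enorm x1 expr1n.
have zz : dot z z = 1 by rewrite -sqr_enorm z1 expr1n.
pose w := x - z; pose s := 2 / dot w w.
have w0 : dot w w != 0 by rewrite -sqr_enorm sqrf_eq0 enorm_eq0 subr_eq0.
(* This is where equal norms enter: [x] is then moved by exactly [- w], that is, to [z]. *)
have wwE : dot w w = 2 * dot x w.
  by rewrite /w dotBl !dotBr xx zz (dotC z x); ring.
pose P : 'M[R]_n.+1 := w^T *m w.
have PT : P^T = P by rewrite /P trmx_mul trmxK.
have PP : P *m P = dot w w *: P.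
  by rewrite /P mulmxA -(mulmxA w^T) [w *m w^T]mx11_scalar -dotE mul_mx_scalar -scalemxAl.
exists (1%:M - s *: P).
  have AT : (1%:M - s *: P)^T = 1%:M - s *: P.
    by apply/matrixP => i j; have := congr1 (fun M : 'M[R]_n.+1 => M i j) PT;
      rewrite !mxE => ->; rewrite eq_sym.
  rewrite AT mulmxBr mulmx1 mulmxBl mul1mx.
  rewrite -scalemxAr -scalemxAl PP !scalerA.
  have -> : s * s * dot w w = s + s by rewrite /s; field.
  by rewrite scalerDl opprB addrK subrK.
rewrite mulmxBr mulmx1 -scalemxAr /P mulmxA [x *m w^T]mx11_scalar -dotE mul_scalar_mx scalerA.
have -> : s * dot x w = 1 by rewrite /s wwE; field; move: w0; rewrite wwE mulf_eq0 negb_or => /andP[].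
by rewrite scale1r /w opprB addrC subrK.
Qed.

Lemma integral_hkernel alpha x : enorm x = 1 ->
  (\int[mu]_t (hkernel alpha x (row_of_tuple t))%:E)%E = @gamma_integral R n alpha.
Proof.
move=> x1; have e1 : enorm (north_pole : vec) = 1.
  by rewrite /enorm dot_basis mxE !eqxx sqrtr1.
have [A AA xA] := reflection x1 e1.
have AA' := mulmx1C AA.
have dA y z : dot (y *m A) (z *m A) = dot y z.
  by rewrite !dotE trmx_mul mulmxA -(mulmxA y) AA mulmx1.
have eA y : enorm (y *m A) = enorm y by rewrite /enorm dA.
transitivity (\int[mu]_t (hkernel alpha north_pole (row_of_tuple t *m A))%:E)%E.
  apply: eq_integral => t _; move: (row_of_tuple t) => y; congr EFin.
  rewrite /hkernel -xA -mulmxBl !eA; congr (_ * _ `^ _).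
  by rewrite /sphere_dist; congr acos; rewrite /normalize eA scalemxAl dA.
rewrite (ge0_integral_isometry (F := fun y => (hkernel alpha north_pole y)%:E) AA)//.
- by apply/measurable_EFinP; exact: measurable_hkernel.
- by move=> y; rewrite lee_fin hkernel_ge0.
Qed.

End kernel_integral.

(** * Removing the cutoff *)

Section hessian_bound.
Context {R : realType} {n : nat}.
Local Notation mR := (measurableTypeR R).
Local Notation vec := 'rV[R]_n.+1.
Local Notation mu := (lebesgue_tuple n.+1 : {measure set (n.+1.-tuple mR) -> \bar R}).
Variables (f u : vec -> R) (alpha A : R) (x v : vec).
Hypothesis n2 : (2 <= n)%N.
Hypothesis C2u : C2_sphere u.
Hypothesis eq_u : forall x, sphere n x -> sphere_laplacian u x + n%:R * u x = f x.
Hypothesis xS : sphere n x.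
Hypothesis A0 : 0 <= A.
Hypothesis alpha0 : 0 < alpha.
Hypothesis f_holder : forall z, sphere n z -> `|f z - f x| <= A * sphere_dist z x `^ alpha.
Hypothesis xv : tangent x v.
Hypothesis v1 : enorm v = 1.

Local Notation c := (f x / n%:R).
Local Notation V := (fine (mu (eball 1%R))).

Let n0 : n%:R != 0 :> R. Proof. by rewrite pnatr_eq0 -lt0n ltnW. Qed.

Lemma extend0_bounded : exists2 M : R, 0 <= M & forall y, y != 0 -> `|extend0 u y - c| <= M.
Proof.
have cS : compact (sphere n : set vec).
  apply: (@subclosed_compact _ _ [set y : vec | enorm y <= 1]).
  - rewrite (_ : sphere n = @enorm R n.+1 @^-1` [set r | r = 1])//.
    by apply: closed_comp; [move=> y _; exact: continuous_enorm|exact: closed_eq].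
  - exact: compact_eball.
  - by move=> y /= ->.
have [|M M0 HM] := @bounded_on_compact _ _ _ (fun y => extend0 u y - c) cS.
  move=> y /set_mem yS.
  have cu : {for y, continuous (extend0 u)}.
    by apply: C1_on_continuous; [case: C2u|exact: sphere_neq0].
  exact: cvgB cu (cvg_cst _).
exists M => // y y0; have := HM (normalize y) (enorm_normalize y0).
by rewrite /extend0/= normalize_sphere// enorm_normalize.
Qed.

(** Near radius 1 the cutoff is the identity, with value, first and second derivative 1, 1, 0. The
    term with the first derivative produces [u x - c], the zeroth-order part of the convexity
    condition. *)
Lemma radial_mul2_pole L : 2 <= L ->
  radial_mul2 u c (cutid L) (cutid1 L) (cutid2 L) v x = sphere_hess u x v v + u x - c.
Proof.
move=> L2; have L0 : 0 < L by apply: lt_le_trans L2.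
have [e1 e2 e3] : [/\ chi L 1 = 1, chi1 L 1 = 0 & chi2 L 1 = 0].
  by apply: chi_mid => //; [rewrite ler_pdivrMr// mul1r|rewrite (le_trans _ L2)// ler1n].
rewrite /radial_mul2 (_ : enorm x = 1)// /cutid2 /cutid1 /cutid e1 e2 e3.
have -> : dot x v = 0 by exact: xv.
have -> : dot v v = 1 by rewrite -sqr_enorm v1 expr1n.
rewrite -sphere_hessE// /extend0/= normalize_sphere// invr1; ring.
Qed.

Lemma laplacian_cutoff_bound (L M : R) (y : vec) : 2 <= L ->
  (forall y, y != 0 -> `|extend0 u y - c| <= M) ->
  `|\sum_i radial_mul2 u c (cutid L) (cutid1 L) (cutid2 L) (basis_vec i) y| <=
  A * ((enorm y)^-1 * sphere_dist (normalize y) x `^ alpha) +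
  (9 * (n + 2)%:R + 144) * M * (L * (nat_of_bool (enorm y <= 2 * L^-1))%:R
     + L^-1 * (nat_of_bool (L <= enorm y <= 2 * L))%:R).
Proof.
move=> L2 uM; have L0 : 0 < L by apply: lt_le_trans L2.
have M0 : 0 <= M.
  by apply: le_trans (uM x _); rewrite ?normr_ge0//; exact: sphere_neq0.
have B0 : 0 <= L * (nat_of_bool (enorm y <= 2 * L^-1))%:R
     + L^-1 * (nat_of_bool (L <= enorm y <= 2 * L))%:R :> R.
  by rewrite addr_ge0// mulr_ge0// ?invr_ge0 ltW.
have K0 : 0 <= 9 * (n + 2)%:R + 144 :> R by rewrite addr_ge0// mulr_ge0.
(* Inside the hole of the cutoff, which contains the origin, all terms vanish. *)
have [ya|ya] := leP (enorm y) L^-1.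
  rewrite big1 ?normr0.
    by rewrite addr_ge0// !mulr_ge0// ?powR_ge0// invr_ge0 enorm_ge0.
  move=> i _; rewrite /radial_mul2 /cutid /cutid1 /cutid2.
  have [-> -> ->] := chi_small L2 ya; rewrite !(mul0r, mulr0, addr0)//.
have y0 : y != 0 by rewrite -enorm_gt0 (lt_trans _ ya)// invr_gt0.
have p : 0 < enorm y by rewrite enorm_gt0.
have e0 : enorm y != 0 by rewrite enorm_eq0.
rewrite (sum_radial_mul2 _ _ _ _ C2u y0).
have nS := enorm_normalize y0.
have lap : sphere_laplacian u (normalize y) = f (normalize y) - n%:R * extend0 u y.
  by rewrite /extend0/= -(eq_u nS) addrK.
(* The terms in [u] without a derivative of [chi] cancel by the equation, and n c = f x. In the
   coefficient n + 2, n comes from the radial Laplacian and 2 from differentiating [r * chi r]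
   twice. *)
have -> : (cutid2 L (enorm y) + n%:R * (cutid1 L (enorm y) * (enorm y)^-1)) * (extend0 u y - c) +
    cutid L (enorm y) * (enorm y)^-1 ^+ 2 * sphere_laplacian u (normalize y) =
    chi L (enorm y) * (enorm y)^-1 * (f (normalize y) - f x) +
    ((n + 2)%:R * chi1 L (enorm y) + enorm y * chi2 L (enorm y)) * (extend0 u y - c).
  rewrite lap /cutid2 /cutid1 /cutid natrD; field.
  by rewrite e0 n0.
apply: le_trans (ler_normD _ _) _; apply: lerD.
  have p' : 0 <= (enorm y)^-1 by rewrite invr_ge0 ltW.
  rewrite normrM normrM (ger0_norm p') (mulrCA A); apply: ler_pM => //.
  - exact: mulr_ge0.
  - by rewrite ler_piMl// ler_chi.
  - exact: f_holder.
rewrite normrM -mulrA (mulrC M) mulrA; apply: ler_pM => //; last exact: uM.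
exact: chi_error.
Qed.

Lemma hessian_bound :
  ((V * `|sphere_hess u x v v + u x - c|)%:E <= A%:E * @gamma_integral R n alpha)%E.
Proof.
have [M M0 uM] := extend0_bounded.
have x1 : enorm x = 1 by exact: xS.
pose K : R := (9 * (n + 2)%:R + 144) * M.
have K0 : 0 <= K by rewrite mulr_ge0// addr_ge0// mulr_ge0.
have V0 : 0 < V by rewrite fine_gt0// volume_eball1_gt0 volume_eball1_lty.
have VE : mu (eball 1%R) = V%:E by rewrite fineK// ge0_fin_numE// volume_eball1_lty.
apply/lee_addgt0Pr => e e0.
(* One power of 2 bounds the kernel on the ramps, the other comes from the radii 2/L and 2L of the
   balls containing them; the last 2 counts the ramps. *)
pose B : R := K * 2 ^+ n.+1 * 2 ^+ n.+1 * V * 2.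
have B0 : 0 <= B by rewrite !mulr_ge0// ?exprn_ge0// ltW.
(* The value 4 keeps both ramps away from the unit sphere: 2/L <= 1/2, and L - 1 >= L/2. *)
pose L : R := Num.max 4 (B / e).
have L4 : 4 <= L by rewrite le_max lexx.
have L2 : 2 <= L by apply: le_trans L4; rewrite ler_nat.
have L0 : 0 < L by apply: lt_le_trans L2.
have Li0 : 0 <= L^-1 by rewrite invr_ge0 ltW.
have LB : B * L^-1 <= e.
  by rewrite ler_pdivrMr// mulrC -ler_pdivrMr// le_max lexx orbT.
rewrite -(radial_mul2_pole L2).
have dk := is_derive_cutid L; have dk1 := is_derive_cutid1 L.
have ck2 := @continuous_cutid2 R L.
have Li : 0 < L^-1 by rewrite invr_gt0.
have ks r : r <= L^-1 -> [/\ cutid L r = 0, cutid1 L r = 0 & cutid2 L r = 0].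
  by move=> /(chi_small L2); rewrite /cutid /cutid1 /cutid2 => -[-> -> ->]; rewrite !mulr0 addr0.
have kl r : 2 * L <= r -> [/\ cutid L r = 0, cutid1 L r = 0 & cutid2 L r = 0].
  by move=> /(chi_large L2); rewrite /cutid /cutid1 /cutid2 => -[-> -> ->]; rewrite !mulr0 addr0.
pose Wb i := radial_mul2 u c (cutid L) (cutid1 L) (cutid2 L) (basis_vec i).
(* The pointwise bound itself gives 0 at [x]: the distance term is a positive power of 0, and no
   ramp meets radius 1. *)
have Lx : \sum_i Wb i x = 0.
  have := laplacian_cutoff_bound x L2 uM.
  have xx : dot x x = 1 by rewrite -sqr_enorm x1 expr1n.
  rewrite x1 normalize_sphere// /sphere_dist xx acos1 powR0 ?gt_eqF// !mulr0 add0r.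
  have -> : (1 <= 2 * L^-1) = false.
    by apply/negbTE; rewrite -ltNge ltr_pdivrMr// mul1r (lt_le_trans _ L4)// ltr_nat.
  have -> : (L <= 1 <= 2 * L) = false.
    by apply/negbTE; rewrite negb_and -ltNge (lt_le_trans _ L4)// ltr1n.
  by rewrite !mulr0 addr0 mulr0 normr_le0 => /eqP.
have cW : Cc (radial_mul u c (cutid L)) by exact: Cc_radial_mul C2u dk Li ks kl.
have lW w : line_C2 w (radial_mul u c (cutid L)) (radial_mul2 u c (cutid L) (cutid1 L) (cutid2 L) w).
  exact: radial_mul_line_C2 C2u dk dk1 Li ks w.
have cW2 w : Cc (radial_mul2 u c (cutid L) (cutid1 L) (cutid2 L) w).
  exact: Cc_radial_mul2 C2u dk dk1 ck2 Li ks kl w.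
apply: le_trans (second_derivative_bound n2 cW v1 (lW v) (cW2 v)
  (fun i => lW (basis_vec i)) (fun i => cW2 (basis_vec i)) Lx) _.
pose D : R := K * 2 ^+ n.+1.
(* The three terms are the integrand of gamma, the inner ramp and the outer ramp. *)
pose G (t : n.+1.-tuple mR) : \bar R := (A%:E * (hkernel alpha x (row_of_tuple t))%:E +
  ((D * L)%:E * (\1_(eball (2 * L^-1)) t)%:E +
    (D * L^-1 * L ^- n.+1)%:E * (\1_(eball (2 * L)) t)%:E))%E.
have D0 : 0 <= D by rewrite mulr_ge0// exprn_ge0.
have mi r : measurable_fun setT (EFin \o (\1_(@eball R n.+1 r) : _ -> R)).
  by apply/measurable_EFinP; apply: measurable_indic; exact: measurable_eball.
have mh : measurable_fun setT (EFin \o (hkernel alpha x \o row_of_tuple)).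
  by apply/measurable_EFinP; exact: measurable_hkernel.
have Ln : 0 <= L ^- n.+1 by rewrite invr_ge0 exprn_ge0// ltW.
have near_q y : enorm y <= 2 * L^-1 -> enorm (y - x) ^- n.+1 <= 2 ^+ n.+1.
  move=> yL; rewrite -exprVn; apply: lerXn2r; rewrite ?nnegrE ?invr_ge0 ?enorm_ge0//.
  have L24 : 2 * L^-1 <= 2^-1 by rewrite ler_pdivrMr// -ler_pdivrMl ?invr_gt0// invrK -natrM.
  have H : 2^-1 <= enorm (y - x).
    rewrite -(enormN (y - x)) opprB; apply: le_trans (ler_enormB _ _).
    rewrite x1; lra.
  have Hp : 0 < enorm (y - x) by apply: lt_le_trans H; rewrite invr_gt0.
  by rewrite invf_ple ?posrE.
have far_q y : L <= enorm y -> enorm (y - x) ^- n.+1 <= 2 ^+ n.+1 * L ^- n.+1.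
  move=> yL; rewrite -!exprVn -exprMn; apply: lerXn2r; rewrite ?nnegrE ?mulr_ge0
      ?invr_ge0 ?enorm_ge0 ?(ltW L0)//.
  have H : L / 2 <= enorm (y - x).
    by apply: le_trans (ler_enormB _ _); rewrite x1; lra.
  have Hp : 0 < enorm (y - x) by apply: lt_le_trans H; rewrite divr_gt0.
  by rewrite -invf_div lef_pV2 ?posrE// divr_gt0.
have ptw y : `|\sum_i Wb i y| * enorm (y - x) ^- n.+1 <= A * hkernel alpha x y +
    (D * L * (nat_of_bool (enorm y <= 2 * L^-1))%:R +
     D * L^-1 * L ^- n.+1 * (nat_of_bool (enorm y <= 2 * L))%:R).
  have q0 : 0 <= enorm (y - x) ^- n.+1 by rewrite invr_ge0 exprn_ge0// enorm_ge0.
  apply: le_trans (ler_wpM2r q0 (laplacian_cutoff_bound y L2 uM)) _.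
  rewrite -/K mulrDl; apply: lerD.
    by rewrite le_eqVlt; apply/orP; left; apply/eqP; rewrite /hkernel; ring.
  rewrite mulrDr mulrDl; apply: lerD.
    have [/near_q h|_] := leP (enorm y) (2 * L^-1); last by rewrite !mulr0 mul0r.
    rewrite !mulr1 /D mulrAC; apply: ler_wpM2r; first exact: ltW.
    exact: ler_wpM2l.
  have [/far_q h|_] := leP L (enorm y); last first.
    by rewrite /= !mulr0 mul0r !mulr_ge0.
  case: (_ <= 2 * L); last by rewrite !mulr0 mul0r.
  rewrite !mulr1 /D (_ : K * 2 ^+ n.+1 * L^-1 * L ^- n.+1 = K * L^-1 * (2 ^+ n.+1 * L ^- n.+1)).
    by apply: ler_wpM2l => //; exact: mulr_ge0.
  by ring.
have indE r t : \1_(@eball R n.+1 r) t = (nat_of_bool (enorm (row_of_tuple t) <= r))%:R :> R.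
  by rewrite indicE; congr (nat_of_bool _)%:R; apply/idP/idP; rewrite inE.
have DL0 : 0 <= D * L by rewrite mulr_ge0// ltW.
have DLL0 : 0 <= D * L^-1 * L ^- n.+1 by rewrite !mulr_ge0.
have mc (r : \bar R) F : measurable_fun setT F -> measurable_fun setT (fun t : n.+1.-tuple mR => r * F t)%E.
  exact: measurable_funeM.
have m1 := mc A%:E _ mh.
have m2 := mc (D * L)%:E _ (mi (2 * L^-1)).
have m3 := mc (D * L^-1 * L ^- n.+1)%:E _ (mi (2 * L)).
have m23 := emeasurable_funD m2 m3.
apply: (@le_trans _ _ (\int[mu]_t G t)%E).
  apply: ge0_le_integral => //.
  - by move=> t _; rewrite lee_fin mulr_ge0// invr_ge0 exprn_ge0// enorm_ge0.
  - apply/measurable_EFinP; apply: measurable_funM; last exact: measurable_inv_enorm.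
    apply: measurableT_comp => //.
    apply: (@continuous_measurable_rV R n.+1 (fun y => \sum_i Wb i y)).
    by move=> y; apply: continuous_sum_at => i; have [cWb _] := cW2 (basis_vec i); exact: cWb.
  - exact: emeasurable_funD.
  - by move=> t _; rewrite /G !indE -!EFinM -!EFinD lee_fin; exact: ptw.
rewrite /G ge0_integralD//; last 2 first.
- by move=> t _; rewrite mule_ge0// lee_fin// hkernel_ge0.
- by move=> t _; rewrite adde_ge0// mule_ge0// lee_fin.
rewrite ge0_integralZl//; last by move=> t _; rewrite lee_fin hkernel_ge0.
rewrite integral_hkernel//; apply: leeD2l.
rewrite ge0_integralD//; last 2 first.
- by move=> t _; rewrite mule_ge0// lee_fin.
- by move=> t _; rewrite mule_ge0// lee_fin.
have Ii r : (\int[mu]_t (\1_(@eball R n.+1 r) t)%:E = mu (eball r))%E.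
  by rewrite integral_indic ?setIT//; exact: measurable_eball.
have I3 r k : 0 <= k -> (\int[mu]_t (k%:E * (\1_(@eball R n.+1 r) t)%:E) = k%:E * mu (eball r))%E.
  move=> k0; rewrite -Ii.
  by apply: (@ge0_integralZl _ _ _ mu setT measurableT _ (mi r)) => // t _; rewrite lee_fin.
have Iv r k : 0 < r -> 0 <= k ->
    (\int[mu]_t (k%:E * (\1_(@eball R n.+1 r) t)%:E) = (k * (r ^+ n.+1 * V))%:E)%E.
  by move=> r0 k0; rewrite I3// volume_eball//; move: VE; case: (mu (eball 1%R)).
have two0 : 0 < 2 :> R by [].
rewrite (Iv _ _ (mulr_gt0 two0 Li) DL0) (Iv _ _ (mulr_gt0 two0 L0) DLL0) -EFinD lee_fin.
apply: le_trans LB.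
(* Inner ramp: L times a volume of order L^(-n-1). Outer ramp: L^(-1) times the kernel L^(-n-1)
   times a volume of order L^(n+1). *)
have -> : D * L * ((2 * L^-1) ^+ n.+1 * V) + D * L^-1 * L ^- n.+1 * ((2 * L) ^+ n.+1 * V) =
    K * 2 ^+ n.+1 * 2 ^+ n.+1 * V * (L ^- n + L^-1).
  rewrite /D !exprMn exprVn [L ^+ n.+1]exprS; field.
  by rewrite expf_neq0 gt_eqF.
rewrite /B -(mulrA _ 2 L^-1) ler_wpM2l//.
  by rewrite !mulr_ge0// ?exprn_ge0// ltW.
rewrite mulr2n mulrDl mul1r lerD2r -exprVn.
rewrite -[leRHS]expr1 ler_wiXn2l//; last exact: ltnW.
by rewrite invf_le1// (le_trans _ L4)// ler1n.
Qed.

End hessian_bound.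

(** * From the Hessian bound to convexity *)

Section convexity.
Context {R : realType} {n : nat}.
Local Notation mR := (measurableTypeR R).
Local Notation vec := 'rV[R]_n.+1.
Local Notation mu := (lebesgue_tuple n.+1 : {measure set (n.+1.-tuple mR) -> \bar R}).

Lemma sphere_dist_gt0 (x z : vec) : sphere n x -> sphere n z -> x <> z ->
  0 < sphere_dist x z.
Proof.
move=> xS zS /eqP xz.
have : 0 < dot (x - z) (x - z) by rewrite -sqr_enorm exprn_gt0// enorm_gt0 subr_eq0.
rewrite dotBl !dotBr (dotC z x) !sphere_dot// => xz1.
have := ler_dot_enorm x z; rewrite xS zS mulr1 ler_norml => /andP[xzN _].
by apply: acos_gt0; rewrite xzN/=; lra.
Qed.

Lemma holder_seminorm_le (alpha A : R) (f : vec -> R) (x z : vec) :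
  (holder_seminorm alpha f <= A%:E)%E -> sphere n x -> sphere n z ->
  0 <= A -> `|f x - f z| <= A * sphere_dist x z `^ alpha.
Proof.
move=> fA xS zS A0; have [->|/eqP xz] := eqVneq x z.
  by rewrite subrr normr0 mulr_ge0// powR_ge0.
rewrite -ler_pdivrMr ?powR_gt0 ?sphere_dist_gt0//.
by rewrite -lee_fin; apply: le_trans fA; apply: ereal_sup_ubound; exists x, z.
Qed.

Lemma sphere_north_pole : sphere n (north_pole : vec).
Proof. by rewrite /sphere/= /enorm dot_basis mxE !eqxx sqrtr1. Qed.

Lemma sphere_min_ge0 (f : vec -> R) : (forall x, sphere n x -> 0 < f x) ->
  0 <= sphere_min f.
Proof.
move=> f0; apply: lb_le_inf; last by move=> _ [x xS <-]; exact/ltW/f0.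
by exists (f north_pole), north_pole => //; exact: sphere_north_pole.
Qed.

Lemma sphere_min_le (f : vec -> R) x : (forall x, sphere n x -> 0 < f x) ->
  sphere n x -> sphere_min f <= f x.
Proof.
move=> f0 xS; apply: ge_inf; last by exists x.
by exists 0 => _ [z zS <-]; exact/ltW/f0.
Qed.

Lemma gamma_integral_ge0 (alpha : R) : (0 <= @gamma_integral R n alpha)%E.
Proof.
by apply: integral_ge0 => t _; rewrite lee_fin; exact: (hkernel_ge0 alpha north_pole).
Qed.

Lemma gamma_const_ge0 (alpha : R) : 0 <= gamma_const n alpha.
Proof.
apply: mulr_ge0; first by rewrite divr_ge0// ltW// sphere_area_gt0.
by rewrite invr_ge0 fine_ge0// gamma_integral_ge0.
Qed.

(* Holds also when the integral is infinite, since then [gamma_const] is the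
   junk value 0. *)
Lemma gamma_const_integral (alpha : R) :
  ((gamma_const n alpha)%:E * @gamma_integral R n alpha <=
   (sphere_area n / (n * n.+1)%:R)%:E)%E.
Proof.
have q0 : 0 <= sphere_area n / (n * n.+1)%:R :> R by rewrite divr_ge0// ltW// sphere_area_gt0.
rewrite /gamma_const; have := gamma_integral_ge0 alpha.
case: gamma_integral => [r r0|_|//]; last by rewrite /= invr0 mulr0 mul0e lee_fin.
rewrite -EFinM lee_fin /=; have [->|r1] := eqVneq r 0; first by rewrite mulr0.
by rewrite divfK.
Qed.

Lemma volume_eball1_fine_gt0 : 0 < fine (mu (eball 1%R)).
Proof. by rewrite fine_gt0// volume_eball1_gt0 volume_eball1_lty. Qed.

(** The area is defined through the punctured ball, the Hessian bound through the closed one;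
    monotonicity gives the direction in which the area estimates the volume from below. *)
Lemma sphere_area_le : sphere_area n <= n.+1%:R * fine (mu (eball 1%R)).
Proof.
rewrite sphere_areaE ler_wpM2l// fine_le ?volume_peball_le//.
  by rewrite ge0_fin_numE// volume_peball_lty.
by rewrite ge0_fin_numE// volume_eball1_lty.
Qed.

Lemma sphere_hessZ (u : vec -> R) x v : C2_sphere u -> sphere n x -> tangent x v ->
  forall a, sphere_hess u x (a *: v) (a *: v) = a ^+ 2 * sphere_hess u x v v.
Proof.
move=> C2u xS xv a.
have xav : tangent x (a *: v) by rewrite /tangent dotZr xv mulr0.
rewrite !(sphere_hessE C2u)// /ambient_hess mulr_sumr; apply: eq_bigr => i _.
under eq_bigr => j _ do rewrite mxE -mulrA.
by rewrite -mulr_sumr mxE; ring.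
Qed.

End convexity.

Theorem theorem3p2 (R : realType) (n : nat) (alpha : R)
    (f u : 'rV[R]_n.+1 -> R) :
  (2 <= n)%N ->
  0 < alpha < 1 ->
  (holder_seminorm alpha f < +oo)%E ->
  (forall x, sphere n x -> 0 < f x) ->
  C2_sphere u ->
  (forall x, sphere n x -> sphere_laplacian u x + n%:R * u x = f x) ->
  (holder_seminorm alpha f <= (gamma_const n alpha * sphere_min f)%:E)%E ->
  sphere_convex u.
Proof.
move=> n2 /andP[alpha0 _] _ f0 C2u eq_u holder_f.
have unit_case x xi : sphere n x -> tangent x xi -> enorm xi = 1 ->
    0 <= sphere_hess u x xi xi + u x.
  move=> xS xxi xi1.
  (* The Hessian bound is applied with the right-hand side of the hypothesis as Hoelder constant, in
     place of the seminorm itself. *)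
  have A0 : 0 <= gamma_const n alpha * sphere_min f.
    by rewrite mulr_ge0 ?gamma_const_ge0 ?sphere_min_ge0.
  have := hessian_bound n2 C2u eq_u xS A0 alpha0
    (fun z zS => holder_seminorm_le holder_f zS xS A0) xxi xi1.
  set H := sphere_hess u x xi xi + u x.
  rewrite [_ * sphere_min f]mulrC [(_ * gamma_const _ _)%:E]EFinM -muleA => HA.
  have m0 : (0 <= (sphere_min f)%:E)%E by rewrite lee_fin sphere_min_ge0.
  have := le_trans HA (lee_wpmul2l m0 (gamma_const_integral alpha)).
  have := sphere_min_le f0 xS.
  have := @sphere_area_le R n; have := @volume_eball1_fine_gt0 R n.
  rewrite -EFinM lee_fin.
  have := sphere_min_ge0 f0; have := @sphere_area_gt0 R n.
  move: (fine _) (sphere_area n) (sphere_min f) => V s m s0 m_ge0 V0 sV mf.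
  have n0 : 0 < n%:R :> R by rewrite ltr0n ltnW.
  have {}sV : s / (n * n.+1)%:R <= V / n%:R.
    rewrite natrM invfM mulrCA [leRHS]mulrC ler_wpM2l ?invr_ge0//.
    by rewrite ler_pdivrMr// mulrC.
  (* The number [H] is within c of c = f x / n, hence nonnegative. *)
  move=> VH; have : V * `|H - f x / n%:R| <= V * (f x / n%:R).
    apply: le_trans VH _; rewrite [leRHS]mulrCA ler_pM//; apply: divr_ge0 => //; exact: ltW.
  rewrite ler_pM2l// ler_norml => /andP[+ _]; lra.
move=> x v xS xv; have [->|v0] := eqVneq v 0.
  have := sphere_hessZ C2u xS xv 0; rewrite scale0r expr0n mul0r => ->.
  by rewrite dot0r mulr0 addr0.
(* Both terms of the convexity condition are quadratic in [v], which reduces it to unit tangent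
   vectors. *)
have vE : v = enorm v *: normalize v.
  by rewrite scalerA divff ?scale1r// enorm_eq0.
have xi : tangent x (normalize v) by rewrite /tangent dotZr xv mulr0.
rewrite -sqr_enorm {1 2}vE (sphere_hessZ C2u)// mulrC -mulrDl.
by rewrite mulr_ge0 ?sqr_ge0// unit_case// enorm_normalize.
Qed.
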